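(* Let $\Omega\subseteq\mathbb{H}$ be a non-empty circular domain, and suppose that each connected component of $\Omega_I=\Omega\cap\mathbb{C}_I$ is simply connected for some (and hence any) $I\in\mathbb{S}$. Given $h\in\mathcal{SR}_{\mathbb{R}}(\Omega)\setminus\{0\}$, there exists $f\in\mathcal{SR}_{\mathbb{R}}(\Omega)$ such that $f^2=h$ if and only if both of the following hold: (i) the zero set of $h$ consists of real zeroes of even isolated multiplicity and isolated spheres $\mathbb{S}_q$ with spherical multiplicity a multiple of $4$; (ii) if $\Omega\cap\mathbb{R}\neq\emptyset$ then $h(\Omega\cap\mathbb{R})\subseteq[0,+\infty)$.
   Context: $\mathbb{H}$ is the algebra of quaternions (with the Euclidean topology of $\mathbb{R}^4$), $\mathbb{S}=\{q\in\mathbb{H}: q^2=-1\}$, and $\mathbb{C}_I=\mathrm{Span}_{\mathbb{R}}(1,I)$ for $I\in\mathbb{S}$. For $D\subseteq\mathbb{C}=\{\alpha+\imath\beta:\alpha,\beta\in\mathbb{R}\}$ invariant under complex conjugation, $\Omega_D=\{\alpha+\beta I:\alpha+\imath\beta\in D,\ I\in\mathbb{S}\}$; sets of this form are called circular, and a circular domain is a connected open circular subset of $\mathbb{H}$. For $q=\alpha+\beta I$, $\mathbb{S}_q=\{\alpha+\beta J: J\in\mathbb{S}\}$. A stem function is $F=F_1+\imath F_2:D\to\mathbb{H}\otimes_{\mathbb{R}}\mathbb{C}$ ($F_1,F_2$ $\mathbb{H}$-valued) with $F(\overline z)=\overline{F(z)}$, where $\overline{p+\imath q}=p-\imath q$.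 It induces the slice function $f=\mathcal{I}(F):\Omega_D\to\mathbb{H}$, $f(\alpha+\beta I)=F_1(\alpha+\imath\beta)+I F_2(\alpha+\imath\beta)$. On a circular domain $\Omega=\Omega_D$, $f=\mathcal I(F)$ is slice-regular if $F$ is holomorphic for the natural complex structures of $\mathbb{C}$ and $\mathbb{H}\otimes_{\mathbb{R}}\mathbb{C}$; $\mathcal{SR}(\Omega)$ is the set of slice-regular functions, and $\mathcal{SR}_{\mathbb{R}}(\Omega)$ is the subset of slice-preserving ones, i.e. those with $F_1,F_2$ real-valued. The $*$-product is $\mathcal I(F)*\mathcal I(G)=\mathcal I(FG)$, with $(p+\imath q)(p'+\imath q')=pp'-qq'+\imath(pq'+qp')$; if one factor is slice-preserving it is the pointwise product, so $f^2$ is the pointwise square. Multiplicities: let $h\in\mathcal{SR}(\Omega)$. For a sphere $\mathbb{S}_{x+yI}\subset\Omega$ with $y\ne0$, if $h(q)=\big((q-x)^2+y^2\big)^m (q-p_1)*\cdots*(q-p_n)*g(q)$ with $m,n\geq 0$, $p_1,\dots,p_n\in\mathbb{S}_{x+yI}$, $p_{\ell}\neq\overline{p_{\ell+1}}$ for all $\ell$, and $g\in\mathcal{SR}(\Omega)$ without zeroes in $\mathbb{S}_{x+yI}$, then $2m$ is the spherical multiplicity of $\mathbb{S}_{x+yI}$ and, if $n>0$, $n$ is the isolated multiplicity of $p_1$. For a real point $x\in\Omega$, if $h(q)=(q-x)^n g(q)$ with $g\in\mathcal{SR}(\Omega)$, $g(x)\neq0$, then $n$ is the isolated multiplicity of $x$.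 *)

(* Defs.v *)
From Stdlib Require Import Reals List Arith.
From Coquelicot Require Import Coquelicot.

Open Scope R_scope.

(* (((a, b), c), d) stands for a + b i + c j + d k.  The additive group and
   the topology are those of the product R^4. *)
Definition Quat : Type := (R * R * R * R)%type.

Definition quat (a b c d : R) : Quat := (a, b, c, d).
Definition q_re (q : Quat) : R := fst (fst (fst q)).
Definition q_i (q : Quat) : R := snd (fst (fst q)).
Definition q_j (q : Quat) : R := snd (fst q).
Definition q_k (q : Quat) : R := snd q.

Canonical Quat_UniformSpace : UniformSpace :=
  UniformSpace.Pack Quat
    (UniformSpace.class
       (prod_UniformSpace
          (prod_UniformSpace (prod_UniformSpace R_UniformSpace R_UniformSpace)
             R_UniformSpace) R_UniformSpace)) Quat.

Canonical Quat_AbelianGroup : AbelianGroup :=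
  AbelianGroup.Pack Quat
    (AbelianGroup.class
       (prod_AbelianGroup
          (prod_AbelianGroup (prod_AbelianGroup R_AbelianGroup R_AbelianGroup)
             R_AbelianGroup) R_AbelianGroup)) Quat.

Definition Qmult (p q : Quat) : Quat :=
  quat
    (q_re p * q_re q - q_i p * q_i q - q_j p * q_j q - q_k p * q_k q)
    (q_re p * q_i q + q_i p * q_re q + q_j p * q_k q - q_k p * q_j q)
    (q_re p * q_j q - q_i p * q_k q + q_j p * q_re q + q_k p * q_i q)
    (q_re p * q_k q + q_i p * q_j q - q_j p * q_i q + q_k p * q_re q).

Definition RtoQ (a : R) : Quat := quat a 0 0 0.

Lemma quat_eq (p q : Quat) :
  q_re p = q_re q -> q_i p = q_i q -> q_j p = q_j q -> q_k p = q_k q -> p = q.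
Proof.
  destruct p as [[[a b] c] d]; destruct q as [[[a' b'] c'] d'].
  unfold q_re, q_i, q_j, q_k; simpl; intros -> -> -> ->; reflexivity.
Qed.

Lemma Quat_Ring_mixin : Ring.mixin_of Quat_AbelianGroup.
Proof.
  exists Qmult (RtoQ 1); intros;
    repeat match goal with x : _ |- _ => destruct x as [[[? ?] ?] ?] end;
    apply quat_eq; cbv -[Rplus Rmult Ropp Rminus R0 R1 IZR]; ring.
Defined.

Canonical Quat_Ring : Ring :=
  Ring.Pack Quat
    (Ring.Class Quat (AbelianGroup.class Quat_AbelianGroup) Quat_Ring_mixin)
    Quat.

Declare Scope quat_scope.
Delimit Scope quat_scope with Q.
Bind Scope quat_scope with Quat.
Notation "p + q" := (@plus Quat_AbelianGroup p q) : quat_scope.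
Notation "p - q" := (@minus Quat_AbelianGroup p q) : quat_scope.
Notation "- q" := (@opp Quat_AbelianGroup q) : quat_scope.
Notation "p * q" := (@mult Quat_Ring p q) : quat_scope.
Notation "q ^ n" := (@pow_n Quat_Ring q n%nat) : quat_scope.
Notation "0" := (RtoQ 0) : quat_scope.
Notation "1" := (RtoQ 1) : quat_scope.

Definition Qconj (q : Quat) : Quat :=
  quat (q_re q) (Ropp (q_i q)) (Ropp (q_j q)) (Ropp (q_k q)).

Definition imag_unit (J : Quat) : Prop := (J * J = - (1))%Q.

Definition slice_point (alpha beta : R) (J : Quat) : Quat :=
  (RtoQ alpha + RtoQ beta * J)%Q.

Definition sphere (x y : R) (q : Quat) : Prop :=
  exists J : Quat, imag_unit J /\ q = slice_point x y J.

Section Topology.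
Context {T : UniformSpace}.

(* With this convention the empty set is connected. *)
Definition connected (A : T -> Prop) : Prop :=
  forall U V : T -> Prop, open U -> open V ->
    (forall x, A x -> U x \/ V x) ->
    (exists x, A x /\ U x) -> (exists x, A x /\ V x) ->
    exists x, A x /\ U x /\ V x.

(* The connected component of x in A: the union of the connected subsets of A
   that contain x. *)
Definition component (A : T -> Prop) (x y : T) : Prop :=
  exists B : T -> Prop,
    connected B /\ (forall z, B z -> A z) /\ B x /\ B y.

Definition unit_interval (t : R) : Prop := 0 <= t <= 1.

Definition path_in (A : T -> Prop) (gamma : R -> T) : Prop :=
  continuous_on unit_interval gamma /\
  forall t, unit_interval t -> A (gamma t).

Definition path_connected (A : T -> Prop) : Prop :=
  forall x y, A x -> A y ->
    exists gamma : R -> T, path_in A gamma /\ gamma 0 = x /\ gamma 1 = y.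

(* The loop gamma is homotopic in A, with fixed base point, to a constant. *)
Definition null_homotopic (A : T -> Prop) (gamma : R -> T) : Prop :=
  exists Phi : R * R -> T,
    let square (st : R * R) := unit_interval (fst st) /\ unit_interval (snd st) in
    continuous_on square Phi /\
    (forall st, square st -> A (Phi st)) /\
    (forall t, unit_interval t -> Phi (0, t) = gamma t) /\
    (forall t, unit_interval t -> Phi (1, t) = gamma 0) /\
    (forall s, unit_interval s -> Phi (s, 0) = gamma 0 /\ Phi (s, 1) = gamma 0).

Definition simply_connected (A : T -> Prop) : Prop :=
  path_connected A /\
  forall gamma : R -> T,
    path_in A gamma -> gamma 0 = gamma 1 -> null_homotopic A gamma.

End Topology.

Definition conj_invariant (D : C -> Prop) : Prop :=
  forall z, D z -> D (Cconj z).

(* The set Omega_D; it determines D when D is conj_invariant. *)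
Definition circ (D : C -> Prop) (q : Quat) : Prop :=
  exists (alpha beta : R) (J : Quat),
    D (alpha, beta) /\ imag_unit J /\ q = slice_point alpha beta J.

Definition circular_domain (D : C -> Prop) : Prop :=
  conj_invariant D /\ open (circ D) /\ connected (circ D).

Definition plane_section (Omega : Quat -> Prop) (I q : Quat) : Prop :=
  Omega q /\ exists alpha beta : R, q = slice_point alpha beta I.

(* The pair (p, q) stands for the element p + i q of the complexified
   quaternions. *)
Definition QC : Type := (Quat * Quat)%type.

Definition QCconj (w : QC) : QC := (fst w, (- snd w)%Q).

Definition QCmult (w w' : QC) : QC :=
  ((fst w * fst w' - snd w * snd w')%Q, (fst w * snd w' + snd w * fst w')%Q).

Definition is_stem (D : C -> Prop) (F : C -> QC) : Prop :=
  forall z, D z -> F (Cconj z) = QCconj (F z).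

(* f is the slice function induced by F on Omega_D; the values of f outside
   Omega_D and those of F outside D are irrelevant. *)
Definition induces (D : C -> Prop) (F : C -> QC) (f : Quat -> Quat) : Prop :=
  forall (alpha beta : R) (J : Quat), D (alpha, beta) -> imag_unit J ->
    f (slice_point alpha beta J) =
      (fst (F (alpha, beta)) + J * snd (F (alpha, beta)))%Q.

(* As a complex vector space the complexified quaternions are C^4, with
   complex coordinates (re p, re q), (i p, i q), (j p, j q), (k p, k q) at
   p + i q.  A map into them is holomorphic when these coordinates have a
   complex derivative at every point of the (open) set D. *)
Definition QC_holomorphic (D : C -> Prop) (F : C -> QC) : Prop :=
  forall c : Quat -> R, In c (q_re :: q_i :: q_j :: q_k :: nil) ->
  forall z : C, D z ->
    @ex_derive C_AbsRing C_NormedModule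
      (fun w : C => (c (fst (F w)), c (snd (F w))) : C) z.

Definition slice_regular (D : C -> Prop) (f : Quat -> Quat) : Prop :=
  exists F : C -> QC, is_stem D F /\ QC_holomorphic D F /\ induces D F f.

Definition real_valued (D : C -> Prop) (F : C -> QC) : Prop :=
  forall z, D z -> exists a b : R, F z = (RtoQ a, RtoQ b).

Definition slice_regular_real (D : C -> Prop) (f : Quat -> Quat) : Prop :=
  exists F : C -> QC,
    is_stem D F /\ QC_holomorphic D F /\ real_valued D F /\ induces D F f.

Definition is_star (D : C -> Prop) (f g k : Quat -> Quat) : Prop :=
  exists F G : C -> QC,
    is_stem D F /\ is_stem D G /\ induces D F f /\ induces D G g /\
    induces D (fun z => QCmult (F z) (G z)) k.

(* On Omega_D, k = (q - p_1) * ... * (q - p_n) * g with ps = p_1, ..., p_n. *)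
Fixpoint is_star_linear (D : C -> Prop) (ps : list Quat)
    (g k : Quat -> Quat) : Prop :=
  match ps with
  | nil => forall q, circ D q -> k q = g q
  | p :: ps' => exists k' : Quat -> Quat,
      is_star_linear D ps' g k' /\ is_star D (fun q => (q - p)%Q) k' k
  end.

(* The spherical multiplicity of the sphere of x + y J (y <> 0) for h is mu.
   The first factor is slice-preserving, hence the pointwise product. *)
Definition spherical_multiplicity (D : C -> Prop) (h : Quat -> Quat)
    (x y : R) (mu : nat) : Prop :=
  y <> 0 /\ (forall q, sphere x y q -> circ D q) /\
  exists (m : nat) (ps : list Quat) (g k : Quat -> Quat),
    mu = (2 * m)%nat /\
    (forall p, In p ps -> sphere x y p) /\
    (forall l : nat, (S l < length ps)%nat ->
       nth l ps (RtoQ 0) <> Qconj (nth (S l) ps (RtoQ 0))) /\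
    slice_regular D g /\
    (forall q, sphere x y q -> g q <> RtoQ 0) /\
    is_star_linear D ps g k /\
    (forall q, circ D q ->
       h q = (((q - RtoQ x) ^ 2 + RtoQ y ^ 2) ^ m * k q)%Q).

Definition real_isolated_multiplicity (D : C -> Prop) (h : Quat -> Quat)
    (x : R) (n : nat) : Prop :=
  circ D (RtoQ x) /\
  exists g : Quat -> Quat,
    slice_regular D g /\ g (RtoQ x) <> RtoQ 0 /\
    forall q, circ D q -> h q = ((q - RtoQ x) ^ n * g q)%Q.

Definition zero_of (Omega : Quat -> Prop) (h : Quat -> Quat) (q : Quat) : Prop :=
  Omega q /\ h q = RtoQ 0.

Definition isolated_zero_sphere (Omega : Quat -> Prop) (h : Quat -> Quat)
    (x y : R) : Prop :=
  (forall q, sphere x y q -> zero_of Omega h q) /\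
  exists U : Quat -> Prop, open U /\ (forall q, sphere x y q -> U q) /\
    forall q, U q -> zero_of Omega h q -> sphere x y q.

(* Main.v *)
Require Import Defs.
From Stdlib Require Import Reals List Arith Lra Lia Classical ClassicalEpsilon.
From Stdlib Require Import IndefiniteDescription FunctionalExtensionality.
From Stdlib Require Import PropExtensionality Bool.
From Coquelicot Require Import Coquelicot.

(** A slice-preserving function [h] on the circular domain of [D] is a
    holomorphic function [phi] on [D] that commutes with conjugation, and
    [f] squares to [h] exactly when the stem [psi] of [f] squares to [phi]
    ([complex_stem_square]).  The question is therefore when [phi] has a
    holomorphic square root that commutes with conjugation.

    Suppose that [psi] is such a root.  It is real on the real axis, so [phi]
    is nonnegative there.  It is not identically zero near any point of [D]
    ([not_locally_zero]), so it has a finite order [n] at each zero [z0]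
    ([order_dichotomy]), and dividing by the [n]-th power of the real
    polynomial with the roots [z0] and its conjugate leaves a symmetric
    holomorphic cofactor ([divide_out_zero]).  Squaring gives the
    multiplicities of [h].

    Conversely, the condition on multiplicities says that [phi] has even order
    at every point.  For a sphere this needs an argument, because a spherical
    multiplicity leaves room for isolated factors [q - p_l]; but the stem of
    their product does not vanish at the point of the sphere
    ([star_linear_stem]), and the cofactor of a slice-preserving function is
    scalar ([scalar_cofactor]).  Where the order is even, [phi] has a
    holomorphic square root nearby ([local_sqrt]), and its germ is unique up to
    sign, also at a zero of [phi] ([roots_agree]).  The germs of square roots
    thus form an unbranched two-sheeted covering of [D].  Loops in [D] contract
    ([loops_contract]), so this covering has a section ([monodromy_section],
    [global_sqrt]).  A root and its reflection agree up to sign, and the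
    nonnegativity of [h] on the real axis makes this sign positive; without
    real points the root can be prescribed on one half of [D] and reflected
    ([symmetric_sqrt]).

    The finite order of zeros is the one fact of complex analysis behind both
    directions.  It comes from Goursat's theorem for rectangles with an
    exceptional point ([goursat_rect], [goursat_except]), which provides a
    primitive of the difference quotient of [f] at [a]; its vanishing circle
    integral is a Taylor expansion with remainder ([taylor_at_0]). *)

(** * Complex differentiability *)

Section Continuity.
Context {U : UniformSpace}.

Lemma Ccont_pair (f : U -> C) (x : U) :
  continuous (fun t => fst (f t)) x -> continuous (fun t => snd (f t)) x ->
  continuous f x.
Proof.
  intros H1 H2. apply filterlim_locally. intros eps.
  apply filterlim_locally with (eps := eps) in H1, H2.
  generalize (filter_and _ _ H1 H2). apply filter_imp.
  intros t Ht. exact Ht.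
Qed.

Lemma Ccont_fst (f : U -> C) (x : U) :
  continuous f x -> continuous (fun t => fst (f t)) x.
Proof.
  intros H. apply (continuous_comp f fst); [exact H | apply continuous_fst].
Qed.

Lemma Ccont_snd (f : U -> C) (x : U) :
  continuous f x -> continuous (fun t => snd (f t)) x.
Proof.
  intros H. apply (continuous_comp f snd); [exact H | apply continuous_snd].
Qed.

Lemma Rcont_plus (f g : U -> R) (x : U) :
  continuous f x -> continuous g x -> continuous (fun t => f t + g t) x.
Proof. intros; now apply (continuous_plus f g). Qed.

Lemma Rcont_opp (f : U -> R) (x : U) :
  continuous f x -> continuous (fun t => - f t) x.
Proof. intros; now apply (continuous_opp f). Qed.

Lemma Rcont_minus (f g : U -> R) (x : U) :
  continuous f x -> continuous g x -> continuous (fun t => f t - g t) x.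
Proof. intros; now apply (continuous_minus f g). Qed.

Lemma Rcont_mult (f g : U -> R) (x : U) :
  continuous f x -> continuous g x -> continuous (fun t => f t * g t) x.
Proof. intros; now apply (continuous_mult f g). Qed.

Lemma Ccont_plus (f g : U -> C) (x : U) :
  continuous f x -> continuous g x -> continuous (fun t => (f t + g t)%C) x.
Proof.
  intros Hf Hg; apply Ccont_pair; cbn;
    apply Rcont_plus; auto using Ccont_fst, Ccont_snd.
Qed.

Lemma Ccont_minus (f g : U -> C) (x : U) :
  continuous f x -> continuous g x -> continuous (fun t => (f t - g t)%C) x.
Proof.
  intros Hf Hg; apply Ccont_pair; cbn;
    apply Rcont_minus; auto using Ccont_fst, Ccont_snd.
Qed.

Lemma Ccont_mult (f g : U -> C) (x : U) :
  continuous f x -> continuous g x -> continuous (fun t => (f t * g t)%C) x.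
Proof.
  intros Hf Hg; apply Ccont_pair; cbn;
    [apply Rcont_minus | apply Rcont_plus];
    apply Rcont_mult; auto using Ccont_fst, Ccont_snd.
Qed.

Lemma Ccont_inv (f : U -> C) (x : U) :
  continuous f x -> f x <> RtoC 0 -> continuous (fun t => (/ f t)%C) x.
Proof.
  intros Hf H0.
  assert (Hn : fst (f x) ^ 2 + snd (f x) ^ 2 <> 0).
  { intros E. apply H0. destruct (f x) as [a b]; simpl in E.
    unfold RtoC; f_equal; nra. }
  assert (Hi : continuous (fun t => / (fst (f t) ^ 2 + snd (f t) ^ 2)) x).
  { apply (continuous_comp (fun t => fst (f t) ^ 2 + snd (f t) ^ 2) Rinv).
    - simpl. apply Rcont_plus; repeat apply Rcont_mult;
        auto using Ccont_fst, Ccont_snd, continuous_const.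
    - now apply continuous_Rinv. }
  apply Ccont_pair; cbn -[pow]; unfold Rdiv; apply Rcont_mult; auto.
  - now apply Ccont_fst.
  - now apply Rcont_opp, Ccont_snd.
Qed.

Lemma Ccont_pow (f : U -> C) (n : nat) (x : U) :
  continuous f x -> continuous (fun t => (f t ^ n)%C) x.
Proof.
  intros Hf; induction n as [|n IH]; simpl.
  - apply continuous_const.
  - now apply Ccont_mult.
Qed.

End Continuity.

Lemma Cconj_continuous (z : C) : continuous Cconj z.
Proof.
  apply Ccont_pair; simpl; [apply continuous_fst|].
  apply (Rcont_opp (fun w : C => snd w)), continuous_snd.
Qed.

Lemma Ccont_sub (c z : C) : continuous (fun w => (w - c)%C) z.
Proof. apply Ccont_minus; [apply continuous_id | apply continuous_const]. Qed.

Lemma Cmod_minus_sym (a b : C) : Cmod (a - b) = Cmod (b - a).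
Proof. rewrite <- Cmod_opp. f_equal. ring. Qed.

Lemma Cmod_le_sum (a b : R) : Cmod (a, b) <= Rabs a + Rabs b.
Proof.
  replace (a, b) with (RtoC a + Ci * RtoC b)%C
    by (unfold RtoC, Ci, Cmult, Cplus; simpl; f_equal; ring).
  eapply Rle_trans; [apply Cmod_triangle|].
  rewrite Cmod_mult, Cmod_Ci, !Cmod_R. lra.
Qed.

Lemma im_le_Cmod (c : C) : Rabs (snd c) <= Cmod c.
Proof. eapply Rle_trans; [apply Rmax_r | apply Rmax_Cmod]. Qed.

Lemma fst_le_Cmod (c : C) : Rabs (fst c) <= Cmod c.
Proof. eapply Rle_trans; [apply Rmax_l | apply Rmax_Cmod]. Qed.

Lemma locally_Cmod (z : C) (P : C -> Prop) :
  locally z P <-> exists d, 0 < d /\ forall w, Cmod (w - z) < d -> P w.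
Proof.
  split.
  - intros [e He]. exists e. split; [apply cond_pos|].
    intros w Hw. apply He. split.
    + apply Rle_lt_trans with (2 := Hw). apply (fst_le_Cmod (w - z)).
    + apply Rle_lt_trans with (2 := Hw). apply (im_le_Cmod (w - z)).
  - intros (d & Hd & H).
    assert (Hd2 : 0 < d / 2) by lra.
    exists (mkposreal _ Hd2). intros [w1 w2] [H1 H2]. apply H.
    destruct z as [z1 z2].
    unfold ball in H1, H2; simpl in H1, H2; unfold AbsRing_ball in H1, H2;
      simpl in H1, H2; unfold abs, minus, plus, opp in H1, H2; simpl in H1, H2.
    eapply Rle_lt_trans; [apply Cmod_le_sum|]. cbn. unfold Rminus in *. lra.
Qed.

Lemma locally_conj (z : C) (P : C -> Prop) :
  locally z P -> locally (Cconj z) (fun w => P (Cconj w)).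
Proof.
  rewrite !locally_Cmod. intros (d & Hd & H). exists d. split; [exact Hd|].
  intros w Hw. apply H.
  now rewrite <- (Cconj_conj z), <- Cminus_conj, Cmod_conj.
Qed.

Lemma Ccontinuous_Cmod {U : UniformSpace} (f : U -> C) (x : U) :
  continuous f x <->
  forall eps, 0 < eps -> locally x (fun w => Cmod (f w - f x) < eps).
Proof.
  split.
  - intros H eps He.
    apply (H (fun y => Cmod (y - f x) < eps)).
    apply locally_Cmod. exists eps; auto.
  - intros H P HP. apply locally_Cmod in HP. destruct HP as (d & Hd & HP).
    specialize (H d Hd). unfold filtermap. revert H. apply filter_imp. auto.
Qed.

Lemma continuous_ball (f : C -> C) (z : C) (eps : R) :
  continuous f z -> 0 < eps ->
  exists d, 0 < d /\ forall w, Cmod (w - z) < d -> Cmod (f w - f z) < eps.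
Proof.
  intros Hf He. apply (locally_Cmod z (fun w => Cmod (f w - f z) < eps)).
  exact (proj1 (Ccontinuous_Cmod f z) Hf eps He).
Qed.

(** Caratheodory's form of the complex derivative: the difference quotient
    extends to a function that is continuous at the point.  It turns the rules
    of calculus into algebra. *)
Definition cderiv (f : C -> C) (z l : C) : Prop :=
  exists q : C -> C,
    (forall w, f w = (f z + q w * (w - z))%C) /\ continuous q z /\ q z = l.

Definition cdiff (f : C -> C) (z : C) : Prop := exists l, cderiv f z l.

Lemma cderiv_eps (f : C -> C) (z l : C) :
  cderiv f z l <->
  forall eps, 0 < eps ->
    locally z (fun w => Cmod (f w - f z - (w - z) * l) <= eps * Cmod (w - z)).
Proof.
  split.
  - intros (q & Hq & Hc & Hl) eps Heps.
    generalize (proj1 (Ccontinuous_Cmod q z) Hc eps Heps).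
    apply filter_imp. intros w Hw.
    rewrite (Hq w), <- Hl.
    replace (f z + q w * (w - z) - f z - (w - z) * q z)%C
      with ((q w - q z) * (w - z))%C by ring.
    rewrite Cmod_mult. apply Rmult_le_compat_r; [apply Cmod_ge_0 | lra].
  - intros H.
    exists (fun w => if Ceq_dec w z then l else ((f w - f z) / (w - z))%C).
    split; [|split].
    + intros w. destruct (Ceq_dec w z) as [->|Hw]; [ring|].
      field. now apply Cminus_eq_contra.
    + apply Ccontinuous_Cmod. intros eps He.
      assert (He2 : 0 < eps / 2) by lra.
      generalize (H _ He2). apply filter_imp. intros w Hw.
      destruct (Ceq_dec z z) as [_|E]; [|now elim E].
      destruct (Ceq_dec w z) as [->|Hwz].
      * replace (l - l)%C with (RtoC 0) by ring. rewrite Cmod_0; lra.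
      * assert (Hwz' := Cminus_eq_contra _ _ Hwz).
        replace ((f w - f z) / (w - z) - l)%C
          with (((f w - f z) - (w - z) * l) / (w - z))%C by (field; auto).
        rewrite Cmod_div by auto.
        assert (0 < Cmod (w - z)) by now apply Cmod_gt_0.
        apply Rle_lt_trans with (eps / 2); [|lra].
        apply Rle_div_l; lra.
    + destruct (Ceq_dec z z) as [_|E]; [reflexivity|now elim E].
Qed.

Lemma cderiv_is_derive (f : C -> C) (z l : C) :
  cderiv f z l <-> @is_derive C_AbsRing C_NormedModule f z l.
Proof.
  rewrite cderiv_eps. split.
  - intros H. split.
    + apply is_linear_scal_l.
    + intros y Hy.
      assert (Hzy : z = y)
        by exact (@is_filter_lim_locally_unique _
                    (AbsRing_NormedModule C_AbsRing) z y Hy).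
      subst y. intros eps. apply locally_C. exact (H eps (cond_pos eps)).
  - intros [_ H] eps Heps.
    specialize (H z (fun P HP => HP) (mkposreal _ Heps)).
    apply locally_C in H. exact H.
Qed.

Lemma cderiv_ext_loc (f g : C -> C) (z l : C) :
  locally z (fun w => f w = g w) -> cderiv f z l -> cderiv g z l.
Proof.
  intros H. rewrite !cderiv_is_derive. apply is_derive_ext_loc.
  now apply locally_C.
Qed.

Lemma cdiff_ext_loc (f g : C -> C) (z : C) :
  locally z (fun w => f w = g w) -> cdiff f z -> cdiff g z.
Proof. intros H [l Hl]; exists l; now apply cderiv_ext_loc with f. Qed.

Lemma cdiff_continuous (f : C -> C) (z : C) : cdiff f z -> continuous f z.
Proof.
  intros (l & q & Hq & Hc & _).
  apply continuous_ext with (fun w => (f z + q w * (w - z))%C).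
  { intros w; now rewrite (Hq w). }
  apply Ccont_plus; [apply continuous_const|].
  apply Ccont_mult; auto. apply Ccont_sub.
Qed.

Lemma cdiff_near_continuous (f : C -> C) (z : C) :
  locally z (cdiff f) -> continuous f z.
Proof. intros H. apply cdiff_continuous. exact (locally_singleton z _ H). Qed.

Lemma cderiv_const (c z : C) : cderiv (fun _ => c) z (RtoC 0).
Proof.
  exists (fun _ => RtoC 0). split; [intros; ring|].
  split; [apply continuous_const | reflexivity].
Qed.

Lemma cderiv_id (z : C) : cderiv (fun w => w) z (RtoC 1).
Proof.
  exists (fun _ => RtoC 1). split; [intros; ring|].
  split; [apply continuous_const | reflexivity].
Qed.

Lemma cderiv_plus (f g : C -> C) (z l m : C) :
  cderiv f z l -> cderiv g z m ->
  cderiv (fun w => (f w + g w)%C) z (l + m)%C.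
Proof.
  intros (p & Hp & Hpc & <-) (q & Hq & Hqc & <-).
  exists (fun w => (p w + q w)%C). split; [|split; [|reflexivity]].
  - intros w. rewrite (Hp w), (Hq w). ring.
  - now apply Ccont_plus.
Qed.

Lemma cderiv_mult (f g : C -> C) (z l m : C) :
  cderiv f z l -> cderiv g z m ->
  cderiv (fun w => (f w * g w)%C) z (l * g z + f z * m)%C.
Proof.
  intros (p & Hp & Hpc & Hl) (q & Hq & Hqc & Hm).
  assert (Hg : continuous g z) by (apply cdiff_continuous; exists m, q; auto).
  exists (fun w => (p w * g w + f z * q w)%C). split; [|split].
  - intros w. rewrite (Hp w), (Hq w). ring.
  - apply Ccont_plus; apply Ccont_mult; auto. apply continuous_const.
  - now rewrite Hl, Hm.
Qed.

Lemma cdiff_const (c z : C) : cdiff (fun _ => c) z.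
Proof. eexists; apply cderiv_const. Qed.

Lemma cdiff_id (z : C) : cdiff (fun w => w) z.
Proof. eexists; apply cderiv_id. Qed.

Lemma cdiff_plus (f g : C -> C) (z : C) :
  cdiff f z -> cdiff g z -> cdiff (fun w => (f w + g w)%C) z.
Proof. intros [l H] [m H']; eexists; eapply cderiv_plus; eauto. Qed.

Lemma cdiff_mult (f g : C -> C) (z : C) :
  cdiff f z -> cdiff g z -> cdiff (fun w => (f w * g w)%C) z.
Proof. intros [l H] [m H']; eexists; eapply cderiv_mult; eauto. Qed.

Lemma cdiff_minus (f g : C -> C) (z : C) :
  cdiff f z -> cdiff g z -> cdiff (fun w => (f w - g w)%C) z.
Proof.
  intros Hf Hg.
  apply cdiff_ext_loc with (fun w => (f w + - RtoC 1 * g w)%C).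
  { apply filter_forall. intros w. ring. }
  apply cdiff_plus; auto. apply cdiff_mult; auto. apply cdiff_const.
Qed.

Lemma cdiff_sub (c z : C) : cdiff (fun w => (w - c)%C) z.
Proof. apply cdiff_minus; [apply cdiff_id | apply cdiff_const]. Qed.

Lemma cdiff_pow (f : C -> C) (n : nat) (z : C) :
  cdiff f z -> cdiff (fun w => (f w ^ n)%C) z.
Proof.
  intros H; induction n; simpl; [apply cdiff_const | now apply cdiff_mult].
Qed.

Lemma Clocally_neq (f : C -> C) (z c : C) :
  continuous f z -> f z <> c -> locally z (fun w => f w <> c).
Proof.
  intros Hc H0.
  assert (Hp : 0 < Cmod (f z - c)) by now apply Cmod_gt_0, Cminus_eq_contra.
  generalize (proj1 (Ccontinuous_Cmod f z) Hc _ Hp). apply filter_imp.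
  intros w Hw E. rewrite E, Cmod_minus_sym in Hw. lra.
Qed.

Lemma punctured_point (z : C) (P : C -> Prop) :
  locally z P -> exists w, w <> z /\ snd w = snd z /\ P w.
Proof.
  intros H. apply locally_Cmod in H. destruct H as (d & Hd & H).
  assert (Ew : (z + RtoC (d / 2) - z)%C = RtoC (d / 2)) by ring.
  exists (z + RtoC (d / 2))%C. split; [|split].
  - intros E. assert (E' : RtoC (d / 2) = RtoC 0) by (rewrite <- Ew, E; ring).
    apply RtoC_inj in E'. lra.
  - simpl. ring.
  - apply H. rewrite Ew, Cmod_R, Rabs_pos_eq; lra.
Qed.

Lemma continuous_agree (f g : C -> C) (z : C) :
  continuous f z -> continuous g z ->
  locally z (fun w => w <> z -> f w = g w) -> f z = g z.
Proof.
  intros Hf Hg H.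
  destruct (Ceq_dec (f z) (g z)) as [E|E]; [exact E|exfalso].
  assert (Hc : continuous (fun w => (f w - g w)%C) z) by now apply Ccont_minus.
  assert (Hne := Clocally_neq _ z (RtoC 0) Hc (Cminus_eq_contra _ _ E)).
  destruct (punctured_point z _ (filter_and _ _ H Hne))
    as (w & Hw & _ & H1 & H2).
  apply H2. rewrite (H1 Hw). ring.
Qed.

Lemma cdiff_inv (f : C -> C) (z : C) :
  cdiff f z -> f z <> RtoC 0 -> cdiff (fun w => (/ f w)%C) z.
Proof.
  intros Hf H0. assert (Hc := cdiff_continuous f z Hf).
  destruct Hf as (l & q & Hq & Hqc & Hl).
  eexists. apply cderiv_is_derive.
  apply is_derive_ext_loc with
    (f := fun w => if Ceq_dec (f w) (RtoC 0)
                   then (/ f z + - (q w / (f w * f z)) * (w - z))%C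
                   else (/ f w)%C).
  { apply locally_C. generalize (Clocally_neq f z _ Hc H0). apply filter_imp.
    intros w Hw. destruct Ceq_dec; [contradiction|reflexivity]. }
  apply cderiv_is_derive. exists (fun w => (- (q w / (f w * f z)))%C).
  split; [|split; [|reflexivity]].
  - intros w. destruct (Ceq_dec (f z) (RtoC 0)); [contradiction|].
    destruct (Ceq_dec (f w) (RtoC 0)) as [E|E]; [reflexivity|].
    assert (Hw := Hq w).
    replace (q w / (f w * f z))%C with (q w * / f w * / f z)%C
      by (field; auto).
    replace (- (q w * / f w * / f z) * (w - z))%C
      with (- (q w * (w - z)) * / f w * / f z)%C by ring.
    replace (q w * (w - z))%C with (f w - f z)%C by (rewrite Hw; ring).
    field; auto.
  - apply continuous_ext with (fun w => (RtoC 0 - q w * / (f w * f z))%C).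
    { intros w. unfold Cdiv, Cminus. now rewrite Cplus_0_l. }
    apply Ccont_minus; [apply continuous_const|].
    apply Ccont_mult; auto. apply Ccont_inv.
    + apply Ccont_mult; auto. apply continuous_const.
    + now apply Cmult_neq_0.
Qed.

Lemma cdiff_div (f g : C -> C) (z : C) :
  cdiff f z -> cdiff g z -> g z <> RtoC 0 -> cdiff (fun w => (f w / g w)%C) z.
Proof. intros. apply cdiff_mult; auto. now apply cdiff_inv. Qed.

(** The two conjugations of the difference quotient cancel. *)
Lemma cdiff_conj (f : C -> C) (z : C) :
  cdiff f (Cconj z) -> cdiff (fun w => Cconj (f (Cconj w))) z.
Proof.
  intros (l & q & Hq & Hc & _).
  exists (Cconj (q (Cconj z))), (fun w => Cconj (q (Cconj w))).
  split; [|split; [|reflexivity]].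
  - intros w. rewrite (Hq (Cconj w)), Cplus_conj, Cmult_conj, Cminus_conj,
      !Cconj_conj. reflexivity.
  - apply Ccontinuous_Cmod. intros eps He.
    assert (H := locally_conj _ _ (proj1 (Ccontinuous_Cmod q _) Hc eps He)).
    rewrite Cconj_conj in H. revert H. apply filter_imp. intros w Hw.
    now rewrite <- Cminus_conj, Cmod_conj.
Qed.

Lemma cdiff_comp (f u : C -> C) (z : C) :
  cdiff f (u z) -> cdiff u z -> cdiff (fun w => f (u w)) z.
Proof.
  intros (l & p & Hp & Hpc & _) Hu.
  assert (Huc := cdiff_continuous u z Hu).
  destruct Hu as (m & q & Hq & Hqc & _).
  exists (p (u z) * q z)%C, (fun w => (p (u w) * q w)%C).
  split; [|split; [|reflexivity]].
  - intros w. rewrite (Hp (u w)). f_equal.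
    replace (u w - u z)%C with (q w * (w - z))%C by (rewrite (Hq w); ring).
    ring.
  - apply Ccont_mult; auto. now apply (continuous_comp u p).
Qed.

Lemma cdiff_comp_translate (f : C -> C) (c z : C) :
  cdiff f (z + c)%C -> cdiff (fun w => f (w + c)%C) z.
Proof.
  intros Hf. apply (cdiff_comp f (fun w => (w + c)%C)); auto.
  apply (cdiff_plus (fun w => w) (fun _ => c));
    [apply cdiff_id | apply cdiff_const].
Qed.

(** * Integrals of complex valued functions of a real variable *)

Definition CInt (u : R -> C) (a b : R) : C :=
  @RInt C_R_CompleteNormedModule u a b.

Section CInt.
Implicit Types (u v : R -> C) (a b : R).

Definition Rcont (u : R -> C) : Prop := forall t, continuous u t.

Lemma CInt_ex u a b : Rcont u -> @ex_RInt C_R_NormedModule u a b.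
Proof.
  intros H. apply (@ex_RInt_continuous C_R_CompleteNormedModule).
  intros t _. apply H.
Qed.

Lemma CInt_is u a b :
  Rcont u -> @is_RInt C_R_NormedModule u a b (CInt u a b).
Proof.
  intros H. apply (@RInt_correct C_R_CompleteNormedModule). now apply CInt_ex.
Qed.

Lemma CInt_unique u a b (l : C) :
  @is_RInt C_R_NormedModule u a b l -> CInt u a b = l.
Proof. apply (@is_RInt_unique C_R_CompleteNormedModule). Qed.

Lemma CInt_chasles u a b c :
  Rcont u -> (CInt u a b + CInt u b c)%C = CInt u a c.
Proof.
  intros H. apply (@RInt_Chasles C_R_CompleteNormedModule); now apply CInt_ex.
Qed.

Lemma CInt_plus u v a b :
  Rcont u -> Rcont v ->
  CInt (fun t => (u t + v t)%C) a b = (CInt u a b + CInt v a b)%C.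
Proof.
  intros Hu Hv. apply CInt_unique.
  apply (@is_RInt_plus C_R_NormedModule); now apply CInt_is.
Qed.

Lemma CInt_mult_const (c : C) u a b :
  Rcont u -> CInt (fun t => (c * u t)%C) a b = (c * CInt u a b)%C.
Proof.
  intros Hu. apply CInt_unique.
  assert (H := CInt_is u a b Hu).
  apply is_RInt_fct_extend_fst in H as H1.
  apply is_RInt_fct_extend_snd in H as H2.
  apply is_RInt_fct_extend_pair; simpl.
  - apply (@is_RInt_minus R_NormedModule);
      apply (@is_RInt_scal R_NormedModule); assumption.
  - apply (@is_RInt_plus R_NormedModule);
      apply (@is_RInt_scal R_NormedModule); assumption.
Qed.

Lemma CInt_ext u v a b :
  (forall t, u t = v t) -> CInt u a b = CInt v a b.
Proof. intros H. apply (@RInt_ext C_R_CompleteNormedModule). auto. Qed.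

Lemma CInt_lin3 (c e : C) u v w a b :
  Rcont u -> Rcont v -> Rcont w ->
  CInt (fun t => (u t + c * v t + e * w t)%C) a b
  = (CInt u a b + c * CInt v a b + e * CInt w a b)%C.
Proof.
  intros Hu Hv Hw.
  assert (Hm : forall (k : C) x, Rcont x -> Rcont (fun t => (k * x t)%C))
    by (intros k x Hx t; apply Ccont_mult; [apply continuous_const | apply Hx]).
  rewrite (CInt_plus (fun t => (u t + c * v t)%C) (fun t => (e * w t)%C)).
  - rewrite (CInt_plus u (fun t => (c * v t)%C)) by auto.
    rewrite !CInt_mult_const by auto. reflexivity.
  - intros t. apply Ccont_plus; [apply Hu | now apply (Hm c v)].
  - now apply (Hm e w).
Qed.

Lemma CInt_const (c : C) a b : CInt (fun _ => c) a b = (RtoC (b - a) * c)%C.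
Proof.
  apply CInt_unique. rewrite <- scal_R_Cmult.
  apply (@is_RInt_const C_R_NormedModule).
Qed.

Lemma CInt_norm u a b M :
  Rcont u ->
  (forall t, Rmin a b <= t <= Rmax a b -> Cmod (u t) <= M) ->
  Cmod (CInt u a b) <= Rabs (b - a) * M.
Proof.
  intros Hu H.
  rewrite Cmod_norm.
  apply (@norm_RInt_le_const_abs C_R_NormedModule u a b); [|now apply CInt_is].
  intros t Ht. rewrite <- Cmod_norm. now apply H.
Qed.

Lemma curve_derive_eps u (t : R) (l : C) :
  @is_derive R_AbsRing C_R_NormedModule u t l <->
  forall eps, 0 < eps ->
    locally t (fun s => Cmod (u s - u t - RtoC (s - t) * l)
                        <= eps * Rabs (s - t)).
Proof.
  split.
  - intros [_ H] eps He.
    specialize (H t (fun P HP => HP) (mkposreal _ He)).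
    revert H. apply filter_imp. intros s Hs.
    rewrite <- scal_R_Cmult, Cmod_norm. exact Hs.
  - intros H. split; [apply is_linear_scal_l|].
    intros y Hy.
    assert (Hty : t = y)
      by exact (@is_filter_lim_locally_unique _ R_NormedModule t y Hy).
    subst y. intros eps. generalize (H eps (cond_pos eps)).
    apply filter_imp. intros s Hs. rewrite <- scal_R_Cmult, Cmod_norm in Hs.
    exact Hs.
Qed.

Lemma is_derive_curve (c : R -> C) (G : C -> C) (t : R) (l m : C) :
  cderiv G (c t) m -> @is_derive R_AbsRing C_R_NormedModule c t l ->
  @is_derive R_AbsRing C_R_NormedModule (fun s => G (c s)) t (m * l)%C.
Proof.
  intros HG Hc.
  assert (Hcont : continuous c t)
    by (apply (@ex_derive_continuous R_AbsRing C_R_NormedModule);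
        now exists l).
  rewrite curve_derive_eps in Hc. apply curve_derive_eps.
  rewrite cderiv_eps in HG. intros eps He.
  set (K := Cmod l + Cmod m + 2).
  assert (HK : 0 < K)
    by (assert (h1 := Cmod_ge_0 l); assert (h2 := Cmod_ge_0 m); unfold K; lra).
  set (e := Rmin 1 (eps / K)).
  assert (He1 : 0 < e)
    by (apply Rmin_pos; [lra | now apply Rdiv_lt_0_compat]).
  assert (HeK : e * K <= eps).
  { apply Rle_trans with (eps / K * K).
    - apply Rmult_le_compat_r; [lra | apply Rmin_r].
    - right. field. lra. }
  assert (Hle1 : e <= 1) by apply Rmin_l.
  generalize (filter_and _ _ (Hc e He1) (Hcont _ (HG e He1))).
  apply filter_imp. intros s [H1 H2].
  set (d := (c s - c t)%C) in *.
  set (r := (d - RtoC (s - t) * l)%C) in *.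
  replace (G (c s) - G (c t) - RtoC (s - t) * (m * l))%C
    with ((G (c s) - G (c t) - d * m) + r * m)%C by (unfold r; ring).
  assert (Hd : Cmod d <= (1 + Cmod l) * Rabs (s - t)).
  { replace d with (r + RtoC (s - t) * l)%C by (unfold r; ring).
    eapply Rle_trans; [apply Cmod_triangle|].
    rewrite Cmod_mult, Cmod_R.
    assert (h := Rabs_pos (s - t)). nra. }
  eapply Rle_trans; [apply Cmod_triangle|]. rewrite Cmod_mult.
  assert (hm := Cmod_ge_0 m). assert (hs := Rabs_pos (s - t)).
  assert (hd := Cmod_ge_0 d). assert (hl := Cmod_ge_0 l).
  apply Rle_trans with (e * ((1 + Cmod l) * Rabs (s - t))
                        + e * Rabs (s - t) * Cmod m).
  - apply Rplus_le_compat.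
    + eapply Rle_trans; [exact H2|]. apply Rmult_le_compat_l; lra.
    + now apply Rmult_le_compat_r.
  - apply Rle_trans with (e * K * Rabs (s - t)).
    + unfold K. nra.
    + now apply Rmult_le_compat_r.
Qed.

Lemma CInt_primitive (c u : R -> C) (G g : C -> C) a b :
  (forall t, cderiv G (c t) (g (c t))) ->
  (forall t, @is_derive R_AbsRing C_R_NormedModule c t (u t)) ->
  Rcont (fun t => (g (c t) * u t)%C) ->
  CInt (fun t => (g (c t) * u t)%C) a b = (G (c b) - G (c a))%C.
Proof.
  intros HG Hc Hcont. apply CInt_unique.
  apply (@is_RInt_derive C_R_CompleteNormedModule (fun t => G (c t))).
  - intros t _. now apply is_derive_curve.
  - intros t _. apply Hcont.
Qed.

End CInt.

Lemma is_derive_hline (y t : R) :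
  @is_derive R_AbsRing C_R_NormedModule (fun x => (x, y) : C) t (RtoC 1).
Proof.
  apply curve_derive_eps. intros eps He. apply filter_forall. intros s.
  match goal with |- Cmod ?X <= _ => replace X with (RtoC 0)
    by (unfold RtoC, Cminus, Cplus, Copp, Cmult; simpl; f_equal; ring) end.
  rewrite Cmod_0. apply Rmult_le_pos; [lra | apply Rabs_pos].
Qed.

Lemma is_derive_vline (x t : R) :
  @is_derive R_AbsRing C_R_NormedModule (fun y => (x, y) : C) t Ci.
Proof.
  apply curve_derive_eps. intros eps He. apply filter_forall. intros s.
  match goal with |- Cmod ?X <= _ => replace X with (RtoC 0)
    by (unfold RtoC, Ci, Cminus, Cplus, Copp, Cmult; simpl; f_equal; ring) end.
  rewrite Cmod_0. apply Rmult_le_pos; [lra | apply Rabs_pos].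
Qed.

(** * Goursat's theorem for rectangles *)

Definition hint (f : C -> C) (x0 x1 y : R) : C :=
  CInt (fun x => f (x, y)) x0 x1.

Definition vint (f : C -> C) (x y0 y1 : R) : C :=
  CInt (fun y => (Ci * f (x, y))%C) y0 y1.

(** The integral along the boundary of the rectangle, counterclockwise. *)
Definition rect (f : C -> C) (x0 x1 y0 y1 : R) : C :=
  (hint f x0 x1 y0 + vint f x1 y0 y1 - hint f x0 x1 y1 - vint f x0 y0 y1)%C.

Definition ccont (f : C -> C) : Prop := forall z, continuous f z.

Definition in_rect (x0 x1 y0 y1 : R) (z : C) : Prop :=
  x0 <= fst z <= x1 /\ y0 <= snd z <= y1.

Lemma Rcont_h (f : C -> C) y : ccont f -> Rcont (fun x => f (x, y)).
Proof.
  intros H t. apply (continuous_comp (fun x => (x, y) : C) f); [|apply H].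
  apply Ccont_pair; [apply continuous_id | apply continuous_const].
Qed.

Lemma Rcont_v (f : C -> C) x : ccont f -> Rcont (fun y => (Ci * f (x, y))%C).
Proof.
  intros H t. apply Ccont_mult; [apply continuous_const|].
  apply (continuous_comp (fun y => (x, y) : C) f); [|apply H].
  apply Ccont_pair; [apply continuous_const | apply continuous_id].
Qed.

#[local] Hint Resolve Rcont_h Rcont_v : core.

Section Rectangles.
Variables (f : C -> C).
Hypothesis Hf : ccont f.

Lemma rect_split_x x0 x1 x2 y0 y1 :
  rect f x0 x2 y0 y1 = (rect f x0 x1 y0 y1 + rect f x1 x2 y0 y1)%C.
Proof.
  unfold rect, hint.
  rewrite <- !(CInt_chasles _ x0 x1 x2) by auto. ring.
Qed.

Lemma rect_split_y x0 x1 y0 y1 y2 :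
  rect f x0 x1 y0 y2 = (rect f x0 x1 y0 y1 + rect f x0 x1 y1 y2)%C.
Proof.
  unfold rect, vint.
  rewrite <- !(CInt_chasles _ y0 y1 y2) by auto. ring.
Qed.

Lemma rect_degenerate_x x y0 y1 : rect f x x y0 y1 = RtoC 0.
Proof.
  assert (E := rect_split_x x x x y0 y1).
  replace (rect f x x y0 y1)
    with (rect f x x y0 y1 + rect f x x y0 y1 - rect f x x y0 y1)%C by ring.
  rewrite <- E. ring.
Qed.

Lemma rect_degenerate_y x0 x1 y : rect f x0 x1 y y = RtoC 0.
Proof.
  assert (E := rect_split_y x0 x1 y y y).
  replace (rect f x0 x1 y y)
    with (rect f x0 x1 y y + rect f x0 x1 y y - rect f x0 x1 y y)%C by ring.
  rewrite <- E. ring.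
Qed.

Lemma rect_norm x0 x1 y0 y1 M :
  x0 <= x1 -> y0 <= y1 ->
  (forall z, in_rect x0 x1 y0 y1 z -> Cmod (f z) <= M) ->
  Cmod (rect f x0 x1 y0 y1) <= 2 * ((x1 - x0) + (y1 - y0)) * M.
Proof.
  intros Hx Hy HM.
  assert (Hh : forall y, y0 <= y <= y1 ->
             Cmod (hint f x0 x1 y) <= (x1 - x0) * M).
  { intros y Hyy. rewrite <- (Rabs_pos_eq (x1 - x0)) by lra.
    apply CInt_norm; auto. intros t Ht.
    rewrite Rmin_left, Rmax_right in Ht by auto. apply HM. split; simpl; lra. }
  assert (Hv : forall x, x0 <= x <= x1 ->
             Cmod (vint f x y0 y1) <= (y1 - y0) * M).
  { intros x Hxx. rewrite <- (Rabs_pos_eq (y1 - y0)) by lra.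
    apply CInt_norm; auto. intros t Ht.
    rewrite Rmin_left, Rmax_right in Ht by auto.
    rewrite Cmod_mult, Cmod_Ci, Rmult_1_l. apply HM. split; simpl; lra. }
  unfold rect, Cminus.
  assert (h1 := Hh y0 ltac:(lra)). assert (h2 := Hh y1 ltac:(lra)).
  assert (h3 := Hv x0 ltac:(lra)). assert (h4 := Hv x1 ltac:(lra)).
  rewrite <- Cmod_opp in h2. rewrite <- Cmod_opp in h3.
  eapply Rle_trans; [apply Cmod_triangle|].
  eapply Rle_trans; [apply Rplus_le_compat_r, Cmod_triangle|].
  eapply Rle_trans;
    [apply Rplus_le_compat_r, Rplus_le_compat_r, Cmod_triangle|].
  lra.
Qed.

End Rectangles.

Lemma hint_plus f g x0 x1 y : ccont f -> ccont g ->
  hint (fun z => (f z + g z)%C) x0 x1 y = (hint f x0 x1 y + hint g x0 x1 y)%C.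
Proof. intros Hf Hg. apply CInt_plus; auto. Qed.

Lemma vint_plus f g x y0 y1 : ccont f -> ccont g ->
  vint (fun z => (f z + g z)%C) x y0 y1 = (vint f x y0 y1 + vint g x y0 y1)%C.
Proof.
  intros Hf Hg. unfold vint. rewrite <- CInt_plus by auto.
  apply CInt_ext. intros t. ring.
Qed.

Lemma rect_plus f g x0 x1 y0 y1 : ccont f -> ccont g ->
  rect (fun z => (f z + g z)%C) x0 x1 y0 y1
  = (rect f x0 x1 y0 y1 + rect g x0 x1 y0 y1)%C.
Proof.
  intros Hf Hg. unfold rect. rewrite !hint_plus, !vint_plus by auto. ring.
Qed.

Lemma rect_primitive (G g : C -> C) x0 x1 y0 y1 :
  ccont g -> (forall z, cderiv G z (g z)) -> rect g x0 x1 y0 y1 = RtoC 0.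
Proof.
  intros Hc HG.
  assert (Hh : forall y, hint g x0 x1 y = (G (x1, y) - G (x0, y))%C).
  { intros y. unfold hint.
    rewrite <- (CInt_primitive (fun x => (x, y)) (fun _ => RtoC 1) G g); auto.
    - apply CInt_ext. intros t; ring.
    - apply is_derive_hline.
    - intros t.
      apply Ccont_mult; [now apply Rcont_h | apply continuous_const]. }
  assert (Hv : forall x, vint g x y0 y1 = (G (x, y1) - G (x, y0))%C).
  { intros x. unfold vint.
    rewrite <- (CInt_primitive (fun y => (x, y)) (fun _ => Ci) G g); auto.
    - apply CInt_ext. intros t; ring.
    - apply is_derive_vline.
    - intros t. apply continuous_ext with (fun y => (Ci * g (x, y))%C).
      { intros y. apply Cmult_comm. }
      now apply Rcont_v. }
  unfold rect. rewrite !Hh, !Hv. ring.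
Qed.

(** A rectangle on which the boundary integral is not small compared to the
    squared half perimeter has a quarter with the same property, because that
    square scales like the area.  The nested quarters shrink to a point [p];
    there the affine part of [f] integrates to zero and the remainder is too
    small. *)
Section Goursat.
Variables (f : C -> C) (x0 y0 w h : R).
Hypotheses (Hf : ccont f) (Hw : 0 <= w) (Hh : 0 <= h).
Variable eps : R.
Hypothesis Heps : 0 < eps.

Definition bad (n : nat) (z : C) : Prop :=
  eps * ((w + h) / 2 ^ n) ^ 2
  < Cmod (rect f (fst z) (fst z + w / 2 ^ n) (snd z) (snd z + h / 2 ^ n)).

Lemma bad_step n z : bad n z -> { z' : C | bad (S n) z' /\
  fst z <= fst z' <= fst z + w / 2 ^ S n /\
  snd z <= snd z' <= snd z + h / 2 ^ S n }.
Proof.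
  intros Hbad. destruct z as [x y].
  assert (E2 : 0 < 2 ^ n) by (apply pow_lt; lra).
  assert (Ew : w / 2 ^ n = 2 * (w / 2 ^ S n)) by (simpl; field; lra).
  assert (Eh : h / 2 ^ n = 2 * (h / 2 ^ S n)) by (simpl; field; lra).
  set (w' := w / 2 ^ S n) in *. set (h' := h / 2 ^ S n) in *.
  assert (Hw' : 0 <= w').
  { apply Rdiv_le_0_compat; [auto|]. simpl. lra. }
  assert (Hh' : 0 <= h').
  { apply Rdiv_le_0_compat; [auto|]. simpl. lra. }
  assert (D : forall z : C, { bad (S n) z } + { ~ bad (S n) z })
    by (intros; apply Rlt_dec).
  assert (Bnd : forall a b : C, Cmod (a + b) <= Cmod a + Cmod b)
    by (intros; apply Cmod_triangle).
  destruct (D (x, y)) as [B1|B1]; [exists (x, y); simpl; split; [auto|lra]|].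
  destruct (D (x + w', y)) as [B2|B2];
    [exists (x + w', y); simpl; split; [auto|lra]|].
  destruct (D (x, y + h')) as [B3|B3];
    [exists (x, y + h'); simpl; split; [auto|lra]|].
  destruct (D (x + w', y + h')) as [B4|B4];
    [exists (x + w', y + h'); simpl; split; [auto|lra]|].
  exfalso. unfold bad in *. cbn [fst snd] in *.
  fold w' h' in B1, B2, B3, B4. apply Rnot_lt_le in B1, B2, B3, B4.
  revert Hbad. apply Rle_not_lt. rewrite Ew, Eh.
  rewrite (rect_split_x f Hf x (x + w')).
  rewrite (rect_split_y f Hf x (x + w') y (y + h')).
  rewrite (rect_split_y f Hf (x + w') _ y (y + h')).
  replace (x + 2 * w') with (x + w' + w') by ring.
  replace (y + 2 * h') with (y + h' + h') by ring.
  eapply Rle_trans; [apply Cmod_triangle|].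
  eapply Rle_trans; [apply Rplus_le_compat; apply Cmod_triangle|].
  replace ((w + h) / 2 ^ n) with (2 * ((w + h) / 2 ^ S n))
    by (simpl; field; lra).
  nra.
Qed.

Hypothesis H0 : bad 0 (x0, y0).

Fixpoint bad_seq (n : nat) : { z : C | bad n z } :=
  match n with
  | O => exist _ (x0, y0) H0
  | S m => let s := bad_step m (proj1_sig (bad_seq m)) (proj2_sig (bad_seq m))
           in exist _ (proj1_sig s) (proj1 (proj2_sig s))
  end.

Lemma bad_seq_nested n :
  let z := proj1_sig (bad_seq n) in let z' := proj1_sig (bad_seq (S n)) in
  fst z <= fst z' <= fst z + w / 2 ^ S n /\
  snd z <= snd z' <= snd z + h / 2 ^ S n.
Proof. simpl. destruct bad_step; simpl in *; tauto. Qed.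

End Goursat.

Lemma nested_point (a : nat -> R) (w : R) :
  0 <= w -> (forall n, a n <= a (S n) <= a n + w / 2 ^ S n) ->
  exists p, forall n, a n <= p <= a n + w / 2 ^ n.
Proof.
  intros Hw Ha.
  assert (Hpow : forall n, 0 < 2 ^ n) by (intros; apply pow_lt; lra).
  assert (Hmon : forall n k, a n <= a (n + k)%nat
                   /\ a (n + k)%nat + w / 2 ^ (n + k) <= a n + w / 2 ^ n).
  { intros n k. induction k as [|k IH].
    - rewrite Nat.add_0_r. lra.
    - rewrite Nat.add_succ_r.
      assert (H := Ha (n + k)%nat). assert (h := Hpow (n + k)%nat).
      assert (E : w / 2 ^ (n + k) = 2 * (w / 2 ^ S (n + k)))
        by (simpl; field; lra). lra. }
  assert (Hwn : forall n, 0 <= w / 2 ^ n)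
    by (intros; apply Rdiv_le_0_compat; auto).
  assert (Hcross : forall n m, a n <= a m + w / 2 ^ m).
  { intros n m. destruct (Nat.le_ge_cases n m) as [H|H].
    - destruct (Hmon n (m - n)%nat) as [h _].
      replace (n + (m - n))%nat with m in h by lia.
      specialize (Hwn m). lra.
    - destruct (Hmon m (n - m)%nat) as [_ h].
      replace (m + (n - m))%nat with n in h by lia.
      specialize (Hwn n). lra. }
  destruct (completeness (fun r => exists n, r = a n)) as [p [Hub Hlub]].
  - exists (a 0%nat + w / 2 ^ 0). intros r [n ->]. apply Hcross.
  - exists (a 0%nat), 0%nat. reflexivity.
  - exists p. intros n. split.
    + apply Hub. now exists n.
    + apply Hlub. intros r [m ->]. apply Hcross.
Qed.

Lemma small_pow2 (A d : R) : 0 < d -> exists n, A / 2 ^ n < d.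
Proof.
  intros Hd.
  destruct (Pow_x_infinity 2 ltac:(rewrite Rabs_pos_eq; lra) (Rabs A / d + 1))
    as [n Hn].
  exists n. specialize (Hn n (Nat.le_refl n)).
  assert (Hp : 0 < 2 ^ n) by (apply pow_lt; lra).
  rewrite (Rabs_pos_eq (2 ^ n)) in Hn by lra.
  apply Rlt_div_l; [lra|].
  assert (E : Rabs A / d * d = Rabs A) by (field; lra).
  assert (h := Rle_abs A). nra.
Qed.

Lemma goursat_rect (f : C -> C) x0 x1 y0 y1 :
  ccont f -> x0 <= x1 -> y0 <= y1 ->
  (forall z, in_rect x0 x1 y0 y1 z -> cdiff f z) ->
  rect f x0 x1 y0 y1 = RtoC 0.
Proof.
  intros Hf Hx Hy Hd.
  destruct (Ceq_dec (rect f x0 x1 y0 y1) 0) as [E|E]; [exact E|exfalso].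
  apply Cmod_gt_0 in E.
  set (w := x1 - x0). set (h := y1 - y0).
  set (eps := Cmod (rect f x0 x1 y0 y1) / ((w + h) ^ 2 + 1)).
  assert (Hpos : 0 < (w + h) ^ 2 + 1) by (assert (i := pow2_ge_0 (w + h)); lra).
  assert (Heps : 0 < eps) by now apply Rdiv_lt_0_compat.
  assert (Hw : 0 <= w) by (unfold w; lra).
  assert (Hh : 0 <= h) by (unfold h; lra).
  assert (H0 : bad f w h eps 0 (x0, y0)).
  { unfold bad. cbn [fst snd pow]. rewrite !Rdiv_1_r.
    replace (x0 + w) with x1 by (unfold w; ring).
    replace (y0 + h) with y1 by (unfold h; ring).
    replace (Cmod (rect f x0 x1 y0 y1)) with (eps * ((w + h) ^ 2 + 1))
      by (unfold eps; field; lra).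
    simpl. nra. }
  set (s := fun n => proj1_sig (bad_seq f x0 y0 w h Hf Hw Hh eps H0 n)).
  assert (Hn := bad_seq_nested f x0 y0 w h Hf Hw Hh eps H0).
  destruct (nested_point (fun n => fst (s n)) w Hw (fun n => proj1 (Hn n)))
    as [p1 Hp1].
  destruct (nested_point (fun n => snd (s n)) h Hh (fun n => proj2 (Hn n)))
    as [p2 Hp2].
  set (p := (p1, p2) : C).
  assert (Hp : in_rect x0 x1 y0 y1 p).
  { specialize (Hp1 0%nat). specialize (Hp2 0%nat). unfold s in Hp1, Hp2.
    cbn in Hp1, Hp2. rewrite Rdiv_1_r in Hp1, Hp2.
    unfold w, h in Hp1, Hp2. split; simpl; lra. }
  destruct (Hd p Hp) as (l & q & Hq & Hc & Hl).
  destruct (continuous_ball q p (eps / 2) Hc ltac:(lra)) as (d & Hdpos & Hqd).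
  destruct (small_pow2 (w + h) d Hdpos) as [n Hnd].
  assert (Hbad := proj2_sig (bad_seq f x0 y0 w h Hf Hw Hh eps H0 n)).
  fold (s n) in Hbad. unfold bad in Hbad.
  specialize (Hp1 n). specialize (Hp2 n). simpl in Hp1, Hp2.
  set (X := fst (s n)) in *. set (Y := snd (s n)) in *.
  assert (H2n : 0 < 2 ^ n) by (apply pow_lt; lra).
  assert (Esum : (w + h) / 2 ^ n = w / 2 ^ n + h / 2 ^ n) by (field; lra).
  assert (Hwn : 0 <= w / 2 ^ n) by now apply Rdiv_le_0_compat.
  assert (Hhn : 0 <= h / 2 ^ n) by now apply Rdiv_le_0_compat.
  rewrite Esum in *.
  set (w' := w / 2 ^ n) in *. set (h' := h / 2 ^ n) in *.
  revert Hbad. apply Rle_not_lt.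
  set (aff := fun z => (f p + l * (z - p))%C).
  set (err := fun z => (f z - aff z)%C).
  assert (Haff : forall z, cderiv
    (fun z => (f p * z + l / RtoC 2 * ((z - p) * (z - p)))%C) z (aff z)).
  { intros z. unfold aff.
    exists (fun v => f p + l / RtoC 2 * ((v - p) + (z - p)))%C.
    split; [intros v; field | split; [|field]].
    apply Ccont_plus; [apply continuous_const|].
    apply Ccont_mult; [apply continuous_const|].
    apply Ccont_plus; [apply Ccont_sub | apply continuous_const]. }
  assert (Haffc : ccont aff).
  { intros z. apply Ccont_plus; [apply continuous_const|].
    apply Ccont_mult; [apply continuous_const | apply Ccont_sub]. }
  assert (Herrc : ccont err) by (intros z; apply Ccont_minus; auto).
  assert (Ef : rect f X (X + w') Y (Y + h')
               = rect err X (X + w') Y (Y + h')).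
  { transitivity (rect (fun z => (err z + aff z)%C) X (X + w') Y (Y + h')).
    - replace f with (fun z => f z) at 1 by reflexivity.
      unfold rect, hint, vint. f_equal; [f_equal; [f_equal|]|];
        try (apply f_equal); apply CInt_ext; intros t; unfold err; ring.
    - rewrite rect_plus by auto.
      rewrite (rect_primitive _ aff) by eauto. ring. }
  rewrite Ef.
  replace (eps * (w' + h') ^ 2)
    with (2 * ((X + w' - X) + (Y + h' - Y)) * (eps / 2 * (w' + h')))
    by (simpl; field).
  apply rect_norm; auto; try lra.
  intros z [Hz1 Hz2].
  assert (Hdist : Cmod (z - p) <= w' + h').
  { destruct z as [z1 z2]. simpl in Hz1, Hz2.
    eapply Rle_trans; [apply Cmod_le_sum|].
    unfold p; simpl.
    assert (Rabs (z1 + - p1) <= w') by (apply Rabs_le; lra).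
    assert (Rabs (z2 + - p2) <= h') by (apply Rabs_le; lra). lra. }
  replace (err z) with ((q z - q p) * (z - p))%C
    by (unfold err, aff; rewrite (Hq z), Hl; ring).
  rewrite Cmod_mult.
  apply Rmult_le_compat; auto using Cmod_ge_0.
  left. apply Hqd. lra.
Qed.

(** One exceptional point is harmless when the function is continuous there:
    the point is enclosed in a small rectangle, whose boundary integral tends
    to zero with its size, while Goursat's theorem applies to the rest. *)
Lemma goursat_except (f : C -> C) x0 x1 y0 y1 (p : C) :
  ccont f -> x0 <= x1 -> y0 <= y1 ->
  (forall z, in_rect x0 x1 y0 y1 z -> z <> p -> cdiff f z) ->
  rect f x0 x1 y0 y1 = RtoC 0.
Proof.
  intros Hf Hx Hy Hd.
  destruct (classic (in_rect x0 x1 y0 y1 p)) as [Hp|Hp].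
  2:{ apply goursat_rect; auto. intros z Hz. apply Hd; auto.
      intros ->. contradiction. }
  destruct (Ceq_dec (rect f x0 x1 y0 y1) 0) as [E|E]; [exact E|exfalso].
  apply Cmod_gt_0 in E. set (rho := Cmod (rect f x0 x1 y0 y1)) in *.
  destruct (continuous_ball f p 1 (Hf p) ltac:(lra))
    as (d & Hdp & Hfd).
  set (M := Cmod (f p) + 1).
  assert (HM : 0 < M) by (assert (i := Cmod_ge_0 (f p)); unfold M; lra).
  set (e := Rmin (d / 3) (rho / (16 * M))).
  assert (He : 0 < e).
  { apply Rmin_pos; [lra|]. apply Rdiv_lt_0_compat; lra. }
  assert (He1 : e <= d / 3) by apply Rmin_l.
  assert (He2 : 16 * e * M <= rho).
  { apply Rle_trans with (16 * (rho / (16 * M)) * M).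
    - apply Rmult_le_compat_r; [lra|]. apply Rmult_le_compat_l; [lra|].
      apply Rmin_r.
    - right. field. lra. }
  destruct p as [p1 p2]. destruct Hp as [Hp1 Hp2]. simpl in Hp1, Hp2.
  set (a1 := Rmax x0 (p1 - e)). set (a2 := Rmin x1 (p1 + e)).
  set (b1 := Rmax y0 (p2 - e)). set (b2 := Rmin y1 (p2 + e)).
  assert (Hlo : forall s c, s <= c -> s <= Rmax s (c - e)
            /\ c - e <= Rmax s (c - e) <= c
            /\ (Rmax s (c - e) = s \/ Rmax s (c - e) = c - e)).
  { intros s c Hsc. destruct (Rle_dec s (c - e));
      [rewrite Rmax_right by lra | rewrite Rmax_left by lra];
      repeat split; try lra; auto. }
  assert (Hhi : forall s c, c <= s -> Rmin s (c + e) <= s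
            /\ c <= Rmin s (c + e) <= c + e
            /\ (Rmin s (c + e) = s \/ Rmin s (c + e) = c + e)).
  { intros s c Hsc. destruct (Rle_dec s (c + e));
      [rewrite Rmin_left by lra | rewrite Rmin_right by lra];
      repeat split; try lra; auto. }
  assert (Ha1 := Hlo x0 p1 (proj1 Hp1)). assert (Ha2 := Hhi x1 p1 (proj2 Hp1)).
  assert (Hb1 := Hlo y0 p2 (proj1 Hp2)). assert (Hb2 := Hhi y1 p2 (proj2 Hp2)).
  fold a1 in Ha1. fold a2 in Ha2. fold b1 in Hb1. fold b2 in Hb2.
  clearbody a1 a2 b1 b2.
  (* An outer piece is degenerate when the point lies on that edge. *)
  assert (Hpiece : forall u1 u2 v1 v2, x0 <= u1 <= u2 -> u2 <= x1 ->
            y0 <= v1 <= v2 -> v2 <= y1 ->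
            ~ in_rect u1 u2 v1 v2 (p1, p2) -> rect f u1 u2 v1 v2 = RtoC 0).
  { intros u1 u2 v1 v2 i1 i2 i3 i4 Hn. apply goursat_rect; auto; try lra.
    intros z [Hz1 Hz2]. apply Hd; [split; lra|]. intros ->. now apply Hn. }
  assert (L : rect f x0 a1 y0 y1 = RtoC 0).
  { destruct (proj2 (proj2 Ha1)) as [->|Ea]; [now apply rect_degenerate_x|].
    apply Hpiece; try lra. intros [Hu _]; simpl in Hu; lra. }
  assert (Ri : rect f a2 x1 y0 y1 = RtoC 0).
  { destruct (proj2 (proj2 Ha2)) as [->|Ea]; [now apply rect_degenerate_x|].
    apply Hpiece; try lra. intros [Hu _]; simpl in Hu; lra. }
  assert (Dn : rect f a1 a2 y0 b1 = RtoC 0).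
  { destruct (proj2 (proj2 Hb1)) as [->|Ea]; [now apply rect_degenerate_y|].
    apply Hpiece; try lra. intros [_ Hv]; simpl in Hv; lra. }
  assert (Up : rect f a1 a2 b2 y1 = RtoC 0).
  { destruct (proj2 (proj2 Hb2)) as [->|Ea]; [now apply rect_degenerate_y|].
    apply Hpiece; try lra. intros [_ Hv]; simpl in Hv; lra. }
  assert (Er : rect f x0 x1 y0 y1 = rect f a1 a2 b1 b2).
  { rewrite (rect_split_x f Hf x0 a1 x1), (rect_split_x f Hf a1 a2 x1), L, Ri.
    rewrite (rect_split_y f Hf a1 a2 y0 b1), (rect_split_y f Hf a1 a2 b1 b2).
    rewrite Dn, Up. ring. }
  assert (Hsmall : Cmod (rect f a1 a2 b1 b2)
                   <= 2 * ((a2 - a1) + (b2 - b1)) * M).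
  { apply rect_norm; auto; try lra.
    intros [u v] [Hu Hv]; simpl in Hu, Hv.
    assert (Hclose : Cmod ((u, v) - (p1, p2)) < d).
    { eapply Rle_lt_trans; [apply Cmod_le_sum|]. simpl.
      assert (Rabs (u + - p1) <= e) by (apply Rabs_le; lra).
      assert (Rabs (v + - p2) <= e) by (apply Rabs_le; lra). lra. }
    assert (i := Hfd _ Hclose).
    replace (f (u, v)) with ((f (u, v) - f (p1, p2)) + f (p1, p2))%C by ring.
    eapply Rle_trans; [apply Cmod_triangle|]. unfold M. lra. }
  rewrite <- Er in Hsmall. fold rho in Hsmall.
  assert (2 * ((a2 - a1) + (b2 - b1)) * M <= 2 * (4 * e) * M).
  { apply Rmult_le_compat_r; lra. }
  assert (0 < e * M) by now apply Rmult_lt_0_compat.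
  lra.
Qed.

(** * Primitives and the Taylor expansion *)

Definition in_square (r : R) (z : C) : Prop :=
  Rabs (fst z) < r /\ Rabs (snd z) < r.

Lemma primitive_on_square (f : C -> C) (r : R) (p : C) :
  0 < r -> ccont f -> (forall z, in_square r z -> z <> p -> cdiff f z) ->
  exists F : C -> C, forall z, in_square r z -> cderiv F z (f z).
Proof.
  intros Hr Hf Hd.
  assert (H1 : forall x0 x1 y0 y1, x0 <= x1 -> y0 <= y1 ->
            in_square r (x0, y0) -> in_square r (x1, y1) ->
            rect f x0 x1 y0 y1 = RtoC 0).
  { intros x0 x1 y0 y1 Hx Hy [h1 h2] [h3 h4]. simpl in h1, h2, h3, h4.
    apply goursat_except with p; auto. intros z [Hz1 Hz2] Hzp. apply Hd; auto.
    apply Rabs_lt_between in h1, h2, h3, h4.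
    split; apply Rabs_lt_between; lra. }
  assert (H2 : forall x0 x1 y0 y1, y0 <= y1 ->
            in_square r (x0, y0) -> in_square r (x1, y1) ->
            rect f x0 x1 y0 y1 = RtoC 0).
  { intros x0 x1 y0 y1 Hy [h1 h2] [h3 h4].
    destruct (Rle_dec x0 x1) as [h|h]; [now apply H1; try split|].
    assert (E := rect_split_x f Hf x0 x1 x0 y0 y1).
    rewrite (H1 x1 x0), (rect_degenerate_x f Hf) in E by (lra || now split).
    rewrite E. ring. }
  assert (Hrect : forall x0 x1 y0 y1,
            in_square r (x0, y0) -> in_square r (x1, y1) ->
            rect f x0 x1 y0 y1 = RtoC 0).
  { intros x0 x1 y0 y1 [h1 h2] [h3 h4].
    destruct (Rle_dec y0 y1) as [h|h]; [now apply H2; try split|].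
    assert (E := rect_split_y f Hf x0 x1 y0 y1 y0).
    rewrite (H2 x0 x1 y1 y0), (rect_degenerate_y f Hf) in E
      by (lra || now split).
    rewrite E. ring. }
  exists (fun z => (hint f 0 (fst z) 0 + vint f (fst z) 0 (snd z))%C).
  intros [x y] [Hx Hy]. simpl in Hx, Hy.
  apply cderiv_eps. intros eps He.
  destruct (continuous_ball f (x, y) (eps / 2) (Hf (x, y)) ltac:(lra))
    as (d & Hdp & Hfd).
  set (d' := Rmin (d / 2) (Rmin (r - Rabs x) (r - Rabs y))).
  assert (Hd' : 0 < d') by (repeat apply Rmin_pos; lra).
  assert (Hd1 : d' <= d / 2) by apply Rmin_l.
  assert (Hd2 : d' <= r - Rabs x)
    by (eapply Rle_trans; [apply Rmin_r | apply Rmin_l]).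
  assert (Hd3 : d' <= r - Rabs y)
    by (eapply Rle_trans; [apply Rmin_r | apply Rmin_r]).
  apply locally_Cmod. exists d'. split; auto.
  intros [x' y'] Hw. simpl.
  assert (Hwx := fst_le_Cmod ((x', y') - (x, y))%C). simpl in Hwx.
  assert (Hwy := im_le_Cmod ((x', y') - (x, y))%C). simpl in Hwy.
  change (x' + - x) with (x' - x) in Hwx.
  change (y' + - y) with (y' - y) in Hwy.
  set (D := Cmod ((x', y') - (x, y))) in *.
  assert (Hx' : Rabs x' < r).
  { replace x' with ((x' - x) + x) by ring.
    eapply Rle_lt_trans; [apply Rabs_triang|]. lra. }
  set (k := (- f (x, y))%C).
  assert (Hk : ccont (fun _ => k)) by (intros z; apply continuous_const).
  assert (Hfk : ccont (fun z => (f z + k)%C))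
    by (intros z; apply Ccont_plus; auto).
  assert (E : (hint f 0 x' 0 + vint f x' 0 y'
               - (hint f 0 x 0 + vint f x 0 y) - ((x', y') - (x, y)) * f (x, y)
               = hint (fun z => f z + k) x x' y
                 + vint (fun z => f z + k) x' y y')%C).
  { rewrite hint_plus, vint_plus by auto.
    assert (E0 : rect f x x' 0 y = RtoC 0)
      by (apply Hrect; split; simpl; rewrite ?Rabs_R0; auto).
    unfold rect in E0.
    assert (E1 : hint f x x' y
                 = (hint f x x' 0 + vint f x' 0 y - vint f x 0 y)%C).
    { symmetry. rewrite <- (Cplus_0_r (hint f x x' y)), <- E0. ring. }
    assert (E2 : hint (fun _ => k) x x' y = (RtoC (x' - x) * k)%C)
      by exact (CInt_const k x x').
    assert (E3 : vint (fun _ => k) x' y y' = (RtoC (y' - y) * (Ci * k))%C)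
      by exact (CInt_const (Ci * k)%C y y').
    rewrite E1, E2, E3. unfold hint, vint.
    rewrite <- (CInt_chasles (fun t => f (t, 0)) 0 x x') by auto.
    rewrite <- (CInt_chasles (fun t => (Ci * f (x', t))%C) 0 y y') by auto.
    replace ((x', y') - (x, y))%C with (RtoC (x' - x) + RtoC (y' - y) * Ci)%C
      by (unfold RtoC, Ci, Cminus, Cplus, Copp, Cmult; simpl; f_equal; ring).
    unfold k. ring. }
  rewrite E. clear E.
  assert (Hbetween : forall s s' t, Rmin s s' <= t <= Rmax s s' ->
            Rabs (t - s) <= Rabs (s' - s)).
  { intros s s' t Ht. unfold Rmin, Rmax in Ht. destruct (Rle_dec s s').
    - rewrite !Rabs_pos_eq by lra. lra.
    - rewrite !Rabs_left1 by lra. lra. }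
  assert (Hh : Cmod (hint (fun z => f z + k)%C x x' y)
               <= Rabs (x' - x) * (eps / 2)).
  { apply CInt_norm; [exact (Rcont_h _ y Hfk)|]. intros t Ht. left. apply Hfd.
    eapply Rle_lt_trans; [apply Cmod_le_sum|]. simpl.
    assert (Rabs (t + - x) <= Rabs (x' - x)) by exact (Hbetween x x' t Ht).
    rewrite Rplus_opp_r, Rabs_R0. lra. }
  assert (Hv : Cmod (vint (fun z => f z + k)%C x' y y')
               <= Rabs (y' - y) * (eps / 2)).
  { apply CInt_norm; [exact (Rcont_v _ x' Hfk)|]. intros t Ht.
    rewrite Cmod_mult, Cmod_Ci, Rmult_1_l. left. apply Hfd.
    eapply Rle_lt_trans; [apply Cmod_le_sum|]. simpl.
    assert (Rabs (t + - y) <= Rabs (y' - y)) by exact (Hbetween y y' t Ht).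
    change (x' + - x) with (x' - x). lra. }
  eapply Rle_trans; [apply Cmod_triangle|]. nra.
Qed.

Definition cexpi (t : R) : C := (cos t, sin t).

Lemma Cmod_cexpi t : Cmod (cexpi t) = 1.
Proof.
  unfold Cmod, cexpi; simpl fst; simpl snd.
  assert (h := sin2_cos2 t). unfold Rsqr in h.
  replace (cos t ^ 2 + sin t ^ 2) with 1 by (rewrite <- h; ring).
  apply sqrt_1.
Qed.

Definition on_circle (r t : R) : C := (RtoC r * cexpi t)%C.

Lemma Cmod_on_circle r t : 0 < r -> Cmod (on_circle r t) = r.
Proof.
  intros Hr. unfold on_circle. rewrite Cmod_mult, Cmod_cexpi, Cmod_R.
  rewrite Rabs_pos_eq; lra.
Qed.

Lemma on_circle_neq0 r t : 0 < r -> on_circle r t <> RtoC 0.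
Proof. intros Hr. apply Cmod_gt_0. rewrite Cmod_on_circle; lra. Qed.

Lemma real_derive_eps (u : R -> R) (t l : R) :
  is_derive u t l -> forall eps, 0 < eps ->
  locally t (fun s => Rabs (u s - u t - (s - t) * l) <= eps * Rabs (s - t)).
Proof.
  intros [_ H] eps He.
  exact (H t (fun P HP => HP) (mkposreal _ He)).
Qed.

Lemma is_derive_circle r t :
  @is_derive R_AbsRing C_R_NormedModule (on_circle r) t (Ci * on_circle r t)%C.
Proof.
  apply curve_derive_eps. intros eps He.
  assert (Hc : is_derive (fun s => r * cos s) t (r * - sin t)).
  { auto_derive; auto. ring. }
  assert (Hs : is_derive (fun s => r * sin s) t (r * cos t)).
  { auto_derive; auto. ring. }
  assert (Hc' := real_derive_eps _ _ _ Hc (eps / 2) ltac:(lra)).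
  assert (Hs' := real_derive_eps _ _ _ Hs (eps / 2) ltac:(lra)).
  generalize (filter_and _ _ Hc' Hs'). apply filter_imp. intros s [H1 H2].
  match goal with |- Cmod ?X <= _ => replace X with
    (r * cos s - r * cos t - (s - t) * (r * - sin t),
     r * sin s - r * sin t - (s - t) * (r * cos t)) end.
  - eapply Rle_trans; [apply Cmod_le_sum|]. lra.
  - unfold on_circle, cexpi, RtoC, Ci, Cminus, Cplus, Copp, Cmult; simpl.
    f_equal; ring.
Qed.

Lemma Rcont_circle r : Rcont (on_circle r).
Proof.
  intros t. apply (@ex_derive_continuous R_AbsRing C_R_NormedModule).
  eexists. apply is_derive_circle.
Qed.

Lemma on_circle_period r : on_circle r (2 * PI) = on_circle r 0.
Proof.
  unfold on_circle, cexpi. now rewrite cos_2PI, sin_2PI, cos_0, sin_0.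
Qed.

Definition cmean (r : R) (u : C -> C) : C :=
  CInt (fun t => u (on_circle r t)) 0 (2 * PI).

Lemma cmean_primitive (r : R) (F f : C -> C) :
  0 < r -> (forall t, continuous f (on_circle r t)) ->
  (forall t, cderiv F (on_circle r t) (f (on_circle r t))) ->
  cmean r (fun w => f w * w)%C = RtoC 0.
Proof.
  intros Hr Hc HF.
  assert (Hcont : Rcont (fun t => (f (on_circle r t) * on_circle r t)%C)).
  { intros t. apply Ccont_mult; [|apply Rcont_circle].
    apply (continuous_comp (on_circle r) f); auto. apply Rcont_circle. }
  assert (E : CInt (fun t => (f (on_circle r t) * (Ci * on_circle r t))%C)
                0 (2 * PI) = RtoC 0).
  { rewrite (CInt_primitive (on_circle r) _ F f).
    - rewrite on_circle_period. ring.
    - exact HF.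
    - apply is_derive_circle.
    - intros t.
      apply continuous_ext
        with (fun t => (Ci * (f (on_circle r t) * on_circle r t))%C).
      { intros s. now rewrite !Cmult_assoc, (Cmult_comm Ci). }
      apply Ccont_mult; [apply continuous_const | apply Hcont]. }
  rewrite (CInt_ext _ (fun t => (Ci * (f (on_circle r t) * on_circle r t))%C))
    in E by (intros; ring).
  rewrite CInt_mult_const in E by exact Hcont.
  change (Ci * cmean r (fun w => f w * w) = RtoC 0)%C in E.
  replace (cmean r (fun w => f w * w)%C)
    with (/ Ci * (Ci * cmean r (fun w => f w * w)))%C
    by (field; apply Ci_nz).
  rewrite E. ring.
Qed.

Lemma cderiv_inv_pow (n : nat) (z : C) :
  z <> RtoC 0 ->
  cderiv (fun w => (/ w) ^ n)%C z (- RtoC (INR n) * (/ z) ^ S n)%C.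
Proof.
  intros Hz.
  assert (Hinv : cderiv (fun w => / w)%C z (- (/ z) ^ 2)%C).
  { destruct (cdiff_inv (fun w => w) z (cdiff_id z) Hz) as [l Hl].
    assert (E : cderiv (fun w => w * / w)%C z (RtoC 1 * / z + z * l)%C)
      by (apply (cderiv_mult (fun w => w) Cinv); auto using cderiv_id).
    assert (E1 : cderiv (fun w => w * / w)%C z (RtoC 0)).
    { apply cderiv_ext_loc with (fun _ => RtoC 1); [|apply cderiv_const].
      generalize (Clocally_neq (fun w => w) z _ (continuous_id z) Hz).
      apply filter_imp. intros w Hw. symmetry. now apply Cinv_r. }
    apply cderiv_is_derive, is_C_derive_unique in E, E1.
    rewrite E in E1.
    replace (- (/ z) ^ 2)%C with l; auto.
    replace l with (/ z * (RtoC 1 * / z + z * l) - (/ z) ^ 2)%C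
      by (field; auto).
    rewrite E1. ring. }
  induction n as [|n IH].
  - simpl. replace (- RtoC 0 * (/ z * RtoC 1))%C with (RtoC 0) by ring.
    apply cderiv_const.
  - replace (- RtoC (INR (S n)) * (/ z) ^ S (S n))%C
      with (- (/ z) ^ 2 * (/ z) ^ n + / z * (- RtoC (INR n) * (/ z) ^ S n))%C.
    + apply (cderiv_mult Cinv (fun w => (/ w) ^ n)%C); auto.
    + rewrite S_INR, RtoC_plus. simpl. ring.
Qed.

Lemma Ccont_inv_pow (n : nat) (z : C) :
  z <> RtoC 0 -> continuous (fun w => (/ w) ^ n)%C z.
Proof.
  intros Hz. apply Ccont_pow. apply Ccont_inv; [apply continuous_id | auto].
Qed.

Lemma cmean_inv_pow (r : R) (n : nat) :
  0 < r -> cmean r (fun w => (/ w) ^ S n)%C = RtoC 0.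
Proof.
  intros Hr.
  assert (Hn : RtoC (INR (S n)) <> RtoC 0).
  { intros E. apply RtoC_inj in E. now apply (not_0_INR (S n)) in E. }
  transitivity (cmean r (fun w => (/ w) ^ S (S n) * w)%C).
  { apply CInt_ext. intros t.
    assert (H0 := on_circle_neq0 r t Hr). simpl. field; auto. }
  apply cmean_primitive
    with (F := fun w => (- / RtoC (INR (S n)) * (/ w) ^ S n)%C); auto.
  - intros t. apply Ccont_inv_pow. now apply on_circle_neq0.
  - intros t. set (z := on_circle r t).
    assert (Hz : z <> RtoC 0) by now apply on_circle_neq0.
    replace ((/ z) ^ S (S n))%C
      with (RtoC 0 * (/ z) ^ S n
            + - / RtoC (INR (S n)) * (- RtoC (INR (S n)) * (/ z) ^ S (S n)))%C
      by (field; auto).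
    apply (cderiv_mult (fun _ => - / RtoC (INR (S n)))%C
             (fun w => (/ w) ^ S n)%C);
      [apply cderiv_const | now apply cderiv_inv_pow].
Qed.

(** Cauchy's theorem for the difference quotient [q] of [f] at [a] says that
    the circle integral of [q w * w] vanishes.  Writing [w = (w - a) + a]
    repeatedly turns this into the Taylor expansion about 0, evaluated at [a],
    where [b k] is the remainder after [k] terms, divided by [a ^ k].  The
    value of the integral of [/ (w - a)] never enters. *)
Lemma taylor_at_0 (f : C -> C) (r' r : R) :
  0 < r < r' -> ccont f -> (forall z, in_square r' z -> cdiff f z) ->
  exists (c : nat -> C) (B : R), 0 <= B /\
    exists rho, 0 < rho <= r / 2 /\ forall a, Cmod a <= rho ->
    exists b : nat -> C,
      b 0%nat = f a /\
      (forall k, b k = (c k + a * b (S k))%C) /\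
      (forall k, Cmod (b (S k)) <= B / r ^ k).
Proof.
  intros Hr Hf Hd.
  assert (Hpi : 0 < 2 * PI) by (assert (h := PI_RGT_0); lra).
  assert (Hpi0 : RtoC (2 * PI) <> RtoC 0)
    by (intros E; apply RtoC_inj in E; lra).
  assert (HM : exists M, forall t, 0 <= t <= 2 * PI ->
                 Cmod (f (on_circle r t)) <= M).
  { assert (Hc : forall t, 0 <= t <= 2 * PI ->
              continuity_pt (fun t => Cmod (f (on_circle r t))) t).
    { intros t _. apply continuity_pt_filterlim.
      apply continuous_ext with
        (fun t => @norm R_AbsRing C_R_NormedModule (f (on_circle r t))).
      { intros s. symmetry. apply Cmod_norm. }
      apply (continuous_comp (fun t => f (on_circle r t))
               (@norm R_AbsRing C_R_NormedModule)).
      - apply (continuous_comp (on_circle r) f); auto. apply Rcont_circle.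
      - apply (@filterlim_norm R_AbsRing C_R_NormedModule). }
    destruct (continuity_ab_maj _ 0 (2 * PI) ltac:(lra) Hc) as (t0 & H0 & _).
    exists (Cmod (f (on_circle r t0))). exact H0. }
  destruct HM as [M0 HM].
  set (M := Rmax M0 (Cmod (f 0) + 1)).
  assert (HM0 : 0 <= M).
  { apply Rle_trans with (Cmod (f 0) + 1); [|apply Rmax_r].
    assert (h := Cmod_ge_0 (f 0)). lra. }
  destruct (continuous_ball f (RtoC 0) 1 (Hf (RtoC 0)) ltac:(lra))
    as (d & Hdp & Hfd).
  set (coef := fun k => cmean r (fun w => f w * (/ w) ^ k)%C).
  set (B := 4 * M / r).
  assert (HB : 0 <= B)
    by (unfold B; apply Rdiv_le_0_compat; lra).
  assert (Hsq : forall z, Cmod z <= r -> in_square r' z).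
  { intros z Hz. split; eapply Rle_lt_trans.
    - apply fst_le_Cmod.
    - lra.
    - apply im_le_Cmod.
    - lra. }
  exists (fun k => (coef k / RtoC (2 * PI))%C), B. split; [exact HB|].
  exists (Rmin (r / 2) (d / 2)).
  split; [split; [apply Rmin_pos; lra | apply Rmin_l]|].
  intros a Har.
  assert (Ha : Cmod a <= r / 2) by (eapply Rle_trans; [exact Har|apply Rmin_l]).
  assert (Hfa : Cmod (f a) <= M).
  { apply Rle_trans with (Cmod (f 0) + 1); [|apply Rmax_r].
    assert (h : Cmod (f a - f 0) < 1).
    { apply Hfd. replace (a - 0)%C with a by ring.
      apply Rle_lt_trans with (d / 2); [|lra].
      eapply Rle_trans; [exact Har|apply Rmin_r]. }
    replace (f a) with ((f a - f 0) + f 0)%C by ring.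
    eapply Rle_trans; [apply Cmod_triangle|]. lra. }
  assert (Hcirc : forall t, on_circle r t <> a).
  { intros t E. assert (h := Cmod_on_circle r t (proj1 Hr)).
    rewrite E in h. lra. }
  destruct (Hd a (Hsq a ltac:(lra))) as (l & q & Hq & Hqc & _).
  assert (Hqw : forall w, w <> a -> q w = ((f w - f a) / (w - a))%C).
  { intros w Hw. rewrite (Hq w). field. now apply Cminus_eq_contra. }
  assert (Hqloc : forall z, z <> a ->
            locally z (fun w => ((f w - f a) / (w - a))%C = q w)).
  { intros z Hz.
    generalize (Clocally_neq (fun w => w) z a (continuous_id z) Hz).
    apply filter_imp. intros w Hw. symmetry. now apply Hqw. }
  assert (Hqcont : ccont q).
  { intros z. destruct (Ceq_dec z a) as [->|Hz]; [exact Hqc|].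
    apply continuous_ext_loc with (1 := Hqloc z Hz).
    apply Ccont_mult.
    - apply Ccont_minus; [apply Hf | apply continuous_const].
    - apply Ccont_inv; [|now apply Cminus_eq_contra].
      apply Ccont_sub. }
  destruct (primitive_on_square q r' a ltac:(lra) Hqcont) as [F HF].
  { intros z Hz Hza. apply cdiff_ext_loc with (1 := Hqloc z Hza).
    apply cdiff_div; [| |now apply Cminus_eq_contra].
    - apply cdiff_minus; [now apply Hd | apply cdiff_const].
    - apply cdiff_sub. }
  assert (Hcauchy : cmean r (fun w => q w * w)%C = RtoC 0).
  { apply cmean_primitive with F; [lra|intros; apply Hqcont|].
    intros t. apply HF, Hsq. rewrite Cmod_on_circle; lra. }
  assert (Hcu : forall (u : C -> C) k, ccont u ->
            Rcont (fun t => (u (on_circle r t) * (/ on_circle r t) ^ k)%C)).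
  { intros u k Hu t.
    apply (continuous_comp (on_circle r) (fun w => u w * (/ w) ^ k)%C).
    - apply Rcont_circle.
    - apply Ccont_mult; [apply Hu|]. apply Ccont_inv_pow.
      apply on_circle_neq0; lra. }
  set (m := fun k => cmean r (fun w => q w * (/ w) ^ k)%C).
  assert (Hlin : forall (u v w : C -> C) (c e : C) k,
            ccont u -> ccont v -> ccont w ->
            cmean r (fun z => (u z + c * v z + e * w z) * (/ z) ^ k)%C
            = (cmean r (fun z => u z * (/ z) ^ k)
               + c * cmean r (fun z => v z * (/ z) ^ k)
               + e * cmean r (fun z => w z * (/ z) ^ k))%C).
  { intros u v w c e k Hu Hv Hw. unfold cmean.
    rewrite <- (CInt_lin3 c e) by (now apply Hcu).
    apply CInt_ext. intros t. ring. }
  assert (Hone : ccont (fun _ => RtoC 1)) by (intros z; apply continuous_const).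
  assert (H0 : (RtoC (2 * PI) * f a = coef 0%nat + a * m 0%nat)%C).
  { assert (E : cmean r (fun w => q w * w)%C
                = (coef 0%nat + (- f a) * cmean r (fun z => RtoC 1 * (/ z) ^ 0)
                   + a * m 0%nat)%C).
    { unfold coef, m. rewrite <- Hlin by auto.
      apply CInt_ext. intros t. set (w := on_circle r t).
      rewrite (Hq w). simpl. ring. }
    rewrite Hcauchy in E. simpl in E.
    unfold cmean at 1 in E. rewrite CInt_const in E.
    replace (2 * PI - 0)%R with (2 * PI) in E by ring.
    replace (RtoC (2 * PI) * f a)%C
      with (RtoC 0 + RtoC (2 * PI) * f a)%C by ring.
    rewrite E. ring. }
  assert (HS : forall k, m k = (coef (S k) + a * m (S k))%C).
  { intros k. unfold coef, m.
    transitivity (cmean r (fun z => (f z + - f a * RtoC 1 + a * q z)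
                                    * (/ z) ^ S k)%C).
    - apply CInt_ext. intros t.
      assert (Hw0 := on_circle_neq0 r t (proj1 Hr)).
      set (w := on_circle r t) in *. rewrite (Hq w). simpl. field; auto.
    - rewrite (Hlin f (fun _ => RtoC 1) q) by auto.
      replace (cmean r (fun z => RtoC 1 * (/ z) ^ S k)%C) with (RtoC 0).
      + ring.
      + symmetry. rewrite <- (cmean_inv_pow r k) by lra.
        apply CInt_ext. intros t. ring. }
  exists (fun k => match k with
                   | O => f a
                   | S k' => (m k' / RtoC (2 * PI))%C
                   end).
  split; [reflexivity|]. split.
  - intros [|k].
    + replace (f a) with (/ RtoC (2 * PI) * (RtoC (2 * PI) * f a))%C
        by (field; auto).
      rewrite H0. field; auto.
    + rewrite (HS k). field; auto.
  - intros k. rewrite Cmod_div, Cmod_R by auto.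
    rewrite (Rabs_pos_eq (2 * PI)) by lra.
    assert (Hrk : 0 < r ^ k) by (apply pow_lt; lra).
    assert (Hm : Cmod (m k) <= Rabs (2 * PI - 0) * (B / r ^ k)).
    { apply CInt_norm; [now apply Hcu|]. intros t Ht.
      rewrite Rmin_left, Rmax_right in Ht by lra.
      assert (Hmod := Cmod_on_circle r t (proj1 Hr)).
      rewrite Cmod_mult, Cmod_pow, Cmod_inv, Hmod
        by (apply on_circle_neq0; lra).
      rewrite pow_inv. apply Rmult_le_compat_r;
        [left; now apply Rinv_0_lt_compat|].
      rewrite Hqw by auto.
      rewrite Cmod_div by now apply Cminus_eq_contra.
      assert (Hden : r / 2 <= Cmod (on_circle r t - a)).
      { assert (h := Cmod_triangle (on_circle r t - a) a).
        replace (on_circle r t - a + a)%C with (on_circle r t) in h by ring.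
        lra. }
      assert (Hnum : Cmod (f (on_circle r t) - f a) <= 2 * M).
      { unfold Cminus. eapply Rle_trans; [apply Cmod_triangle|].
        rewrite Cmod_opp. specialize (HM t Ht).
        assert (h := Rmax_l M0 (Cmod (f 0) + 1)). fold M in h. lra. }
      apply Rle_div_l; [lra|].
      apply Rle_trans with (B * (r / 2)).
      - unfold B. replace (4 * M / r * (r / 2)) with (2 * M) by (field; lra).
        exact Hnum.
      - now apply Rmult_le_compat_l. }
    rewrite Rminus_0_r, Rabs_pos_eq in Hm by lra.
    apply Rle_div_l; [lra|]. lra.
Qed.

(** * The order of a zero *)

(** The nearest point projection of the plane onto a closed square makes a
    function defined near the square into one that is continuous everywhere. *)
Definition clamp (r t : R) : R := Rmax (- r) (Rmin r t).

Lemma clamp_bound r t : 0 < r -> Rabs (clamp r t) <= r.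
Proof.
  intros Hr. apply Rabs_le. unfold clamp. split; [apply Rmax_l|].
  apply Rmax_lub; [lra | apply Rmin_l].
Qed.

Lemma clamp_inside r t : Rabs t < r -> clamp r t = t.
Proof.
  intros H. apply Rabs_lt_between in H. unfold clamp.
  rewrite Rmin_right, Rmax_right by lra. reflexivity.
Qed.

Lemma clamp_lipschitz r s t : Rabs (clamp r s - clamp r t) <= Rabs (s - t).
Proof.
  apply Rabs_le. assert (h1 := Rle_abs (s - t)).
  assert (h2 := Rle_abs (- (s - t))). rewrite Rabs_Ropp in h2.
  unfold clamp, Rmin. destruct (Rle_dec r s), (Rle_dec r t);
    unfold Rmax; repeat destruct Rle_dec; lra.
Qed.

Definition Cclamp (r : R) (z : C) : C := (clamp r (fst z), clamp r (snd z)).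

Lemma Cclamp_continuous r z : continuous (Cclamp r) z.
Proof.
  apply Ccontinuous_Cmod. intros eps He. apply locally_Cmod.
  exists (eps / 2). split; [lra|]. intros w Hw.
  eapply Rle_lt_trans; [apply Cmod_le_sum|].
  assert (h1 := clamp_lipschitz r (fst w) (fst z)).
  assert (h2 := clamp_lipschitz r (snd w) (snd z)).
  assert (h3 := fst_le_Cmod (w - z)%C). assert (h4 := im_le_Cmod (w - z)%C).
  simpl in h3, h4 |- *. unfold Rminus in *. lra.
Qed.

(** The first nonzero Taylor coefficient gives the order.  If all of them
    vanish, [f a] equals every remainder term, and these decay like
    [(rho / r) ^ k]. *)
Lemma order_at_0 (f : C -> C) (r' r : R) :
  0 < r < r' -> ccont f -> (forall z, in_square r' z -> cdiff f z) ->
  locally (RtoC 0) (fun z => f z = RtoC 0) \/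
  exists (n : nat) (g : C -> C),
    (forall z, f z = (z ^ n * g z)%C) /\ g (RtoC 0) <> RtoC 0 /\
    cdiff g (RtoC 0) /\
    (forall z, cdiff f z -> z <> RtoC 0 -> cdiff g z).
Proof.
  intros Hr Hf Hd.
  destruct (taylor_at_0 f r' r Hr Hf Hd) as (c & B & HB & rho & Hrho & H).
  assert (Hfirst : (forall k, c k = RtoC 0) \/
            exists n, c n <> RtoC 0 /\ forall k, (k < n)%nat -> c k = RtoC 0).
  { destruct (classic (exists n, c n <> RtoC 0)) as [[n Hn]|Hn].
    - right. revert Hn.
      induction n as [n IH] using (well_founded_induction lt_wf). intros Hn.
      destruct (classic (exists k, (k < n)%nat /\ c k <> RtoC 0))
        as [(k & Hk & Hck)|Hk].
      + now apply (IH k).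
      + exists n. split; auto. intros k Hkn. apply NNPP. intros Hck.
        apply Hk. now exists k.
    - left. intros k. apply NNPP. intros Hk. apply Hn. now exists k. }
  assert (Hpow : forall a b n, (forall k, b k = (c k + a * b (S k))%C) ->
            (forall k, (k < n)%nat -> c k = RtoC 0) ->
            b 0%nat = (a ^ n * b n)%C).
  { intros a b n Hb Hc. induction n as [|n IH].
    - simpl. ring.
    - rewrite IH by (intros; apply Hc; lia).
      rewrite (Hb n), (Hc n) by lia. simpl. ring. }
  destruct Hfirst as [Hc|(n & Hn & Hc)].
  - left. apply locally_Cmod. exists rho. split; [lra|].
    intros a Ha. replace (a - RtoC 0)%C with a in Ha by ring.
    destruct (H a ltac:(lra)) as (b & Hb0 & Hb & Hbound).
    apply Cmod_eq_0. apply Rle_antisym; [|apply Cmod_ge_0].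
    apply le_epsilon. intros eps He. rewrite Rplus_0_l.
    destruct (small_pow2 (rho * B) eps He) as [k Hk].
    left. apply Rle_lt_trans with (2 := Hk).
    rewrite <- Hb0, (Hpow a b (S k)) by auto.
    rewrite Cmod_mult, Cmod_pow.
    assert (Hrk : 0 < r ^ k) by (apply pow_lt; lra).
    assert (H2k : 0 < 2 ^ k) by (apply pow_lt; lra).
    apply Rle_trans with ((rho * (r / 2) ^ k) * (B / r ^ k)).
    + apply Rmult_le_compat; auto using Cmod_ge_0.
      * apply pow_le, Cmod_ge_0.
      * simpl. assert (h := Cmod_ge_0 a).
        apply Rmult_le_compat; auto; try lra; [now apply pow_le|].
        apply pow_incr. lra.
    + right. unfold Rdiv at 1. rewrite Rpow_mult_distr, pow_inv. field.
      split; lra.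
  - right. exists n.
    set (g := fun a => if Ceq_dec a (RtoC 0) then c n else (f a / a ^ n)%C).
    assert (Hg0 : g (RtoC 0) = c n)
      by (unfold g; destruct Ceq_dec as [_|E]; [reflexivity|now elim E]).
    assert (Hga : forall a, a <> RtoC 0 -> g a = (f a / a ^ n)%C)
      by (intros a Ha; unfold g; destruct Ceq_dec; [contradiction|reflexivity]).
    exists g. split; [|split; [|split]].
    + intros a. destruct (Ceq_dec a (RtoC 0)) as [->|Ha].
      * rewrite Hg0. destruct (H (RtoC 0)) as (b & Hb0 & Hb & _).
        { rewrite Cmod_0; lra. }
        rewrite <- Hb0, (Hpow (RtoC 0) b n), (Hb n) by auto.
        f_equal. ring.
      * rewrite Hga by auto. field. now apply Cpow_nz.
    + now rewrite Hg0.
    + exists (c (S n)). apply cderiv_eps. intros eps He.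
      set (K := B / r ^ S n).
      assert (HK : 0 <= K)
        by (apply Rdiv_le_0_compat; [lra | apply pow_lt; lra]).
      apply locally_Cmod. exists (Rmin rho (eps / (K + 1))).
      assert (HeK : 0 < eps / (K + 1)) by (apply Rdiv_lt_0_compat; lra).
      split; [apply Rmin_pos; lra|].
      intros a Ha. rewrite Hg0.
      replace (a - RtoC 0)%C with a in * by ring.
      destruct (Ceq_dec a (RtoC 0)) as [->|Ha0].
      { rewrite Hg0.
        replace (c n - c n - RtoC 0 * c (S n))%C with (RtoC 0) by ring.
        rewrite Cmod_0. lra. }
      assert (Ha1 : Cmod a < rho)
        by (eapply Rlt_le_trans; [exact Ha | apply Rmin_l]).
      assert (Ha2 : Cmod a < eps / (K + 1))
        by (eapply Rlt_le_trans; [exact Ha | apply Rmin_r]).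
      destruct (H a ltac:(lra)) as (b & Hb0 & Hb & Hbound).
      replace (g a - c n - a * c (S n))%C with (a * (a * b (S (S n))))%C.
      2:{ rewrite Hga by auto.
          rewrite <- Hb0, (Hpow a b n), (Hb n), (Hb (S n)) by auto.
          field. now apply Cpow_nz. }
      rewrite Cmod_mult, Rmult_comm.
      apply Rmult_le_compat_r; [apply Cmod_ge_0|].
      rewrite Cmod_mult. specialize (Hbound (S n)). fold K in Hbound.
      apply Rle_trans with (eps / (K + 1) * (K + 1)).
      * apply Rmult_le_compat; auto using Cmod_ge_0; lra.
      * right. field. lra.
    + intros z Hz Hz0.
      apply cdiff_ext_loc with (fun w => (f w / w ^ n)%C).
      * generalize (Clocally_neq (fun w => w) z _ (continuous_id z) Hz0).
        apply filter_imp. intros w Hw. symmetry. now apply Hga.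
      * apply cdiff_div; auto; [|now apply Cpow_nz].
        apply cdiff_pow, cdiff_id.
Qed.

Definition factors_at (f : C -> C) (z : C) (n : nat) (g : C -> C) : Prop :=
  locally z (fun w => f w = ((w - z) ^ n * g w)%C) /\ g z <> RtoC 0.

(** The function is replaced by one that is continuous on the whole plane and
    equal to it near the point, so that the Taylor expansion applies. *)
Lemma order_dichotomy (f : C -> C) (z : C) :
  locally z (cdiff f) ->
  locally z (fun w => f w = RtoC 0) \/
  exists n g, factors_at f z n g /\ locally z (cdiff g).
Proof.
  intros Hd. apply locally_Cmod in Hd. destruct Hd as (d & Hdp & Hd).
  set (r := d / 4). assert (Hr : 0 < r) by (unfold r; lra).
  set (f1 := fun w => f (Cclamp r w + z)%C).
  assert (Hclose : forall w, Cmod (Cclamp r w) < d).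
  { intros w. eapply Rle_lt_trans; [apply Cmod_le_sum|].
    assert (h1 := clamp_bound r (fst w) Hr).
    assert (h2 := clamp_bound r (snd w) Hr). unfold r in *. lra. }
  assert (Hf1 : ccont f1).
  { intros w. apply (continuous_comp (fun w => Cclamp r w + z)%C f).
    - apply Ccont_plus; [apply Cclamp_continuous | apply continuous_const].
    - apply cdiff_continuous, Hd.
      replace (Cclamp r w + z - z)%C with (Cclamp r w) by ring. apply Hclose. }
  assert (Hin : forall w, in_square r w -> f1 w = f (w + z)%C).
  { intros [u v] [Hu Hv]. unfold f1, Cclamp; simpl in *.
    now rewrite !clamp_inside. }
  assert (Hopen : forall w, in_square r w -> locally w (in_square r)).
  { intros [u v] [Hu Hv]. simpl in Hu, Hv.
    apply locally_Cmod. exists (Rmin (r - Rabs u) (r - Rabs v)).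
    split; [apply Rmin_pos; lra|]. intros [u' v'] Hw.
    assert (h1 := fst_le_Cmod ((u', v') - (u, v))%C).
    assert (h2 := im_le_Cmod ((u', v') - (u, v))%C).
    assert (h3 := Rmin_l (r - Rabs u) (r - Rabs v)).
    assert (h4 := Rmin_r (r - Rabs u) (r - Rabs v)).
    simpl in h1, h2. split; simpl.
    - replace u' with ((u' + - u) + u) by ring.
      eapply Rle_lt_trans; [apply Rabs_triang|]. lra.
    - replace v' with ((v' + - v) + v) by ring.
      eapply Rle_lt_trans; [apply Rabs_triang|]. lra. }
  assert (Hd1 : forall w, in_square r w -> cdiff f1 w).
  { intros w Hw. apply cdiff_ext_loc with (fun w => f (w + z)%C).
    - generalize (Hopen w Hw). apply filter_imp. intros v Hv.
      symmetry. now apply Hin.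
    - apply cdiff_comp_translate, Hd.
      replace (w + z - z)%C with w by ring.
      eapply Rle_lt_trans; [apply (Cmod_le_sum (fst w) (snd w))|] ||
      (destruct w; eapply Rle_lt_trans; [apply Cmod_le_sum|]).
      destruct Hw as [h1 h2]. unfold r in h1, h2. simpl in *. lra. }
  assert (H0sq : in_square r (RtoC 0))
    by (split; simpl; rewrite Rabs_R0; lra).
  assert (Htr : forall P : C -> Prop, locally (RtoC 0) P ->
            locally z (fun w => P (w - z)%C)).
  { intros P HP. apply locally_Cmod in HP. apply locally_Cmod.
    destruct HP as (e & He & HP). exists e. split; auto.
    intros w Hw. apply HP.
    now replace (w - z - RtoC 0)%C with (w - z)%C by ring. }
  assert (Hnear : locally z (fun w => f1 (w - z)%C = f w)).
  { generalize (Htr _ (Hopen _ H0sq)). apply filter_imp. intros w Hw.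
    rewrite Hin by auto. f_equal. ring. }
  destruct (order_at_0 f1 r (r / 2) ltac:(lra) Hf1 Hd1)
    as [H|(n & g & Hfg & Hg0 & Hgd0 & Hgd)].
  - left. generalize (filter_and _ _ (Htr _ H) Hnear). apply filter_imp.
    intros w [E1 E2]. now rewrite <- E2.
  - right. exists n, (fun w => g (w - z)%C). split; [split|].
    + revert Hnear. apply filter_imp. intros w E. now rewrite <- E, Hfg.
    + now replace (z - z)%C with (RtoC 0) by ring.
    + generalize (Htr _ (Hopen _ H0sq)). apply filter_imp. intros w Hw.
      apply (cdiff_comp_translate g (- z)%C).
      change (w + - z)%C with (w - z)%C.
      destruct (Ceq_dec (w - z) (RtoC 0)) as [->|E]; auto.
Qed.

(** Cofactors are only asked to be continuous, so that those that come from
    the multiplicities of a slice function can be compared with the holomorphic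
    one. *)
Lemma order_unique (f : C -> C) (z : C) n g m c :
  factors_at f z n g -> continuous g z ->
  factors_at f z m c -> continuous c z -> n = m.
Proof.
  assert (Hlt : forall n g m c, factors_at f z n g -> continuous g z ->
            factors_at f z m c -> continuous c z -> ~ (n < m)%nat).
  { clear. intros n g m c [Hg Hg0] Hgc [Hc Hc0] Hcc Hlt.
    apply Hg0.
    transitivity ((z - z) ^ (m - n) * c z)%C.
    - apply (continuous_agree g (fun w => (w - z) ^ (m - n) * c w)%C); auto.
      + apply Ccont_mult; auto. apply Ccont_pow, Ccont_sub.
      + generalize (filter_and _ _ Hg Hc). apply filter_imp.
        intros w [H2 H3] Hw.
        assert (Hw0 : (w - z)%C <> RtoC 0) by now apply Cminus_eq_contra.
        assert (Hp := Cpow_nz _ n Hw0).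
        rewrite H2 in H3.
        replace (g w) with (/ (w - z) ^ n * ((w - z) ^ n * g w))%C
          by (field; auto).
        rewrite H3. replace m with (n + (m - n))%nat at 1 by lia.
        rewrite Cpow_add_r. field; auto.
    - replace (z - z)%C with (RtoC 0) by ring.
      destruct (m - n)%nat as [|k] eqn:E; [lia|]. simpl. ring. }
  intros H1 H2 H3 H4.
  assert (h1 := Hlt n g m c H1 H2 H3 H4).
  assert (h2 := Hlt m c n g H3 H4 H1 H2).
  lia.
Qed.

Lemma isolated_zero (f : C -> C) (z : C) n g :
  factors_at f z n g -> continuous g z ->
  locally z (fun w => w <> z -> f w <> RtoC 0).
Proof.
  intros [Hf Hg] Hc.
  generalize (filter_and _ _ Hf (Clocally_neq g z _ Hc Hg)).
  apply filter_imp. intros w [-> Hw] Hwz.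
  apply Cmult_neq_0; auto. now apply Cpow_nz, Cminus_eq_contra.
Qed.

(** * Induction on intervals *)

(** Compactness and connectedness of an interval in one principle, for gluing
    local data along paths.  The supremum of the points that are reached from
    [A] is reached, and it can only be [B]. *)
Lemma interval_induction (A B : R) (P : R -> R -> Prop) :
  A <= B ->
  (forall a b c, A <= a <= b -> b <= c <= B -> P a b -> P b c -> P a c) ->
  (forall t, A <= t <= B -> exists d, 0 < d /\
     forall a b, A <= a <= b -> b <= B -> t - d < a -> b < t + d -> P a b) ->
  P A B.
Proof.
  intros HAB Hglue Hloc.
  set (E := fun t => A <= t <= B /\ P A t).
  assert (EA : E A).
  { split; [lra|]. destruct (Hloc A) as (d & Hd & H); [lra|]. apply H; lra. }
  destruct (completeness E) as [s [Hub Hlub]].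
  - exists B. intros t [Ht _]. lra.
  - now exists A.
  - assert (Hs : A <= s <= B).
    { split; [now apply Hub | apply Hlub; intros t [Ht _]; lra]. }
    destruct (Hloc s Hs) as (d & Hd & H).
    assert (Hex : exists t, E t /\ s - d < t).
    { apply NNPP. intros Hn.
      assert (s <= s - d).
      { apply Hlub. intros t Ht. apply Rnot_lt_le. intros Hlt.
        apply Hn. now exists t. }
      lra. }
    destruct Hex as (t & [Ht HPt] & Hst).
    assert (Hts : t <= s) by (now apply Hub).
    set (b := Rmin B (s + d / 2)).
    assert (Hb1 : b <= B) by apply Rmin_l.
    assert (Hb2 : b <= s + d / 2) by apply Rmin_r.
    assert (Hb3 : s <= b) by (apply Rmin_glb; lra).
    assert (HEb : E b).
    { split; [lra|]. apply (Hglue A t b); try lra; auto. apply H; lra. }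
    assert (Hbs : b <= s) by now apply Hub.
    replace B with b; [apply HEb|].
    unfold b, Rmin in *. destruct (Rle_dec B (s + d / 2)); [reflexivity|lra].
Qed.

Lemma locally_constant_interval {X : Type} (A B : R) (e : R -> X) :
  A <= B ->
  (forall t, A <= t <= B -> exists d, 0 < d /\
     forall s, A <= s <= B -> Rabs (s - t) < d -> e s = e t) ->
  e A = e B.
Proof.
  intros HAB H. apply (interval_induction A B (fun a b => e a = e b) HAB).
  - intros a b c _ _ -> ->. reflexivity.
  - intros t Ht. destruct (H t Ht) as (d & Hd & Hc). exists d. split; auto.
    intros a b Ha Hb H1 H2. rewrite (Hc a), (Hc b); auto; try lra;
      apply Rabs_def1; lra.
Qed.

Ltac min_bounds a b :=
  assert (Rmin a b <= a) by apply Rmin_l;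
  assert (Rmin a b <= b) by apply Rmin_r.

Section Paths.
Context {T : UniformSpace}.

Lemma path_near (g : R -> T) (t : R) (V : T -> Prop) :
  continuous_on unit_interval g -> unit_interval t -> locally (g t) V ->
  exists d, 0 < d /\
    forall s, unit_interval s -> Rabs (s - t) < d -> V (g s).
Proof.
  intros Hg Ht HV. destruct (Hg t Ht V HV) as [d Hd].
  exists d. split; [apply cond_pos|]. intros s Hs Hst. now apply Hd.
Qed.

Lemma path_from_near (g : R -> T) :
  (forall t V, unit_interval t -> locally (g t) V ->
     exists d, 0 < d /\
       forall s, unit_interval s -> Rabs (s - t) < d -> V (g s)) ->
  continuous_on unit_interval g.
Proof.
  intros H t Ht V HV. destruct (H t V Ht HV) as (d & Hd & Hs).
  exists (mkposreal d Hd). intros s Hst Hsu. now apply Hs.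
Qed.

Lemma square_near (g : R * R -> T) (p : R * R) (V : T -> Prop) :
  let square st := unit_interval (fst st) /\ unit_interval (snd st) in
  continuous_on square g -> square p -> locally (g p) V ->
  exists d, 0 < d /\
    forall q, square q -> Rabs (fst q - fst p) < d ->
      Rabs (snd q - snd p) < d -> V (g q).
Proof.
  intros square Hg Hp HV. destruct (Hg p Hp V HV) as [d Hd].
  exists d. split; [apply cond_pos|]. intros q Hq H1 H2.
  apply Hd; [split; assumption | exact Hq].
Qed.

(** The preimages of two disjoint relatively open sets are constant along the
    path by interval induction. *)
Lemma path_separation (g : R -> T) (U V : T -> Prop) :
  continuous_on unit_interval g -> open U -> open V ->
  (forall t, unit_interval t -> U (g t) \/ V (g t)) ->
  (forall t, unit_interval t -> ~ (U (g t) /\ V (g t))) ->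
  forall a b, unit_interval a -> unit_interval b -> U (g a) -> U (g b).
Proof.
  intros Hg HU HV Hcov Hdis.
  assert (Hloc : forall t, unit_interval t -> exists d, 0 < d /\
            forall s, unit_interval s -> Rabs (s - t) < d ->
              (U (g s) <-> U (g t))).
  { intros t Ht. destruct (Hcov t Ht) as [h|h].
    - destruct (path_near g t U Hg Ht (HU _ h)) as (d & Hd & Hs).
      exists d. split; auto. intros s Hsu Hst. split; auto.
    - destruct (path_near g t V Hg Ht (HV _ h)) as (d & Hd & Hs).
      exists d. split; auto. intros s Hsu Hst.
      split; intros h'; exfalso; [apply (Hdis s Hsu) | apply (Hdis t Ht)];
        auto. }
  assert (Hmono : forall a b, unit_interval a -> unit_interval b -> a <= b ->
            (U (g a) <-> U (g b))).
  { intros a b Ha Hb Hab.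
    apply (interval_induction a b (fun s t => U (g s) <-> U (g t)) Hab).
    - intros; tauto.
    - intros t Ht. destruct (Hloc t) as (d & Hd & Hs);
        [unfold unit_interval in *; lra|].
      exists d. split; auto. intros s s' H1 H2 H3 H4.
      unfold unit_interval in *.
      assert (E1 : U (g s) <-> U (g t))
        by (apply Hs; [lra | apply Rabs_def1; lra]).
      assert (E2 : U (g s') <-> U (g t))
        by (apply Hs; [lra | apply Rabs_def1; lra]).
      tauto. }
  intros a b Ha Hb Ua.
  destruct (Rle_dec a b); [now apply (Hmono a b)|].
  apply (Hmono b a); auto; lra.
Qed.

Lemma path_image_connected (g : R -> T) :
  continuous_on unit_interval g ->
  connected (fun x => exists t, unit_interval t /\ x = g t).
Proof.
  intros Hg U V HU HV Hcov (x & (a & Ha & ->) & Ua) (y & (b & Hb & ->) & Vb).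
  apply NNPP. intros Hn.
  assert (Hdis : forall t, unit_interval t -> ~ (U (g t) /\ V (g t))).
  { intros t Ht HUV. apply Hn. exists (g t). split; auto. now exists t. }
  apply (Hdis b Hb). split; auto.
  apply (path_separation g U V Hg HU HV) with a; auto.
  intros t Ht. apply Hcov. now exists t.
Qed.

Lemma path_component (A : T -> Prop) (g : R -> T) (t : R) :
  path_in A g -> unit_interval t -> component A (g 0) (g t).
Proof.
  intros [Hg HA] Ht. exists (fun x => exists t, unit_interval t /\ x = g t).
  split; [now apply path_image_connected|]. split; [|split].
  - intros z (s & Hs & ->). auto.
  - exists 0. split; auto. unfold unit_interval; lra.
  - now exists t.
Qed.

End Paths.

(** * Monodromy of a two-sheeted covering *)

(** A two-sheeted covering of [D], given by sign changes [tau z w] between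
    the sheets over [z] and those over a point [w] of a neighbourhood [N z].
    Paths lift to the covering.  When every loop in [D] is null homotopic, a
    lifted loop closes up, so the sheet reached at [z] from a base point of its
    path component depends on [z] only; this is the section. *)
Section Monodromy.
Variables (D : C -> Prop) (N : C -> C -> Prop) (tau : C -> C -> bool).
Hypothesis N_nbhd : forall z, D z -> locally z (N z).
Hypothesis N_sub : forall z w, D z -> N z w -> D w.
Hypothesis N_path : forall z w, D z -> N z w ->
  exists g : R -> C, continuous_on unit_interval g /\ g 0 = z /\ g 1 = w /\
            forall t, unit_interval t -> N z (g t).
Hypothesis tau_cocycle : forall z w w', D z -> N z w -> N z w' -> N w w' ->
  tau z w' = xorb (tau z w) (tau w w').
Hypothesis loops : forall g : R -> C,
  path_in D g -> g 0 = g 1 -> null_homotopic D g.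

Lemma N_refl z : D z -> N z z.
Proof. intros Hz. exact (locally_singleton z (N z) (N_nbhd z Hz)). Qed.

Lemma tau_refl z : D z -> tau z z = false.
Proof.
  intros Hz. assert (h := N_refl z Hz).
  assert (E := tau_cocycle z z z Hz h h h).
  now destruct (tau z z).
Qed.

Definition box (a b c d : R) (p : R * R) : Prop :=
  a <= fst p <= b /\ c <= snd p <= d.

(** [e] selects a sheet continuously over the points of [K]. *)
Definition lift2 (K : R * R -> Prop) (Phi : R * R -> C) (e : R * R -> bool) :=
  forall p, K p -> exists d, 0 < d /\ forall q, K q ->
    Rabs (fst q - fst p) < d -> Rabs (snd q - snd p) < d ->
    e q = xorb (e p) (tau (Phi p) (Phi q)).

Lemma lift2_glue_x (Phi : R * R -> C) (x0 x1 x2 y0 y1 : R) :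
  x0 <= x1 <= x2 -> y0 <= y1 ->
  (exists e, lift2 (box x0 x1 y0 y1) Phi e) ->
  (exists e, lift2 (box x1 x2 y0 y1) Phi e) ->
  exists e, lift2 (box x0 x2 y0 y1) Phi e.
Proof.
  intros Hx Hy [e1 H1] [e2 H2].
  (* The two lifts differ by a constant sign [k] on the common edge. *)
  set (k := xorb (e1 (x1, y0)) (e2 (x1, y0))).
  assert (Hk : forall y, y0 <= y <= y1 -> e1 (x1, y) = xorb (e2 (x1, y)) k).
  { intros y Hyy.
    assert (E : xorb (e1 (x1, y0)) (e2 (x1, y0))
                = xorb (e1 (x1, y)) (e2 (x1, y))).
    { apply (locally_constant_interval y0 y
               (fun y => xorb (e1 (x1, y)) (e2 (x1, y)))); [lra|].
      intros t Ht.
      destruct (H1 (x1, t)) as (d1 & Hd1 & Hq1); [split; simpl; lra|].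
      destruct (H2 (x1, t)) as (d2 & Hd2 & Hq2); [split; simpl; lra|].
      exists (Rmin d1 d2). split; [now apply Rmin_pos|]. intros s Hs Hst.
      min_bounds d1 d2.
      rewrite (Hq1 (x1, s)), (Hq2 (x1, s)); try (split; simpl; lra);
        simpl; try (rewrite Rminus_diag, Rabs_R0); try lra.
      destruct (e1 (x1, t)), (e2 (x1, t)), (tau (Phi (x1, t)) (Phi (x1, s)));
        reflexivity. }
    unfold k. rewrite E. destruct (e1 (x1, y)), (e2 (x1, y)); reflexivity. }
  exists (fun p => if Rle_dec (fst p) x1 then e1 p else xorb (e2 p) k).
  intros [x y] [Hpx Hpy]. simpl in Hpx, Hpy.
  destruct (Rtotal_order x x1) as [Hlt|[->|Hgt]].
  - destruct (H1 (x, y)) as (d & Hd & Hq); [split; simpl; lra|].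
    exists (Rmin d (x1 - x)). split; [apply Rmin_pos; lra|].
    intros [u v] [Hu Hv] Hux Hvy. simpl in *.
    min_bounds d (x1 - x).
    assert (Hux' := Hux). apply Rabs_def2 in Hux'.
    destruct (Rle_dec x x1) as [_|]; [|lra].
    destruct (Rle_dec u x1) as [_|]; [|lra].
    apply Hq; [split; simpl; lra| |]; simpl; lra.
  - destruct (H1 (x1, y)) as (d1 & Hd1 & Hq1); [split; simpl; lra|].
    destruct (H2 (x1, y)) as (d2 & Hd2 & Hq2); [split; simpl; lra|].
    exists (Rmin d1 d2). split; [apply Rmin_pos; lra|].
    intros [u v] [Hu Hv] Hux Hvy. simpl in *.
    min_bounds d1 d2.
    destruct (Rle_dec x1 x1) as [_|]; [|lra].
    destruct (Rle_dec u x1) as [Hu1|Hu1].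
    + apply Hq1; [split; simpl; lra| |]; simpl; lra.
    + rewrite Hk by lra. rewrite (Hq2 (u, v));
        [|split; simpl; lra|simpl; lra|simpl; lra].
      destruct (e2 (x1, y)), k, (tau (Phi (x1, y)) (Phi (u, v))); reflexivity.
  - destruct (H2 (x, y)) as (d & Hd & Hq); [split; simpl; lra|].
    exists (Rmin d (x - x1)). split; [apply Rmin_pos; lra|].
    intros [u v] [Hu Hv] Hux Hvy. simpl in *.
    min_bounds d (x - x1).
    assert (Hux' := Hux). apply Rabs_def2 in Hux'.
    destruct (Rle_dec x x1) as [|_]; [lra|].
    destruct (Rle_dec u x1) as [|_]; [lra|].
    rewrite (Hq (u, v)); [|split; simpl; lra|simpl; lra|simpl; lra].
    destruct (e2 (x, y)), k, (tau (Phi (x, y)) (Phi (u, v))); reflexivity.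
Qed.

Lemma lift2_swap (Phi : R * R -> C) (x0 x1 y0 y1 : R) :
  (exists e, lift2 (box x0 x1 y0 y1) Phi e) ->
  exists e, lift2 (box y0 y1 x0 x1) (fun p => Phi (snd p, fst p)) e.
Proof.
  intros [e He]. exists (fun p => e (snd p, fst p)).
  intros [x y] [Hx Hy]. simpl in Hx, Hy.
  destruct (He (y, x)) as (d & Hd & Hq); [split; assumption|].
  exists d. split; auto. intros [u v] [Hu Hv] H1 H2.
  apply Hq; [split|..]; assumption.
Qed.

(** Interval induction in each of the two coordinates; near one point the
    lift is given by the sign changes from that point. *)
Lemma lift2_exists (Phi : R * R -> C) :
  let square st := unit_interval (fst st) /\ unit_interval (snd st) in
  continuous_on square Phi -> (forall p, square p -> D (Phi p)) ->
  exists e, lift2 (box 0 1 0 1) Phi e.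
Proof.
  intros square Hc HD.
  assert (Hsq : forall x0 x1 y0 y1, 0 <= x0 -> x1 <= 1 -> 0 <= y0 -> y1 <= 1 ->
            forall p, box x0 x1 y0 y1 p -> square p).
  { intros x0 x1 y0 y1 h1 h2 h3 h4 p [Hp1 Hp2].
    split; unfold unit_interval; lra. }
  apply (interval_induction 0 1
           (fun x0 x1 => exists e, lift2 (box x0 x1 0 1) Phi e)); [lra| |].
  { intros a b c Hab Hbc. apply lift2_glue_x; lra. }
  intros x Hx.
  apply (interval_induction 0 1
    (fun y0 y1 => exists d, 0 < d /\
       forall a b, 0 <= a <= b -> b <= 1 -> x - d < a -> b < x + d ->
         exists e, lift2 (box a b y0 y1) Phi e)); [lra| |].
  { intros y0 y1 y2 H01 H12 (d1 & Hd1 & H1) (d2 & Hd2 & H2).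
    exists (Rmin d1 d2). split; [now apply Rmin_pos|].
    min_bounds d1 d2.
    intros a b Hab Hb Ha' Hb'.
    destruct (H1 a b) as [e1 He1]; try lra.
    destruct (H2 a b) as [e2 He2]; try lra.
    destruct (lift2_swap (fun p => Phi (snd p, fst p)) y0 y2 a b) as [e He].
    - apply lift2_glue_x with y1; [lra|lra| |].
      + apply (lift2_swap Phi). now exists e1.
      + apply (lift2_swap Phi). now exists e2.
    - exists e. intros [u v] Huv. destruct (He (u, v) Huv) as (d & Hd & Hq).
      exists d. split; auto. intros [u' v']. apply Hq. }
  intros y Hy.
  assert (Hp : square (x, y)) by (split; simpl; unfold unit_interval; lra).
  destruct (square_near Phi (x, y) (N (Phi (x, y))) Hc Hp
              (N_nbhd _ (HD _ Hp))) as (d & Hd & Hnear).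
  exists d. split; auto. intros y0 y1 Hy01 Hy1 Hd0 Hd1.
  exists d. split; auto. intros a b Hab Hb Ha' Hb'.
  exists (fun p => tau (Phi (x, y)) (Phi p)).
  assert (HN : forall p, box a b y0 y1 p -> N (Phi (x, y)) (Phi p)).
  { intros [u v] Huv. apply Hnear.
    - revert Huv. apply Hsq; lra.
    - destruct Huv as [Hu _]; simpl in Hu |- *. apply Rabs_def1; lra.
    - destruct Huv as [_ Hv]; simpl in Hv |- *. apply Rabs_def1; lra. }
  intros p Hpb.
  assert (Hps : square p) by (revert Hpb; apply Hsq; lra).
  destruct (square_near Phi p (N (Phi p)) Hc Hps (N_nbhd _ (HD _ Hps)))
    as (d' & Hd' & Hnear').
  exists d'. split; auto. intros q Hq H1 H2.
  apply tau_cocycle; auto. apply Hnear'; auto. revert Hq; apply Hsq; lra.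
Qed.

(** A path in the covering space: a path together with a continuous choice of
    sheet. *)
Definition lifted (g : R -> C * bool) : Prop :=
  forall t, unit_interval t ->
    D (fst (g t)) /\
    forall V, locally (fst (g t)) V ->
    exists d, 0 < d /\ forall s, unit_interval s -> Rabs (s - t) < d ->
      V (fst (g s)) /\
      snd (g s) = xorb (snd (g t)) (tau (fst (g t)) (fst (g s))).

Lemma unit0 : unit_interval 0. Proof. unfold unit_interval; lra. Qed.
Lemma unit1 : unit_interval 1. Proof. unfold unit_interval; lra. Qed.
#[local] Hint Resolve unit0 unit1 : core.

Lemma lifted_path_in g : lifted g -> path_in D (fun t => fst (g t)).
Proof.
  intros H. split.
  - apply path_from_near. intros t V Ht HV.
    destruct (proj2 (H t Ht) V HV) as (d & Hd & Hs).
    exists d. split; auto. intros s Hsu Hst. now apply Hs.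
  - intros t Ht. now apply H.
Qed.

Lemma lift_exists (g : R -> C) :
  path_in D g -> exists e, lifted (fun t => (g t, e t)).
Proof.
  intros [Hg HD].
  destruct (lift2_exists (fun p => g (snd p))) as [e He].
  - intros p [_ Hp] V HV.
    destruct (path_near g (snd p) V Hg Hp HV) as (d & Hd & Hs).
    exists (mkposreal d Hd). intros q [_ Hq2] [_ Hq]. now apply Hs.
  - intros p [_ Hp]. now apply HD.
  - exists (fun t => e (0, t)). intros t Ht. split; [now apply HD|].
    intros V HV. simpl in HV.
    destruct (path_near g t V Hg Ht HV) as (d1 & Hd1 & Hs1).
    destruct (He (0, t)) as (d2 & Hd2 & Hs2);
      [split; simpl; unfold unit_interval in *; lra|].
    exists (Rmin d1 d2). split; [now apply Rmin_pos|].
    min_bounds d1 d2.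
    intros s Hs Hst. simpl. split; [apply Hs1; auto; lra|].
    apply (Hs2 (0, s)).
    + split; simpl; unfold unit_interval in *; lra.
    + simpl. rewrite Rminus_diag, Rabs_R0. lra.
    + simpl. lra.
Qed.

Lemma lift_unique (g h : R -> C * bool) :
  lifted g -> lifted h ->
  (forall t, unit_interval t -> fst (g t) = fst (h t)) ->
  xorb (snd (g 0)) (snd (g 1)) = xorb (snd (h 0)) (snd (h 1)).
Proof.
  intros Hg Hh E.
  assert (K : xorb (snd (g 0)) (snd (h 0)) = xorb (snd (g 1)) (snd (h 1))).
  { apply (locally_constant_interval 0 1
             (fun t => xorb (snd (g t)) (snd (h t)))); [lra|].
    intros t Ht.
    destruct (proj2 (Hg t Ht) (fun _ => True) (filter_forall _ (fun _ => I)))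
      as (d1 & Hd1 & H1).
    destruct (proj2 (Hh t Ht) (fun _ => True) (filter_forall _ (fun _ => I)))
      as (d2 & Hd2 & H2).
    exists (Rmin d1 d2). split; [now apply Rmin_pos|].
    min_bounds d1 d2.
    intros s Hs Hst.
    rewrite (proj2 (H1 s Hs ltac:(lra))), (proj2 (H2 s Hs ltac:(lra))).
    rewrite !E by auto.
    destruct (snd (g t)), (snd (h t)), (tau (fst (h t)) (fst (h s)));
      reflexivity. }
  destruct (snd (g 0)), (snd (g 1)), (snd (h 0)), (snd (h 1)); auto.
Qed.

Lemma lifted_shift (g : R -> C * bool) (k : bool) :
  lifted g -> lifted (fun t => (fst (g t), xorb (snd (g t)) k)).
Proof.
  intros Hg t Ht. destruct (Hg t Ht) as [HD Hl]. split; auto.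
  intros V HV. destruct (Hl V HV) as (d & Hd & Hs). exists d. split; auto.
  intros s Hsu Hst. destruct (Hs s Hsu Hst) as [HVs E]. split; auto.
  simpl. rewrite E.
  destruct (snd (g t)), k, (tau (fst (g t)) (fst (g s))); reflexivity.
Qed.

Lemma lifted_reverse (g : R -> C * bool) :
  lifted g -> lifted (fun t => g (1 - t)).
Proof.
  intros Hg t Ht.
  assert (Hu : forall t, unit_interval t -> unit_interval (1 - t))
    by (unfold unit_interval; intros; lra).
  destruct (Hg (1 - t) (Hu t Ht)) as [HD Hl]. split; auto.
  intros V HV. destruct (Hl V HV) as (d & Hd & Hs). exists d. split; auto.
  intros s Hsu Hst. apply Hs; auto.
  replace (1 - s - (1 - t)) with (- (s - t)) by ring. now rewrite Rabs_Ropp.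
Qed.

Definition concat {X : Type} (g h : R -> X) (t : R) : X :=
  if Rle_dec t (1 / 2) then g (2 * t) else h (2 * t - 1).

Lemma concat_0 {X : Type} (g h : R -> X) : concat g h 0 = g 0.
Proof.
  unfold concat. destruct (Rle_dec 0 (1 / 2)); [f_equal; ring | lra].
Qed.

Lemma concat_1 {X : Type} (g h : R -> X) : concat g h 1 = h 1.
Proof.
  unfold concat. destruct (Rle_dec 1 (1 / 2)); [lra | f_equal; ring].
Qed.

Lemma lifted_concat (g h : R -> C * bool) :
  lifted g -> lifted h -> g 1 = h 0 -> lifted (concat g h).
Proof.
  intros Hg Hh E t Ht.
  (* Away from the middle, one of the two paths is followed at double speed. *)
  assert (Hpart : forall k c u, lifted k -> 0 < u ->
    (forall s, unit_interval s -> Rabs (s - t) < u ->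
       unit_interval (2 * s - c) /\ concat g h s = k (2 * s - c)) ->
    D (fst (concat g h t)) /\ forall V, locally (fst (concat g h t)) V ->
    exists d, 0 < d /\ forall s, unit_interval s -> Rabs (s - t) < d ->
      V (fst (concat g h s)) /\ snd (concat g h s) = xorb (snd (concat g h t))
        (tau (fst (concat g h t)) (fst (concat g h s)))).
  { intros k c u Hk Hu Hs. destruct (Hs t Ht) as [Htu ->];
      [rewrite Rminus_diag, Rabs_R0; exact Hu|].
    destruct (Hk _ Htu) as [HD Hl]. split; [exact HD|].
    intros V HV. destruct (Hl V HV) as (d & Hd & Hsd).
    exists (Rmin (d / 2) u). split; [apply Rmin_pos; lra|].
    min_bounds (d / 2) u. intros s Hsu Hst.
    destruct (Hs s Hsu ltac:(lra)) as [Hsk ->].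
    apply Hsd; [exact Hsk|]. apply Rabs_def2 in Hst. apply Rabs_def1; lra. }
  unfold unit_interval in Ht.
  destruct (Rtotal_order t (1 / 2)) as [Hlt|[->|Hgt]].
  - apply (Hpart g 0 (1 / 2 - t)); auto; [lra|]. intros s Hs Hst.
    unfold unit_interval in *. apply Rabs_def2 in Hst. split; [lra|].
    unfold concat. destruct (Rle_dec s (1 / 2)); [f_equal; ring | lra].
  - assert (Et : concat g h (1 / 2) = g 1)
      by (unfold concat; destruct (Rle_dec (1 / 2) (1 / 2));
          [f_equal; field|lra]).
    rewrite Et. destruct (Hg 1) as [HD Hlg]; auto. split; auto.
    intros V HV. destruct (Hlg V HV) as (d1 & Hd1 & Hs1).
    destruct (Hh 0) as [_ Hlh]; auto. rewrite <- E in Hlh.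
    destruct (Hlh V HV) as (d2 & Hd2 & Hs2).
    exists (Rmin (d1 / 2) (d2 / 2)). split; [apply Rmin_pos; lra|].
    min_bounds (d1 / 2) (d2 / 2).
    intros s Hsu Hst. unfold unit_interval in Hsu. apply Rabs_def2 in Hst.
    unfold concat. destruct (Rle_dec s (1 / 2)).
    + apply Hs1; [unfold unit_interval; lra | apply Rabs_def1; lra].
    + apply Hs2; [unfold unit_interval; lra | apply Rabs_def1; lra].
  - apply (Hpart h 1 (t - 1 / 2)); auto; [lra|]. intros s Hs Hst.
    unfold unit_interval in *. apply Rabs_def2 in Hst. split; [lra|].
    unfold concat. destruct (Rle_dec s (1 / 2)); [lra | reflexivity].
Qed.

(** Along a loop the sheet returns: lift the null homotopy; over the three
    sides of the square that it maps to one point, the sheet is constant. *)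
Lemma lifted_loop (g : R -> C * bool) :
  lifted g -> fst (g 0) = fst (g 1) -> snd (g 0) = snd (g 1).
Proof.
  intros Hg E.
  assert (Hp := lifted_path_in g Hg).
  destruct (loops _ Hp E) as (Phi & Hc & HD & H0 & H1 & Hs).
  destruct (lift2_exists Phi Hc HD) as [e He].
  assert (Hz : D (fst (g 0))) by (apply Hg; auto).
  assert (Hconst : forall (c : R -> R * R),
    (forall t, unit_interval t -> unit_interval (fst (c t))
       /\ unit_interval (snd (c t)) /\ Phi (c t) = fst (g 0)) ->
    (forall s t, Rabs (fst (c s) - fst (c t)) <= Rabs (s - t)
       /\ Rabs (snd (c s) - snd (c t)) <= Rabs (s - t)) ->
    e (c 0) = e (c 1)).
  { intros c Hcu Hcl.
    apply (locally_constant_interval 0 1 (fun t => e (c t))); [lra|].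
    intros t Ht. destruct (Hcu t Ht) as (Hu1 & Hu2 & Ec).
    destruct (He (c t)) as (d & Hd & Hq); [split; assumption|].
    exists d. split; auto. intros s Hsu Hst.
    destruct (Hcu s Hsu) as (Hv1 & Hv2 & Ec').
    destruct (Hcl s t) as [i1 i2].
    rewrite (Hq (c s)); [|split; assumption|lra|lra].
    rewrite Ec, Ec', tau_refl by auto. now destruct (e (c t)). }
  assert (Habs0 : forall s t, Rabs (s - s) <= Rabs t)
    by (intros; rewrite Rminus_diag, Rabs_R0; apply Rabs_pos).
  assert (E1 : e (0, 0) = e (1, 0)).
  { apply (Hconst (fun s => (s, 0))); simpl.
    - intros t Ht. split; [|split]; auto; now apply Hs.
    - intros s t. split; [lra | apply Habs0]. }
  assert (E2 : e (1, 0) = e (1, 1)).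
  { apply (Hconst (fun s => (1, s))); simpl.
    - intros t Ht. split; [|split]; auto; now apply H1.
    - intros s t. split; [apply Habs0 | lra]. }
  assert (E3 : e (0, 1) = e (1, 1)).
  { apply (Hconst (fun s => (s, 1))); simpl.
    - intros t Ht. split; [|split]; auto; now apply Hs.
    - intros s t. split; [lra | apply Habs0]. }
  assert (Hl : lifted (fun t => (fst (g t), e (0, t)))).
  { intros t Ht. destruct (Hg t Ht) as [HDt Hlt]. split; auto.
    intros V HV. destruct (Hlt V HV) as (d1 & Hd1 & Hs1).
    destruct (He (0, t)) as (d2 & Hd2 & Hs2);
      [split; simpl; unfold unit_interval in *; lra|].
    exists (Rmin d1 d2). split; [now apply Rmin_pos|].
    min_bounds d1 d2.
    intros s Hsu Hst. simpl. split; [apply Hs1; auto; lra|].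
    rewrite <- (H0 t Ht), <- (H0 s Hsu). apply (Hs2 (0, s)).
    + split; simpl; unfold unit_interval in *; lra.
    + simpl. rewrite Rminus_diag, Rabs_R0. lra.
    + simpl. lra. }
  assert (U := lift_unique _ _ Hg Hl (fun _ _ => eq_refl)). simpl in U.
  rewrite E3, <- E2, <- E1, xorb_nilpotent in U.
  now apply xorb_eq.
Qed.

(** [h] is the monodromy from [b] to [z]. *)
Definition transport (b z : C) (h : bool) : Prop :=
  exists g, lifted g /\ fst (g 0) = b /\ fst (g 1) = z /\
            xorb (snd (g 0)) (snd (g 1)) = h.

(** Two paths with the same ends form a loop; the second lift is shifted so
    that it can be followed backwards from the end of the first. *)
Lemma transport_unique b z h h' :
  transport b z h -> transport b z h' -> h = h'.
Proof.
  intros (g & Hg & Hg0 & Hg1 & Eg) (g' & Hg' & Hg0' & Hg1' & Eg').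
  set (k := xorb (snd (g 1)) (snd (g' 1))).
  assert (Hl := lifted_concat g _ Hg
                  (lifted_reverse _ (lifted_shift g' k Hg'))).
  assert (Eloop : snd (concat g (fun t : R =>
             (fst (g' (1 - t)), xorb (snd (g' (1 - t))) k)) 0)
     = snd (concat g (fun t : R =>
             (fst (g' (1 - t)), xorb (snd (g' (1 - t))) k)) 1)).
  { apply lifted_loop.
    - apply Hl. rewrite Rminus_0_r. rewrite Hg1', <- Hg1.
      unfold k. destruct (g 1) as [z' [|]], (snd (g' 1)); reflexivity.
    - rewrite concat_0, concat_1. simpl. rewrite Rminus_diag. congruence. }
  rewrite concat_0, concat_1 in Eloop. simpl in Eloop.
  rewrite Rminus_diag in Eloop. unfold k in Eloop. subst h h'.
  rewrite Eloop.
  destruct (snd (g 1)), (snd (g' 1)), (snd (g' 0)); reflexivity.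
Qed.

Lemma transport_extend b z w h :
  D z -> N z w -> transport b z h -> transport b w (xorb h (tau z w)).
Proof.
  intros Hz Hw (g & Hg & Hg0 & Hg1 & Eg).
  destruct (N_path z w Hz Hw) as (p & Hp & Hp0 & Hp1 & HpN).
  set (q := fun t => (p t, xorb (snd (g 1)) (tau z (p t)))).
  assert (Hq : lifted q).
  { intros t Ht. assert (HDp : D (p t)) by (apply (N_sub z); auto).
    split; [exact HDp|]. intros V HV.
    destruct (path_near p t _ Hp Ht (filter_and _ _ HV (N_nbhd _ HDp)))
      as (d & Hd & Hs).
    exists d. split; auto. intros s Hsu Hst.
    destruct (Hs s Hsu Hst) as [HVs HNs]. split; [exact HVs|]. simpl.
    rewrite (tau_cocycle z (p t) (p s)) by auto.
    now rewrite xorb_assoc. }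
  exists (concat g q). split; [|split; [|split]].
  - apply lifted_concat; auto. unfold q.
    rewrite Hp0, tau_refl, xorb_false_r by auto.
    rewrite <- Hg1. now destruct (g 1).
  - now rewrite concat_0.
  - now rewrite concat_1.
  - rewrite concat_0, concat_1. simpl. rewrite Hp1, <- Eg.
    now rewrite xorb_assoc.
Qed.

Lemma transport_exists b z :
  (exists g, path_in D g /\ g 0 = b /\ g 1 = z) -> exists h, transport b z h.
Proof.
  intros (g & Hg & H0 & H1). destruct (lift_exists g Hg) as [e He].
  eexists. exists (fun t => (g t, e t)).
  split; [exact He | split; [exact H0 | split; [exact H1 | reflexivity]]].
Qed.

Definition joined (z b : C) : Prop := exists h, transport b z h.

Lemma joined_refl z : D z -> joined z z.
Proof.
  intros Hz. apply transport_exists. exists (fun _ => z).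
  split; [split|]; auto.
  apply path_from_near. intros t V Ht HV. exists 1. split; [lra|].
  intros s _ _. exact (locally_singleton z V HV).
Qed.

Lemma joined_step z w : D z -> N z w -> joined z = joined w.
Proof.
  intros Hz Hw. apply functional_extensionality. intros b.
  apply propositional_extensionality. split.
  - intros [h Hh]. eexists. now apply transport_extend with (2 := Hw) (3 := Hh).
  - intros [h (g & Hg & H0 & H1 & E)].
    destruct (N_path z w Hz Hw) as (p & Hp & Hp0 & Hp1 & HpN).
    assert (HD : path_in D p)
      by (split; auto; intros t Ht; now apply (N_sub z), HpN).
    destruct (lift_exists p HD) as [e He].
    set (k := xorb (e 1) (snd (g 1))).
    eexists.
    exists (concat g (fun t => (p (1 - t), xorb (e (1 - t)) k))).
    split; [|split; [|split; [|reflexivity]]].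
    + apply lifted_concat; auto.
      * exact (lifted_reverse _ (lifted_shift _ k He)).
      * rewrite Rminus_0_r, Hp1, <- H1. unfold k.
        destruct (g 1) as [z' [|]], (e 1); reflexivity.
    + now rewrite concat_0.
    + rewrite concat_1. simpl. now rewrite Rminus_diag.
Qed.

(** The base point is chosen from the predicate [joined z], which is the same
    for all points of a path component. *)
Theorem monodromy_section :
  exists eps : C -> bool,
    forall z w, D z -> N z w -> eps w = xorb (eps z) (tau z w).
Proof.
  set (base := fun z => epsilon (inhabits (RtoC 0)) (joined z)).
  assert (Hbase : forall z, D z -> joined z (base z)).
  { intros z Hz. apply epsilon_spec. exists z. now apply joined_refl. }
  assert (Estep : forall z w, D z -> N z w -> base z = base w).
  { intros z w Hz Hw. unfold base. now rewrite (joined_step z w Hz Hw). }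
  set (eps := fun z =>
    if excluded_middle_informative (transport (base z) z true)
    then true else false).
  assert (Heps : forall z h, transport (base z) z h -> eps z = h).
  { intros z h Hh. unfold eps.
    destruct excluded_middle_informative as [Ht|Ht].
    - now apply (transport_unique (base z) z).
    - destruct h; [contradiction|reflexivity]. }
  exists eps. intros z w Hz Hw.
  destruct (Hbase z Hz) as [h Hh].
  rewrite (Heps z h Hh). apply Heps.
  rewrite <- (Estep z w Hz Hw). now apply transport_extend.
Qed.

End Monodromy.

(** * Square roots of holomorphic functions *)

Definition csqrt (c : C) : C :=
  (sqrt ((Cmod c + fst c) / 2),
   if Rle_dec 0 (snd c) then sqrt ((Cmod c - fst c) / 2)
   else - sqrt ((Cmod c - fst c) / 2)).

Lemma csqrt_square c : (csqrt c * csqrt c)%C = c.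
Proof.
  assert (H1 := fst_le_Cmod c). apply Rabs_le_between in H1.
  assert (Hp : 0 <= (Cmod c + fst c) / 2) by lra.
  assert (Hq : 0 <= (Cmod c - fst c) / 2) by lra.
  assert (E1 := sqrt_sqrt _ Hp). assert (E2 := sqrt_sqrt _ Hq).
  assert (E3 : sqrt ((Cmod c + fst c) / 2) * sqrt ((Cmod c - fst c) / 2)
               = Rabs (snd c) / 2).
  { rewrite <- sqrt_mult by auto.
    replace ((Cmod c + fst c) / 2 * ((Cmod c - fst c) / 2))
      with ((Rabs (snd c) / 2) ^ 2).
    - apply sqrt_pow2. assert (h := Rabs_pos (snd c)). lra.
    - assert (E := Cmod2_alt c). unfold Re, Im in E.
      assert (Ea := pow2_abs (snd c)).
      replace ((Rabs (snd c) / 2) ^ 2) with (Rabs (snd c) ^ 2 / 4) by field.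
      rewrite Ea. replace (snd c ^ 2) with (Cmod c ^ 2 - fst c ^ 2) by lra.
      field. }
  unfold csqrt. destruct c as [x y]. cbn [fst snd] in *.
  unfold Cmult; cbn [fst snd].
  destruct (Rle_dec 0 y) as [Hy|Hy].
  - rewrite (Rabs_pos_eq y) in E3 by auto. f_equal; lra.
  - rewrite (Rabs_left1 y) in E3 by lra. f_equal; lra.
Qed.

Lemma csqrt_re_pos c : 0 < fst c -> 0 < fst (csqrt c).
Proof.
  intros H. simpl. apply sqrt_lt_R0. assert (h := Cmod_ge_0 c). lra.
Qed.

Lemma cdiff_csqrt c : 0 < fst c -> cdiff csqrt c.
Proof.
  intros Hc. assert (Hs := csqrt_re_pos c Hc).
  assert (Hpos : forall w, 0 < fst w -> (csqrt w + csqrt c)%C <> RtoC 0).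
  { intros w Hw E. assert (h := csqrt_re_pos w Hw).
    apply (f_equal fst) in E. cbn [fst snd Cplus RtoC] in E. lra. }
  assert (Hdiff : forall w, 0 < fst w ->
            (csqrt w - csqrt c)%C = ((w - c) / (csqrt w + csqrt c))%C).
  { intros w Hw. replace (w - c)%C
      with (csqrt w * csqrt w - csqrt c * csqrt c)%C
      by now rewrite !csqrt_square.
    field. now apply Hpos. }
  assert (Hnear : locally c (fun w : C => 0 < fst w)).
  { apply locally_Cmod. exists (fst c). split; auto. intros w Hw.
    assert (h : Rabs (fst w + - fst c) < fst c)
      by exact (Rle_lt_trans _ _ _ (fst_le_Cmod (w - c)%C) Hw).
    apply Rabs_def2 in h. lra. }
  assert (Hcont : continuous csqrt c).
  { apply Ccontinuous_Cmod. intros eps He.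
    assert (Hn2 : locally c (fun w => Cmod (w - c) < eps * fst (csqrt c))).
    { apply locally_Cmod. exists (eps * fst (csqrt c)).
      split; auto. now apply Rmult_lt_0_compat. }
    generalize (filter_and _ _ Hnear Hn2). apply filter_imp.
    intros w [Hw1 Hw2]. rewrite Hdiff by auto.
    rewrite Cmod_div by auto.
    assert (Hge : fst (csqrt c) <= Cmod (csqrt w + csqrt c)).
    { assert (h := fst_le_Cmod (csqrt w + csqrt c)%C).
      assert (h2 := csqrt_re_pos w Hw1).
      cbn [fst snd Cplus] in h.
      assert (h3 := Rle_abs (fst (csqrt w) + fst (csqrt c))).
      lra. }
    apply Rlt_div_l; [lra|].
    apply Rlt_le_trans with (1 := Hw2). apply Rmult_le_compat_l; lra. }
  apply cdiff_ext_loc with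
    (fun w : C => if Rlt_dec 0 (fst w) then csqrt w
              else (csqrt c + (w - c) / (csqrt w + csqrt c))%C).
  { revert Hnear. apply filter_imp. intros w Hw.
    destruct Rlt_dec as [_|h]; [reflexivity|now elim h]. }
  exists (/ (csqrt c + csqrt c))%C, (fun w => / (csqrt w + csqrt c))%C.
  split; [|split; [|reflexivity]].
  - intros w. destruct (Rlt_dec 0 (fst c)) as [_|]; [|lra].
    destruct (Rlt_dec 0 (fst w)) as [Hw|Hw].
    + replace (/ (csqrt w + csqrt c) * (w - c))%C with (csqrt w - csqrt c)%C;
        [ring|]. rewrite Hdiff by auto. unfold Cdiv. ring.
    + unfold Cdiv. ring.
  - apply Ccont_inv; [|now apply Hpos].
    apply Ccont_plus; [exact Hcont | apply continuous_const].
Qed.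

Definition even_order (f : C -> C) (z : C) : Prop :=
  exists k g, factors_at f z (2 * k) g /\ continuous g z.

Lemma factors_not_zero (f : C -> C) (z : C) n g :
  factors_at f z n g -> continuous g z ->
  ~ locally z (fun w => f w = RtoC 0).
Proof.
  intros Hfg Hg H0.
  assert (H := filter_and _ _ (isolated_zero f z n g Hfg Hg) H0).
  destruct (punctured_point z _ H) as (w & Hw & _ & H1 & H2).
  now apply H1.
Qed.

(** After division by the even power of [w - z], the cofactor is normalized to
    the value 1 at [z], where the principal square root is holomorphic. *)
Lemma local_sqrt (f : C -> C) (z : C) :
  locally z (cdiff f) -> even_order f z ->
  exists r, locally z (fun w => cdiff r w /\ (r w * r w)%C = f w).
Proof.
  intros Hd (k & c & Hc & Hcc).
  destruct (order_dichotomy f z Hd) as [H0|(n & g & Hg & Hgd)].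
  { now elim (factors_not_zero f z _ c Hc Hcc). }
  assert (Hgc := cdiff_near_continuous g z Hgd).
  assert (En := order_unique f z n g _ c Hg Hgc Hc Hcc).
  destruct Hg as [Hfg Hg0]. rewrite En in Hfg.
  set (u := fun w => (g w / g z)%C).
  assert (Hu : locally z (fun w => 0 < fst (u w))).
  { assert (Huc : continuous (fun w => fst (u w)) z).
    { apply Ccont_fst. apply Ccont_mult; [auto | apply continuous_const]. }
    apply (Huc (fun x => 0 < x)).
    assert (E1 : fst (u z) = 1) by (unfold u, Cdiv; rewrite Cinv_r; auto).
    rewrite E1. exists (mkposreal 1 Rlt_0_1). intros y Hy.
    change (Rabs (y - 1) < 1) in Hy. apply Rabs_def2 in Hy. lra. }
  exists (fun w => ((w - z) ^ k * (csqrt (g z) * csqrt (u w)))%C).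
  generalize (filter_and _ _ Hu (filter_and _ _ Hfg Hgd)). apply filter_imp.
  intros w (Huw & Efg & Hgw). split.
  - apply cdiff_mult.
    + apply cdiff_pow, cdiff_sub.
    + apply cdiff_mult; [apply cdiff_const|].
      apply (cdiff_comp csqrt u); [now apply cdiff_csqrt|].
      apply cdiff_mult; [auto | apply cdiff_const].
  - rewrite Efg.
    replace (2 * k)%nat with (k + k)%nat by lia. rewrite Cpow_add_r.
    transitivity ((w - z) ^ k * (w - z) ^ k
        * ((csqrt (g z) * csqrt (g z)) * (csqrt (u w) * csqrt (u w))))%C;
      [ring|].
    rewrite !csqrt_square. unfold u. field. exact Hg0.
Qed.

(** The product of [f - g] and [f + g] vanishes.  Where [f - g] is not
    identically zero its zeros are isolated, so that [f + g] is zero nearby. *)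
Lemma roots_agree (f g : C -> C) (z : C) :
  locally z (cdiff f) -> locally z (cdiff g) ->
  locally z (fun w => (f w * f w)%C = (g w * g w)%C) ->
  locally z (fun w => f w = g w) \/ locally z (fun w => f w = (- g w)%C).
Proof.
  intros Hf Hg Hsq.
  assert (Hd : locally z (cdiff (fun w => (f w - g w)%C))).
  { generalize (filter_and _ _ Hf Hg). apply filter_imp.
    intros w [H1 H2]. now apply cdiff_minus. }
  destruct (order_dichotomy _ z Hd) as [H0|(n & h & Hh & Hhd)].
  - left. revert H0. apply filter_imp. intros w E. now apply Ceq_minus.
  - right.
    assert (Hhc := cdiff_near_continuous h z Hhd).
    assert (Hiso := isolated_zero _ z n h Hh Hhc).
    assert (Hoff : locally z (fun w => w <> z -> (f w + g w)%C = RtoC 0)).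
    { generalize (filter_and _ _ Hiso Hsq). apply filter_imp.
      intros w [H1 H2] Hw. specialize (H1 Hw).
      replace (f w + g w)%C with ((f w * f w - g w * g w) / (f w - g w))%C
        by (field; auto).
      rewrite H2. unfold Cdiv. ring. }
    assert (Hz : (f z + g z)%C = RtoC 0).
    { apply (continuous_agree (fun w => (f w + g w)%C) (fun _ => RtoC 0));
        [|apply continuous_const|exact Hoff].
      apply Ccont_plus; now apply cdiff_near_continuous. }
    revert Hoff. apply filter_imp. intros w H.
    assert (E : (f w + g w)%C = RtoC 0)
      by (destruct (Ceq_dec w z) as [->|]; auto).
    replace (f w) with ((f w + g w) - g w)%C by ring. rewrite E. ring.
Qed.

Definition csign (b : bool) (z : C) : C := if b then (- z)%C else z.

Lemma csign_xorb a b z : csign (xorb a b) z = csign a (csign b z).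
Proof. destruct a, b; simpl; ring. Qed.

Lemma csign_square b z : (csign b z * csign b z)%C = (z * z)%C.
Proof. destruct b; simpl; ring. Qed.

Lemma csign_mult b z : csign b z = (csign b 1 * z)%C.
Proof. destruct b; simpl; ring. Qed.

Lemma cdiff_csign b f z : cdiff f z -> cdiff (fun w => csign b (f w)) z.
Proof.
  intros H. apply cdiff_ext_loc with (fun w => csign b 1 * f w)%C.
  - apply filter_forall. intros w. symmetry. apply csign_mult.
  - apply cdiff_mult; [apply cdiff_const | exact H].
Qed.

Definition segment (a b : C) (t : R) : C := (a + RtoC t * (b - a))%C.

Lemma segment_path (a b : C) :
  continuous_on unit_interval (segment a b).
Proof.
  intros t _ V HV. apply filter_le_within.
  assert (Hc : continuous (segment a b) t).
  { apply Ccont_plus; [apply continuous_const|].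
    apply Ccont_mult; [|apply continuous_const].
    apply Ccont_pair; [apply continuous_id | apply continuous_const]. }
  exact (Hc V HV).
Qed.

Lemma segment_0 a b : segment a b 0 = a.
Proof. unfold segment. ring. Qed.

Lemma segment_1 a b : segment a b 1 = b.
Proof. unfold segment. ring. Qed.

Lemma segment_ball (z a b : C) (d t : R) :
  unit_interval t -> Cmod (a - z) < d -> Cmod (b - z) < d ->
  Cmod (segment a b t - z) < d.
Proof.
  intros [H0 H1] Ha Hb.
  replace (segment a b t - z)%C
    with (RtoC (1 - t) * (a - z) + RtoC t * (b - z))%C
    by (unfold segment; rewrite RtoC_minus; ring).
  eapply Rle_lt_trans; [apply Cmod_triangle|].
  rewrite !Cmod_mult, !Cmod_R, !Rabs_pos_eq by lra.
  destruct (Rle_lt_or_eq_dec 0 t H0) as [Ht|<-]; [|lra].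
  assert (t * Cmod (b - z) < t * d) by now apply Rmult_lt_compat_l.
  assert ((1 - t) * Cmod (a - z) <= (1 - t) * d)
    by (apply Rmult_le_compat_l; lra).
  lra.
Qed.

(** The local square roots form a two-sheeted covering; its section is the
    global root.  The sheets are compared as germs, so that a zero of [phi]
    does not branch the covering. *)
Theorem global_sqrt (D : C -> Prop) (phi : C -> C) :
  (forall z, D z -> locally z D) ->
  (forall z, D z -> cdiff phi z) ->
  (forall z, D z -> even_order phi z) ->
  (forall g : R -> C, path_in D g -> g 0 = g 1 -> null_homotopic D g) ->
  exists psi, forall z, D z -> cdiff psi z /\ (psi z * psi z)%C = phi z.
Proof.
  intros HD Hphi Heven Hloops.
  assert (Hlocal : forall z, exists p : (C -> C) * R, D z -> 0 < snd p /\
            forall w, Cmod (w - z) < snd p ->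
              D w /\ cdiff (fst p) w /\ (fst p w * fst p w)%C = phi w).
  { intros z. destruct (classic (D z)) as [Hz|Hz];
      [|exists (fun _ => RtoC 0, 0); contradiction].
    destruct (local_sqrt phi z) as [r Hr]; auto.
    - generalize (HD z Hz). apply filter_imp. auto.
    - assert (H := filter_and _ _ (HD z Hz) Hr).
      apply locally_Cmod in H. destruct H as (d & Hd & H).
      exists (r, d). intros _. split; [exact Hd|].
      intros w Hw. destruct (H w Hw) as (h1 & h2 & h3). auto. }
  apply functional_choice in Hlocal. destruct Hlocal as [p Hp].
  set (rho := fun z => snd (p z)). set (r := fun z => fst (p z)).
  set (N := fun z w => Cmod (w - z) < rho z).
  assert (Hrho : forall z, D z -> 0 < rho z) by (intros z Hz; apply (Hp z Hz)).
  assert (Hr : forall z w, D z -> N z w ->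
            D w /\ cdiff (r z) w /\ (r z w * r z w)%C = phi w)
    by (intros z w Hz; apply (Hp z Hz)).
  clearbody rho r. clear Hp p.
  assert (HNopen : forall z w, D z -> N z w -> locally w (N z)).
  { intros z w Hz Hw. apply locally_Cmod.
    exists (rho z - Cmod (w - z)). split; [unfold N in Hw; lra|].
    intros v Hv. unfold N.
    replace (v - z)%C with ((v - w) + (w - z))%C by ring.
    eapply Rle_lt_trans; [apply Cmod_triangle|]. lra. }
  assert (HNrefl : forall z, D z -> N z z).
  { intros z Hz. unfold N. replace (z - z)%C with (RtoC 0) by ring.
    rewrite Cmod_0. auto. }
  assert (Hagree : forall z w v, D z -> D w -> N z v -> N w v ->
            exists b, locally v (fun x => r z x = csign b (r w x))).
  { intros z w v Hz Hw Hzv Hwv.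
    assert (H1 := HNopen z v Hz Hzv). assert (H2 := HNopen w v Hw Hwv).
    destruct (roots_agree (r z) (r w) v) as [H|H].
    - revert H1. apply filter_imp. intros x Hx. now apply Hr.
    - revert H2. apply filter_imp. intros x Hx. now apply Hr.
    - generalize (filter_and _ _ H1 H2). apply filter_imp.
      intros x [Hx1 Hx2]. destruct (Hr z x Hz Hx1) as (_ & _ & ->).
      now destruct (Hr w x Hw Hx2) as (_ & _ & ->).
    - now exists false.
    - now exists true. }
  assert (Hunique : forall w v b c, D w -> N w v ->
            locally v (fun x => csign b (r w x) = csign c (r w x)) -> b = c).
  { intros w v b c Hw Hv H. destruct (Bool.bool_dec b c) as [E|E]; [exact E|].
    exfalso. destruct (Hr w v Hw Hv) as (HDv & _).
    destruct (Heven v HDv) as (k & g & Hg & Hgc).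
    apply (factors_not_zero phi v _ g Hg Hgc).
    generalize (filter_and _ _ H (HNopen w v Hw Hv)). apply filter_imp.
    intros x [Ex Hx]. destruct (Hr w x Hw Hx) as (_ & _ & <-).
    assert (E0 : r w x = RtoC 0).
    { assert (E2 : (RtoC 2 * r w x)%C = RtoC 0).
      { destruct b, c; try (now elim E); simpl in Ex.
        - replace (RtoC 2 * r w x)%C with (r w x - - r w x)%C by ring.
          rewrite Ex. ring.
        - replace (RtoC 2 * r w x)%C with (r w x - - r w x)%C by ring.
          rewrite <- Ex. ring. }
      replace (r w x) with (/ RtoC 2 * (RtoC 2 * r w x))%C by field.
      rewrite E2. ring. }
    rewrite E0. ring. }
  set (tau := fun z w =>
    if excluded_middle_informative (locally w (fun x => r z x = r w x))
    then false else true).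
  assert (Htau : forall z w, D z -> N z w ->
            locally w (fun x => r z x = csign (tau z w) (r w x))).
  { intros z w Hz Hw. assert (HDw : D w) by now apply (Hr z w).
    unfold tau. destruct excluded_middle_informative as [H|H]; [exact H|].
    destruct (Hagree z w w Hz HDw Hw (HNrefl w HDw)) as [[|] Hb];
      [exact Hb | contradiction]. }
  destruct (monodromy_section D N tau) as [eps Heps].
  - intros z Hz. apply HNopen; auto.
  - intros z w Hz Hw. now apply (Hr z w).
  - intros z w Hz Hw. exists (segment z w).
    split; [apply segment_path|]. split; [apply segment_0|].
    split; [apply segment_1|]. intros t Ht.
    apply segment_ball; auto. now apply HNrefl.
  - intros z w w' Hz Hw Hw' Hww'.
    assert (HDw : D w) by now apply (Hr z w).
    assert (HDw' : D w') by now apply (Hr z w').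
    set (b := tau z w).
    set (S := fun c x => locally x (fun y => r z y = csign c (r w y))).
    assert (HSopen : forall c, open (S c))
      by (intros c x Hx; apply locally_locally, Hx).
    assert (Hseg : forall t, unit_interval t ->
              N z (segment w w' t) /\ N w (segment w w' t)).
    { intros t Ht. split; apply segment_ball; auto. now apply HNrefl. }
    assert (Hb : S b w').
    { rewrite <- (segment_1 w w').
      apply (path_separation (segment w w') (S b) (S (negb b))) with 0;
        auto using segment_path.
      - intros t Ht. destruct (Hseg t Ht) as [h1 h2].
        destruct (Hagree z w _ Hz HDw h1 h2) as [c Hc].
        destruct (Bool.bool_dec c b) as [->|Hcb]; [now left|right].
        replace (negb b) with c by (destruct b, c; auto; now elim Hcb).
        exact Hc.
      - intros t Ht [h1 h2]. destruct (Hseg t Ht) as [_ h3].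
        assert (E : b = negb b); [|now destruct b].
        apply (Hunique w _ _ _ HDw h3).
        generalize (filter_and _ _ h1 h2). apply filter_imp.
        intros x [E1 E2]. now rewrite <- E1.
      - apply unit0.
      - apply unit1.
      - rewrite segment_0. now apply Htau. }
    apply (Hunique w' w'); auto.
    assert (H1 := Htau z w' Hz Hw'). assert (H2 := Htau w w' HDw Hww').
    generalize (filter_and _ _ Hb (filter_and _ _ H1 H2)). apply filter_imp.
    intros x (E1 & E2 & E3). rewrite <- E2, E1, E3. now rewrite csign_xorb.
  - exact Hloops.
  - exists (fun z => csign (eps z) (r z z)).
    intros z Hz.
    assert (Hnear : locally z (fun w => csign (eps z) (r z w)
                                        = csign (eps w) (r w w))).
    { generalize (HNopen z z Hz (HNrefl z Hz)). apply filter_imp.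
      intros w Hw. rewrite (Heps z w Hz Hw), csign_xorb. f_equal.
      exact (locally_singleton w _ (Htau z w Hz Hw)). }
    destruct (Hr z z Hz (HNrefl z Hz)) as (_ & Hd & E). split.
    + apply cdiff_ext_loc with (1 := Hnear). now apply cdiff_csign.
    + rewrite csign_square. exact E.
Qed.

(** * Quaternions and slices *)

Ltac quat_ring :=
  intros;
  repeat match goal with
         | x : Quat |- _ => destruct x as [[[? ?] ?] ?]
         | x : C |- _ => destruct x as [? ?]
         end;
  apply quat_eq; cbv -[Rplus Rmult Ropp Rminus R0 R1 IZR]; ring.

Lemma Qmult_assoc (p q r : Quat) : (p * (q * r) = p * q * r)%Q.
Proof. quat_ring. Qed.

Definition qnorm2 (q : Quat) : R :=
  q_re q ^ 2 + q_i q ^ 2 + q_j q ^ 2 + q_k q ^ 2.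

Lemma qnorm2_mult (p q : Quat) : qnorm2 (p * q)%Q = qnorm2 p * qnorm2 q.
Proof.
  destruct p as [[[a b] c] d], q as [[[a' b'] c'] d'].
  cbv -[Rplus Rmult Ropp Rminus R0 R1 IZR]. ring.
Qed.

Lemma qnorm2_0 (q : Quat) : qnorm2 q = 0 <-> q = RtoQ 0.
Proof.
  split.
  - intros H. unfold qnorm2 in H.
    apply quat_eq; cbn [RtoQ quat q_re q_i q_j q_k fst snd];
      destruct q as [[[a b] c] d]; unfold q_re, q_i, q_j, q_k in *;
      simpl in *; nra.
  - intros ->. cbv -[Rplus Rmult R0 R1 IZR]. ring.
Qed.

Lemma Qmult_eq_0 (p q : Quat) : (p * q)%Q = RtoQ 0 -> p = RtoQ 0 \/ q = RtoQ 0.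
Proof.
  intros H. apply qnorm2_0 in H. rewrite qnorm2_mult in H.
  apply Rmult_integral in H. now rewrite !qnorm2_0 in H.
Qed.

Lemma imag_unit_char (J : Quat) :
  imag_unit J <-> q_re J = 0 /\ q_i J ^ 2 + q_j J ^ 2 + q_k J ^ 2 = 1.
Proof.
  unfold imag_unit. destruct J as [[[a b] c] d].
  unfold q_re, q_i, q_j, q_k; simpl fst; simpl snd. split.
  - intros H.
    assert (H1 := f_equal q_re H). assert (H2 := f_equal q_i H).
    assert (H3 := f_equal q_j H). assert (H4 := f_equal q_k H). clear H.
    cbv -[Rplus Rmult Ropp Rminus R0 R1 IZR] in H1, H2, H3, H4.
    assert (Ha : a = 0).
    { destruct (Req_dec a 0) as [E|E]; [exact E|exfalso].
      assert (b = 0) by (apply (Rmult_eq_reg_l a); lra).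
      assert (c = 0) by (apply (Rmult_eq_reg_l a); lra).
      assert (d = 0) by (apply (Rmult_eq_reg_l a); lra).
      subst. nra. }
    subst a. split; [reflexivity|]. lra.
  - intros [-> H].
    apply quat_eq; cbv -[Rplus Rmult Ropp Rminus R0 R1 IZR]; lra.
Qed.

Lemma imag_unit_opp (J : Quat) : imag_unit J -> imag_unit (- J)%Q.
Proof.
  rewrite !imag_unit_char. destruct J as [[[a b] c] d].
  cbv -[Rplus Rmult Ropp Rminus R0 R1 IZR]. lra.
Qed.

Lemma imag_unit_square (J q : Quat) : imag_unit J -> (J * (J * q))%Q = (- q)%Q.
Proof.
  intros H. rewrite Qmult_assoc. unfold imag_unit in H. rewrite H. quat_ring.
Qed.

Definition I0 : Quat := quat 0 1 0 0.

Lemma imag_unit_I0 : imag_unit I0.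
Proof. apply imag_unit_char. cbn. lra. Qed.

(** The identification of the complex numbers with the slice of [J]. *)
Definition in_slice (J : Quat) (z : C) : Quat := slice_point (fst z) (snd z) J.

Lemma in_slice_eq (J : Quat) (z : C) :
  in_slice J z = (RtoQ (fst z) + J * RtoQ (snd z))%Q.
Proof. unfold in_slice, slice_point. quat_ring. Qed.

Lemma in_slice_coords (J : Quat) (z : C) : imag_unit J ->
  in_slice J z = quat (fst z) (snd z * q_i J) (snd z * q_j J) (snd z * q_k J).
Proof.
  intros HJ. apply imag_unit_char in HJ. destruct HJ as [HJ _].
  destruct J as [[[a b] c] d]. unfold q_re in HJ; simpl in HJ. subst a.
  unfold in_slice. quat_ring.
Qed.

Lemma in_slice_mult (J : Quat) (z w : C) : imag_unit J ->
  (in_slice J z * in_slice J w)%Q = in_slice J (z * w)%C.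
Proof.
  intros HJ.
  transitivity ((RtoQ (fst z * fst w)
                 + RtoQ (fst z * snd w + snd z * fst w) * J
                 + RtoQ (snd z * snd w) * (J * J))%Q).
  - unfold in_slice. quat_ring.
  - unfold imag_unit in HJ. rewrite HJ. unfold in_slice. quat_ring.
Qed.

Lemma in_slice_pow (J : Quat) (z : C) (n : nat) : imag_unit J ->
  (in_slice J z ^ n)%Q = in_slice J (z ^ n)%C.
Proof.
  intros HJ. induction n as [|n IH].
  - unfold in_slice. simpl. quat_ring.
  - change (in_slice J z ^ S n)%Q with (in_slice J z * in_slice J z ^ n)%Q.
    now rewrite IH, in_slice_mult.
Qed.

Lemma in_slice_inj (J : Quat) (z w : C) : imag_unit J ->
  in_slice J z = in_slice J w -> z = w.
Proof.
  intros HJ E. rewrite !in_slice_coords in E by exact HJ.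
  apply imag_unit_char in HJ. destruct HJ as [_ HJ].
  unfold quat in E. injection E as E1 E2 E3 E4.
  destruct z as [a b], w as [a' b']. cbn [fst snd] in *. f_equal; [exact E1|].
  assert (Hs : (b - b') * (q_i J ^ 2 + q_j J ^ 2 + q_k J ^ 2) = 0).
  { replace ((b - b') * (q_i J ^ 2 + q_j J ^ 2 + q_k J ^ 2))
      with ((b * q_i J - b' * q_i J) * q_i J
            + (b * q_j J - b' * q_j J) * q_j J
            + (b * q_k J - b' * q_k J) * q_k J) by ring.
    rewrite E2, E3, E4. ring. }
  rewrite HJ in Hs. lra.
Qed.

Lemma in_slice_real (J : Quat) (x : R) : in_slice J (x, 0) = RtoQ x.
Proof. unfold in_slice, slice_point. quat_ring. Qed.

Lemma in_slice_conj (J : Quat) (z : C) :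
  in_slice (- J)%Q (Cconj z) = in_slice J z.
Proof. unfold in_slice, slice_point, Cconj. quat_ring. Qed.

Lemma in_slice_eq_0 (J : Quat) (z : C) : imag_unit J ->
  in_slice J z = RtoQ 0 <-> z = RtoC 0.
Proof.
  intros HJ. split.
  - intros E. apply (in_slice_inj J); auto. rewrite E. symmetry.
    apply in_slice_real.
  - intros ->. apply in_slice_real.
Qed.

(** The values at [J] and [- J] have sum [2 p] and difference [2 J r]. *)
Lemma stem_unique (p r p' r' : Quat) :
  (forall J, imag_unit J -> (p + J * r)%Q = (p' + J * r')%Q) ->
  p = p' /\ r = r'.
Proof.
  intros H. assert (H1 := H _ imag_unit_I0).
  assert (H2 := H _ (imag_unit_opp _ imag_unit_I0)).
  destruct p as [[[a b] c] d], r as [[[a1 b1] c1] d1],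
    p' as [[[a' b'] c'] d'], r' as [[[a1' b1'] c1'] d1'].
  cbv -[Rplus Rmult Ropp Rminus R0 R1 IZR] in H1, H2.
  injection H1 as ? ? ? ?. injection H2 as ? ? ? ?.
  split; apply quat_eq; unfold q_re, q_i, q_j, q_k; simpl; lra.
Qed.

Definition im_norm (q : Quat) : R := sqrt (q_i q ^ 2 + q_j q ^ 2 + q_k q ^ 2).

(** The upper half plane representative of the sphere through [q]. *)
Definition to_C (q : Quat) : C := (q_re q, im_norm q).

(** On the real axis every direction serves; [I0] is a default. *)
Definition direction (q : Quat) : Quat :=
  if Req_dec_T (im_norm q) 0 then I0
  else quat 0 (q_i q / im_norm q) (q_j q / im_norm q) (q_k q / im_norm q).

Lemma im_norm_square q : im_norm q ^ 2 = q_i q ^ 2 + q_j q ^ 2 + q_k q ^ 2.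
Proof.
  apply pow2_sqrt. nra.
Qed.

Lemma imag_unit_direction q : imag_unit (direction q).
Proof.
  unfold direction. destruct Req_dec_T as [E|E]; [apply imag_unit_I0|].
  apply imag_unit_char. split; [reflexivity|].
  cbn [quat q_i q_j q_k fst snd]. assert (h := im_norm_square q).
  replace ((q_i q / im_norm q) ^ 2 + (q_j q / im_norm q) ^ 2
           + (q_k q / im_norm q) ^ 2)
    with ((q_i q ^ 2 + q_j q ^ 2 + q_k q ^ 2) / im_norm q ^ 2) by (field; auto).
  rewrite <- h. field. auto.
Qed.

Lemma in_slice_to_C q : in_slice (direction q) (to_C q) = q.
Proof.
  rewrite in_slice_coords by apply imag_unit_direction.
  unfold to_C, direction. simpl fst; simpl snd.
  destruct Req_dec_T as [E|E].
  - assert (h := im_norm_square q). rewrite E in *.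
    assert (q_i q = 0) by nra.
    assert (q_j q = 0) by nra.
    assert (q_k q = 0) by nra.
    apply quat_eq; cbn; lra.
  - apply quat_eq; cbn [quat q_re q_i q_j q_k fst snd]; [reflexivity|..];
      field; auto.
Qed.

Lemma im_norm_in_slice J z :
  imag_unit J -> im_norm (in_slice J z) = Rabs (snd z).
Proof.
  intros HJ. rewrite in_slice_coords by auto. apply imag_unit_char in HJ.
  unfold im_norm. cbn [quat q_i q_j q_k fst snd].
  replace ((snd z * q_i J) ^ 2 + (snd z * q_j J) ^ 2 + (snd z * q_k J) ^ 2)
    with (snd z ^ 2 * (q_i J ^ 2 + q_j J ^ 2 + q_k J ^ 2)) by ring.
  destruct HJ as [_ ->]. rewrite Rmult_1_r, <- pow2_abs.
  apply sqrt_pow2, Rabs_pos.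
Qed.

Lemma to_C_in_slice J z : imag_unit J ->
  to_C (in_slice J z) = z \/ to_C (in_slice J z) = Cconj z.
Proof.
  intros HJ. unfold to_C. rewrite im_norm_in_slice, in_slice_coords by auto.
  destruct z as [x y]. cbn [quat q_re fst snd]. unfold Cconj; simpl.
  destruct (Rle_dec 0 y).
  - left. rewrite Rabs_pos_eq; auto.
  - right. rewrite Rabs_left1; auto. lra.
Qed.

Lemma circ_to_C (D : C -> Prop) (q : Quat) :
  conj_invariant D -> circ D q <-> D (to_C q).
Proof.
  intros HD. split.
  - intros (a & b & J & Hab & HJ & ->).
    destruct (to_C_in_slice J (a, b) HJ) as [E|E]; unfold in_slice in E;
      simpl in E; rewrite E; auto.
  - intros H. exists (q_re q), (im_norm q), (direction q).
    split; [exact H|]. split; [apply imag_unit_direction|].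
    symmetry. apply in_slice_to_C.
Qed.

Lemma circ_in_slice (D : C -> Prop) (J : Quat) (z : C) :
  conj_invariant D -> imag_unit J -> circ D (in_slice J z) <-> D z.
Proof.
  intros HD HJ. split.
  - intros H. apply circ_to_C in H; auto.
    destruct (to_C_in_slice J z HJ) as [E|E]; rewrite E in H; auto.
    rewrite <- (Cconj_conj z). auto.
  - intros H. exists (fst z), (snd z), J. destruct z; auto.
Qed.

Lemma circ_cases (D : C -> Prop) (q : Quat) :
  circ D q -> exists z J, D z /\ imag_unit J /\ q = in_slice J z.
Proof.
  intros (a & b & J & Hab & HJ & ->). exists (a, b), J. auto.
Qed.

(** ** Topology of circular sets *)

Section QuatContinuity.
Context {U : UniformSpace}.

Definition qcont (f : U -> Quat) (x : U) : Prop :=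
  continuous (fun t => q_re (f t)) x /\ continuous (fun t => q_i (f t)) x /\
  continuous (fun t => q_j (f t)) x /\ continuous (fun t => q_k (f t)) x.

Lemma qcont_continuous (f : U -> Quat) x : qcont f x -> continuous f x.
Proof.
  intros (H1 & H2 & H3 & H4). apply filterlim_locally. intros eps.
  apply filterlim_locally with (eps := eps) in H1, H2, H3, H4.
  generalize (filter_and _ _ (filter_and _ _ (filter_and _ _ H1 H2) H3) H4).
  apply filter_imp. intros t Ht. exact Ht.
Qed.

Lemma continuous_qcont (f : U -> Quat) x : continuous f x -> qcont f x.
Proof.
  intros H. assert (K := proj1 (filterlim_locally f (f x)) H).
  repeat split; apply filterlim_locally; intros eps; generalize (K eps);
    apply filter_imp; intros t [[[h1 h2] h3] h4]; assumption.
Qed.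

Lemma qcont_minus (f g : U -> Quat) x :
  qcont f x -> qcont g x -> qcont (fun t => (f t - g t)%Q) x.
Proof.
  intros (H1 & H2 & H3 & H4) (K1 & K2 & K3 & K4).
  repeat split; [apply (Rcont_minus (fun t => q_re (f t)))
                |apply (Rcont_minus (fun t => q_i (f t)))
                |apply (Rcont_minus (fun t => q_j (f t)))
                |apply (Rcont_minus (fun t => q_k (f t)))]; assumption.
Qed.

Lemma qcont_plus (f g : U -> Quat) x :
  qcont f x -> qcont g x -> qcont (fun t => (f t + g t)%Q) x.
Proof.
  intros (H1 & H2 & H3 & H4) (K1 & K2 & K3 & K4).
  repeat split; [apply (Rcont_plus (fun t => q_re (f t)))
                |apply (Rcont_plus (fun t => q_i (f t)))
                |apply (Rcont_plus (fun t => q_j (f t)))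
                |apply (Rcont_plus (fun t => q_k (f t)))]; assumption.
Qed.

Lemma qcont_mult (f g : U -> Quat) x :
  qcont f x -> qcont g x -> qcont (fun t => (f t * g t)%Q) x.
Proof.
  intros (H1 & H2 & H3 & H4) (K1 & K2 & K3 & K4).
  split; [|split; [|split]].
  - apply (Rcont_minus (fun t => q_re (f t) * q_re (g t) - q_i (f t) * q_i (g t)
                                 - q_j (f t) * q_j (g t)));
      [apply Rcont_minus; [apply Rcont_minus|]|]; now apply Rcont_mult.
  - apply (Rcont_minus (fun t => q_re (f t) * q_i (g t) + q_i (f t) * q_re (g t)
                                 + q_j (f t) * q_k (g t)));
      [apply Rcont_plus; [apply Rcont_plus|]|]; now apply Rcont_mult.
  - apply (Rcont_plus (fun t => q_re (f t) * q_j (g t) - q_i (f t) * q_k (g t)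
                                + q_j (f t) * q_re (g t)));
      [apply Rcont_plus; [apply Rcont_minus|]|]; now apply Rcont_mult.
  - apply (Rcont_plus (fun t => q_re (f t) * q_k (g t) + q_i (f t) * q_j (g t)
                                - q_j (f t) * q_i (g t)));
      [apply Rcont_minus; [apply Rcont_plus|]|]; now apply Rcont_mult.
Qed.

Lemma qcont_const (q : Quat) x : qcont (fun _ : U => q) x.
Proof. repeat split; apply continuous_const. Qed.

Lemma qcont_RtoQ (u : U -> R) x :
  continuous u x -> qcont (fun t => RtoQ (u t)) x.
Proof. intros H. repeat split; auto; apply continuous_const. Qed.

End QuatContinuity.

Lemma in_slice_continuous (J : Quat) (z : C) : continuous (in_slice J) z.
Proof.
  apply qcont_continuous. apply (qcont_plus (fun z : C => RtoQ (fst z))).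
  - apply qcont_RtoQ. apply continuous_fst.
  - apply (qcont_mult (fun z : C => RtoQ (snd z))); [|apply qcont_const].
    apply qcont_RtoQ. apply continuous_snd.
Qed.

Lemma to_C_continuous (q : Quat) : continuous to_C q.
Proof.
  destruct (continuous_qcont (fun q => q) q (continuous_id q))
    as (H1 & H2 & H3 & H4).
  apply Ccont_pair; [exact H1|].
  apply (continuous_comp (fun q => q_i q ^ 2 + q_j q ^ 2 + q_k q ^ 2) sqrt).
  - simpl. repeat apply Rcont_plus; repeat apply Rcont_mult; auto;
      apply continuous_const.
  - apply continuous_sqrt.
Qed.

Lemma open_circ (S : C -> Prop) : conj_invariant S -> open S -> open (circ S).
Proof.
  intros HS HO. apply open_ext with (fun q => S (to_C q)).
  - intros q. symmetry. now apply circ_to_C.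
  - apply open_comp; auto. intros q _. apply to_C_continuous.
Qed.

Lemma circular_domain_open (D : C -> Prop) : circular_domain D -> open D.
Proof.
  intros (Hc & HO & _). apply open_ext with (fun z => circ D (in_slice I0 z)).
  - intros z. apply circ_in_slice; auto. apply imag_unit_I0.
  - apply open_comp; auto. intros z _. apply in_slice_continuous.
Qed.

(** [D] may have two components, exchanged by conjugation; only conjugation
    invariant sets correspond to open sets of quaternions, where the domain is
    connected. *)
Lemma circular_split (D S T : C -> Prop) :
  circular_domain D -> conj_invariant S -> conj_invariant T ->
  open S -> open T -> (forall z, S z -> D z) -> (forall z, T z -> D z) ->
  (forall z, D z -> S z \/ T z) -> (exists z, S z) -> (exists z, T z) ->
  exists z, S z /\ T z.
Proof.
  intros (Hc & HO & Hconn) HS HT HSO HTO HSD HTD Hcov [s Hs] [t Ht].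
  destruct (Hconn (circ S) (circ T)) as (q & Hq & HqS & HqT).
  - now apply open_circ.
  - now apply open_circ.
  - intros q Hq. rewrite !circ_to_C by auto. apply Hcov. now apply circ_to_C.
  - exists (in_slice I0 s).
    rewrite !circ_in_slice by auto using imag_unit_I0. auto.
  - exists (in_slice I0 t).
    rewrite !circ_in_slice by auto using imag_unit_I0. auto.
  - exists (to_C q). rewrite <- !circ_to_C by auto. auto.
Qed.

(** A loop in [D] is carried to a slice, contracted there, and the homotopy is
    projected back to the plane. *)
Lemma loops_contract (D : C -> Prop) (I : Quat) :
  conj_invariant D -> imag_unit I ->
  (forall q, plane_section (circ D) I q ->
     simply_connected (component (plane_section (circ D) I) q)) ->
  forall g : R -> C, path_in D g -> g 0 = g 1 -> null_homotopic D g.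
Proof.
  intros Hc HI Hsc g [Hg HD] Hloop.
  set (A := plane_section (circ D) I).
  set (gq := fun t => in_slice I (g t)).
  assert (HA : forall z, D z -> A (in_slice I z)).
  { intros z Hz. split; [now apply circ_in_slice|].
    exists (fst z), (snd z). reflexivity. }
  assert (Hgq : path_in A gq).
  { split.
    - intros t Ht. apply (filterlim_comp _ _ _ g (in_slice I) _ _ _ (Hg t Ht)).
      apply in_slice_continuous.
    - intros t Ht. apply HA, HD, Ht. }
  assert (H0 : A (gq 0)) by (apply Hgq; apply unit0).
  destruct (Hsc _ H0) as [_ Hnull].
  destruct (Hnull gq) as (Phi & HPc & HPA & HP0 & HP1 & HPs).
  - split; [apply Hgq|]. intros t Ht. now apply path_component.
  - unfold gq. now rewrite Hloop.
  - set (pr := fun q =>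
      (q_re q, q_i q * q_i I + q_j q * q_j I + q_k q * q_k I) : C).
    assert (Hpr : forall z, pr (in_slice I z) = z).
    { intros z. rewrite in_slice_coords by auto.
      apply imag_unit_char in HI. destruct HI as [_ HI].
      unfold pr. cbn [quat q_re q_i q_j q_k fst snd]. destruct z as [x y].
      simpl. f_equal.
      transitivity (y * (q_i I ^ 2 + q_j I ^ 2 + q_k I ^ 2)); [ring|].
      rewrite HI. ring. }
    assert (Hprc : forall q, continuous pr q).
    { intros q.
      destruct (continuous_qcont (fun q => q) q (continuous_id q))
        as (K1 & K2 & K3 & K4).
      apply Ccont_pair; [exact K1|].
      repeat apply Rcont_plus; apply Rcont_mult; auto;
        apply continuous_const. }
    assert (HAD : forall q, component A (gq 0) q -> D (pr q)).
    { intros q (B & _ & HBA & _ & HBq).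
      destruct (HBA q HBq) as [Hq (a & b & E)].
      change (slice_point a b I) with (in_slice I (a, b)) in E. subst q.
      rewrite Hpr. apply circ_in_slice in Hq; auto. }
    exists (fun p => pr (Phi p)). split; [|split; [|split; [|split]]].
    + intros p Hp.
      apply (filterlim_comp _ _ _ Phi pr _ _ _ (HPc p Hp)). apply Hprc.
    + intros p Hp. apply HAD, HPA, Hp.
    + intros t Ht. rewrite HP0 by auto. apply Hpr.
    + intros t Ht. rewrite HP1 by auto. apply Hpr.
    + intros s Hs. destruct (HPs s Hs) as [-> ->]. split; apply Hpr.
Qed.

(** * Slice-preserving functions as complex functions *)

(** A stem with real components [F_1], [F_2] is the single complex function
    [F_1 + i F_2], and the values of [f] are those of [phi] read in the
    slices. *)
Definition complex_stem (D : C -> Prop) (phi : C -> C) (f : Quat -> Quat) :=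
  (forall z, D z -> phi (Cconj z) = Cconj (phi z)) /\
  (forall z, D z -> cdiff phi z) /\
  (forall z J, D z -> imag_unit J -> f (in_slice J z) = in_slice J (phi z)).

Lemma slice_regular_real_stem (D : C -> Prop) (f : Quat -> Quat) :
  slice_regular_real D f -> exists phi, complex_stem D phi f.
Proof.
  intros (F & Hstem & Hhol & Hreal & Hind).
  exists (fun z => (q_re (fst (F z)), q_re (snd (F z)))).
  split; [|split].
  - intros z Hz. rewrite (Hstem z Hz).
    destruct (Hreal z Hz) as (a & b & ->). reflexivity.
  - intros z Hz. destruct (Hhol q_re (or_introl eq_refl) z Hz) as [l Hl].
    exists l. now apply cderiv_is_derive.
  - intros [x y] J Hz HJ. unfold in_slice at 1. simpl.
    rewrite (Hind x y J Hz HJ). destruct (Hreal _ Hz) as (a & b & ->).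
    rewrite in_slice_eq. reflexivity.
Qed.

Lemma complex_stem_regular_real (D : C -> Prop) (phi : C -> C)
    (f : Quat -> Quat) :
  complex_stem D phi f -> slice_regular_real D f.
Proof.
  intros (Hsym & Hd & Hind).
  exists (fun z => (RtoQ (fst (phi z)), RtoQ (snd (phi z)))).
  split; [|split; [|split]].
  - intros z Hz. rewrite (Hsym z Hz). unfold QCconj, Cconj. simpl. f_equal.
    quat_ring.
  - intros c Hc z Hz.
    assert (H0 : @ex_derive C_AbsRing C_NormedModule (fun _ => RtoC 0) z)
      by (exists (RtoC 0); apply cderiv_is_derive; apply cderiv_const).
    destruct Hc as [<-|[<-|[<-|[<-|[]]]]]; try exact H0.
    destruct (Hd z Hz) as [l Hl]. exists l. apply cderiv_is_derive.
    revert Hl. apply cderiv_ext_loc. apply filter_forall. intros w.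
    simpl. now destruct (phi w).
  - intros z _. now exists (fst (phi z)), (snd (phi z)).
  - intros x y J Hz HJ. change (slice_point x y J) with (in_slice J (x, y)).
    rewrite Hind by auto. apply in_slice_eq.
Qed.

Lemma slice_regular_real_regular D f :
  slice_regular_real D f -> slice_regular D f.
Proof. intros (F & H1 & H2 & _ & H3). now exists F. Qed.

Definition slice_fun (phi : C -> C) (q : Quat) : Quat :=
  in_slice (direction q) (phi (to_C q)).

Lemma slice_fun_stem (D : C -> Prop) (phi : C -> C) :
  (forall z, D z -> phi (Cconj z) = Cconj (phi z)) ->
  (forall z, D z -> cdiff phi z) ->
  complex_stem D phi (slice_fun phi).
Proof.
  intros Hsym Hd. split; [exact Hsym|]. split; [exact Hd|].
  intros z J Hz HJ. unfold slice_fun.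
  set (q := in_slice J z). assert (E := in_slice_to_C q).
  assert (HK := imag_unit_direction q). set (K := direction q) in *.
  (* Either [K] and [J] agree, or they are opposite, or [z] is real. *)
  assert (EJ := im_norm_in_slice J z HJ). fold q in EJ.
  destruct (Req_dec (snd z) 0) as [Hy|Hy].
  - assert (Ez : Cconj z = z)
      by (destruct z as [x y]; simpl in Hy; subst y; unfold Cconj; simpl;
          f_equal; ring).
    assert (Et : to_C q = z).
    { destruct (to_C_in_slice J z HJ) as [H|H]; fold q in H; congruence. }
    rewrite Et. assert (Hreal := Hsym z Hz). rewrite Ez in Hreal.
    assert (Hs : snd (phi z) = 0).
    { apply (f_equal snd) in Hreal. simpl in Hreal. lra. }
    destruct (phi z) as [a b]. simpl in Hs. subst b.
    now rewrite !in_slice_real.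
  - assert (Hdir : forall w L, imag_unit L -> in_slice K w = in_slice L w ->
              snd w <> 0 -> K = L).
    { intros w L HL Ew Hw. rewrite !in_slice_coords in Ew by auto.
      unfold quat in Ew. injection Ew as e1 e2 e3.
      apply imag_unit_char in HL, HK.
      apply quat_eq; try lra; apply (Rmult_eq_reg_l (snd w)); auto. }
    destruct (to_C_in_slice J z HJ) as [H|H]; fold q in H; rewrite H in *.
    + now rewrite (Hdir z J HJ).
    + rewrite (Hdir (Cconj z) (- J)%Q (imag_unit_opp J HJ)).
      * rewrite Hsym by auto. apply in_slice_conj.
      * rewrite in_slice_conj. exact E.
      * simpl. lra.
Qed.

(** On each slice the quaternionic square is the complex one. *)
Lemma complex_stem_square (D : C -> Prop) (phi psi : C -> C)
    (h f : Quat -> Quat) :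
  complex_stem D phi h -> complex_stem D psi f ->
  (forall q, circ D q -> (f q * f q)%Q = h q) <->
  (forall z, D z -> (psi z * psi z)%C = phi z).
Proof.
  intros (_ & _ & Hh) (_ & _ & Hf). split.
  - intros H z Hz. apply (in_slice_inj I0); [apply imag_unit_I0|].
    rewrite <- in_slice_mult by apply imag_unit_I0.
    rewrite <- Hh, <- Hf by auto using imag_unit_I0. apply H.
    exists (fst z), (snd z), I0. split; [now destruct z|].
    split; [apply imag_unit_I0 | reflexivity].
  - intros H q Hq. destruct (circ_cases D q Hq) as (z & J & Hz & HJ & ->).
    rewrite Hf, Hh, in_slice_mult by auto. now rewrite H.
Qed.

(** The set where the function vanishes locally is open and closed in [D]. *)
Lemma not_locally_zero (D : C -> Prop) (phi : C -> C) :
  circular_domain D ->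
  (forall z, D z -> phi (Cconj z) = Cconj (phi z)) ->
  (forall z, D z -> cdiff phi z) ->
  (exists z, D z /\ phi z <> RtoC 0) ->
  forall z, D z -> exists n g, factors_at phi z n g /\ locally z (cdiff g).
Proof.
  intros HD Hsym Hd [z1 [Hz1 Hne]] z0 Hz0.
  assert (HO := circular_domain_open D HD).
  assert (Hc := proj1 HD).
  assert (Hdich : forall z, D z -> locally z (fun w => phi w = RtoC 0) \/
            exists n g, factors_at phi z n g /\ locally z (cdiff g)).
  { intros z Hz. apply order_dichotomy.
    generalize (HO z Hz). apply filter_imp. exact Hd. }
  destruct (Hdich z0 Hz0) as [H0|H0]; [exfalso|exact H0].
  set (S := fun z => D z /\ locally z (fun w => phi w = RtoC 0)).
  set (T := fun z => D z /\ ~ locally z (fun w => phi w = RtoC 0)).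
  assert (Hconj : forall z, D z -> locally z (fun w => phi w = RtoC 0) ->
            locally (Cconj z) (fun w => phi w = RtoC 0)).
  { intros z Hz H. generalize (locally_conj _ _ (filter_and _ _ (HO z Hz) H)).
    apply filter_imp. intros w [h1 h2].
    rewrite <- (Cconj_conj w), (Hsym _ h1), h2. unfold Cconj, RtoC. simpl.
    f_equal. ring. }
  destruct (circular_split D S T) as (z & [_ Hz] & [_ Hz']); auto.
  - intros z [Hz H]. split; auto.
  - intros z [Hz H]. split; auto. intros H'. apply H.
    rewrite <- (Cconj_conj z). apply Hconj; auto.
  - intros z [Hz H]. apply filter_and; [now apply HO|].
    now apply locally_locally.
  - intros z [Hz H]. destruct (Hdich z Hz) as [Hz0'|(n & g & Hg & Hgd)];
      [contradiction|].
    assert (Hgc := cdiff_near_continuous g z Hgd).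
    assert (Hiso := isolated_zero phi z n g Hg Hgc).
    generalize (filter_and _ _ (HO z Hz) Hiso). apply filter_imp.
    intros w [HDw Hw]. split; auto. intros Hw0.
    destruct (Ceq_dec w z) as [->|Hwz]; [contradiction|].
    apply (Hw Hwz). exact (locally_singleton w _ Hw0).
  - intros z [Hz _]; exact Hz.
  - intros z [Hz _]; exact Hz.
  - intros z Hz. destruct (classic (locally z (fun w => phi w = RtoC 0)));
      [left | right]; split; auto.
  - exists z0. split; auto.
  - exists z1. split; auto. intros H. apply Hne.
    exact (locally_singleton z1 _ H).
Qed.

(** * Multiplicities and orders *)

Lemma in_slice_sub_real (J : Quat) (z : C) (x : R) :
  (in_slice J z - RtoQ x)%Q = in_slice J (z - RtoC x)%C.
Proof. unfold in_slice, slice_point. quat_ring. Qed.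

Lemma in_slice_plus (J : Quat) (z w : C) :
  (in_slice J z + in_slice J w)%Q = in_slice J (z + w)%C.
Proof. unfold in_slice, slice_point. quat_ring. Qed.

Lemma in_slice_linear_pow (J : Quat) (z : C) (x : R) (n : nat) :
  imag_unit J ->
  ((in_slice J z - RtoQ x) ^ n)%Q = in_slice J ((z - RtoC x) ^ n)%C.
Proof. intros HJ. now rewrite in_slice_sub_real, in_slice_pow. Qed.

Lemma in_slice_quadratic_pow (J : Quat) (z : C) (x y : R) (m : nat) :
  imag_unit J ->
  (((in_slice J z - RtoQ x) ^ 2 + RtoQ y ^ 2) ^ m)%Q
  = in_slice J (((z - (x, y)) * (z - Cconj (x, y))) ^ m)%C.
Proof.
  intros HJ. rewrite in_slice_linear_pow, <- (in_slice_real J y) by auto.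
  rewrite !in_slice_pow, in_slice_plus, in_slice_pow by auto.
  f_equal. f_equal. destruct z as [a b].
  unfold Cconj, RtoC, Cminus, Cplus, Copp, Cmult, Cpow; simpl. f_equal; ring.
Qed.

Lemma real_conj_fixed (x : R) : Cconj (x, 0) = (x, 0).
Proof. unfold Cconj. simpl. f_equal. ring. Qed.

(** Division by a power of the real polynomial [P] that vanishes exactly at
    [z0] and its conjugate removes both zeros at once, symmetrically. *)
Lemma divide_out_zero (D : C -> Prop) (psi P u : C -> C) (z0 : C) n g :
  open D ->
  (forall z, D z -> psi (Cconj z) = Cconj (psi z)) ->
  (forall z, D z -> cdiff psi z) ->
  D z0 -> factors_at psi z0 n g -> locally z0 (cdiff g) ->
  (forall z, cdiff P z) -> (forall z, cdiff u z) ->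
  (forall z, P (Cconj z) = Cconj (P z)) ->
  (forall z, P z = RtoC 0 -> z = z0 \/ z = Cconj z0) ->
  (forall z, P z = ((z - z0) * u z)%C) -> u z0 <> RtoC 0 ->
  conj_invariant D ->
  exists gam,
    (forall z, D z -> gam (Cconj z) = Cconj (gam z)) /\
    (forall z, D z -> cdiff gam z) /\ gam z0 <> RtoC 0 /\
    (forall z, D z -> psi z = (P z ^ n * gam z)%C).
Proof.
  intros HO Hsym Hd Hz0 [Hfg Hg0] Hgd HPd Hud HPc HP0 HPu Hu0 Hc.
  set (v := (g z0 / u z0 ^ n)%C).
  set (gam := fun z => if Ceq_dec z z0 then v
                       else if Ceq_dec z (Cconj z0) then Cconj v
                       else (psi z / P z ^ n)%C).
  assert (Ez0 : gam z0 = v)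
    by (unfold gam; destruct Ceq_dec; [reflexivity|now elim n0]).
  assert (Eoff : forall z, z <> z0 -> z <> Cconj z0 ->
            gam z = (psi z / P z ^ n)%C).
  { intros z h1 h2. unfold gam. destruct Ceq_dec; [contradiction|].
    destruct Ceq_dec; [contradiction|reflexivity]. }
  assert (HPoff : forall z, z <> z0 -> z <> Cconj z0 -> P z <> RtoC 0).
  { intros z h1 h2 H. destruct (HP0 z H); contradiction. }
  assert (Hconjne : locally z0 (fun w => w <> z0 -> w <> Cconj z0)).
  { destruct (Ceq_dec z0 (Cconj z0)) as [E|E].
    - rewrite <- E. apply filter_forall. auto.
    - generalize (Clocally_neq (fun w => w) z0 _ (continuous_id z0) E).
      apply filter_imp. auto. }
  assert (Hu : locally z0 (fun w => u w <> RtoC 0))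
    by (apply Clocally_neq; auto; now apply cdiff_continuous).
  assert (Hnear : locally z0 (fun w => (g w / u w ^ n)%C = gam w)).
  { generalize (filter_and _ _ Hconjne (filter_and _ _ Hu Hfg)).
    apply filter_imp. intros w (h1 & h2 & h3).
    destruct (Ceq_dec w z0) as [->|Hw]; [now rewrite Ez0|].
    rewrite Eoff, h3, HPu, Cpow_mult_l by auto.
    assert (k1 := Cpow_nz _ n (Cminus_eq_contra _ _ Hw)).
    assert (k2 := Cpow_nz _ n h2). field; auto. }
  assert (Hgamd : cdiff gam z0).
  { apply cdiff_ext_loc with (1 := Hnear).
    apply cdiff_div; [exact (locally_singleton z0 _ Hgd)| |now apply Cpow_nz].
    now apply cdiff_pow. }
  assert (Hsymoff : forall z, D z -> z <> z0 -> z <> Cconj z0 ->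
            gam (Cconj z) = Cconj (gam z)).
  { intros z Hz h1 h2.
    rewrite !Eoff; auto.
    - rewrite Hsym, HPc, Cdiv_conj, Cpow_conj
        by (auto; now apply Cpow_nz, HPoff).
      reflexivity.
    - intros E. apply h2. rewrite <- E. now rewrite Cconj_conj.
    - intros E. apply h1. rewrite <- (Cconj_conj z), E. apply Cconj_conj. }
  (* At a real zero the symmetry of the cofactor follows by continuity. *)
  assert (Hsym0 : gam (Cconj z0) = Cconj (gam z0)).
  { destruct (Ceq_dec (Cconj z0) z0) as [E|E].
    - rewrite E.
      transitivity (Cconj (gam (Cconj z0))); [|now rewrite E].
      apply (continuous_agree gam (fun w => Cconj (gam (Cconj w)))).
      + now apply cdiff_continuous.
      + apply cdiff_continuous, cdiff_conj. now rewrite E.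
      + generalize (HO z0 Hz0). apply filter_imp. intros w HDw Hw.
        rewrite Hsymoff, Cconj_conj by (auto; now rewrite E). reflexivity.
    - unfold gam at 1. destruct Ceq_dec; [contradiction|].
      destruct Ceq_dec as [_|h]; [now rewrite Ez0 | now elim h]. }
  assert (Hgsym : forall z, D z -> gam (Cconj z) = Cconj (gam z)).
  { intros z Hz. destruct (Ceq_dec z z0) as [->|h1]; [exact Hsym0|].
    destruct (Ceq_dec z (Cconj z0)) as [->|h2]; [|auto].
    rewrite Hsym0, !Cconj_conj. reflexivity. }
  assert (Hfact0 : psi z0 = (P z0 ^ n * gam z0)%C).
  { rewrite (locally_singleton z0 _ Hfg), HPu, Cpow_mult_l, Ez0. unfold v.
    assert (k2 := Cpow_nz _ n Hu0). field; auto. }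
  exists gam. split; [exact Hgsym|]. split; [|split].
  - intros z Hz. destruct (Ceq_dec z z0) as [->|h1]; [exact Hgamd|].
    destruct (Ceq_dec z (Cconj z0)) as [->|h2].
    + apply cdiff_ext_loc with (fun w => Cconj (gam (Cconj w))).
      * generalize (HO _ Hz). apply filter_imp. intros w Hw.
        rewrite Hgsym by auto. apply Cconj_conj.
      * apply cdiff_conj. now rewrite Cconj_conj.
    + apply cdiff_ext_loc with (fun w => (psi w / P w ^ n)%C).
      * generalize (filter_and _ _
          (Clocally_neq (fun w => w) z _ (continuous_id z) h1)
          (Clocally_neq (fun w => w) z _ (continuous_id z) h2)).
        apply filter_imp. intros w [k1 k2]. symmetry. now apply Eoff.
      * apply cdiff_div; auto; [now apply cdiff_pow | now apply Cpow_nz, HPoff].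
  - rewrite Ez0. unfold v, Cdiv. apply Cmult_neq_0; auto.
    intros E. apply (Cpow_nz _ n Hu0).
    replace (u z0 ^ n)%C with (u z0 ^ n * (u z0 ^ n * / u z0 ^ n))%C
      by (field; now apply Cpow_nz).
    rewrite E. ring.
  - intros z Hz. destruct (Ceq_dec z z0) as [->|h1]; [exact Hfact0|].
    destruct (Ceq_dec z (Cconj z0)) as [->|h2].
    + rewrite Hsym, Hfact0, HPc, Hsym0, Cmult_conj, Cpow_conj by auto.
      reflexivity.
    + rewrite Eoff by auto. field. now apply Cpow_nz, HPoff.
Qed.

Lemma slice_fun_square_stem (D : C -> Prop) (gam : C -> C) :
  (forall z, D z -> gam (Cconj z) = Cconj (gam z)) ->
  (forall z, D z -> cdiff gam z) ->
  complex_stem D (fun z => gam z * gam z)%C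
    (slice_fun (fun z => gam z * gam z)%C).
Proof.
  intros Gsym Gd. apply slice_fun_stem; intros z Hz.
  - now rewrite Gsym, Cmult_conj.
  - apply cdiff_mult; auto.
Qed.

(** A square root [psi] of order [n] at a zero gives a factor [P ^ (2 * n)] of
    [phi] with a square as cofactor: real zeros of multiplicity [2 * n], and
    spheres of spherical multiplicity [2 * (2 * n)]. *)
Section Necessity.
Variables (D : C -> Prop) (h : Quat -> Quat) (phi psi : C -> C).
Hypothesis HD : circular_domain D.
Hypothesis Hh : complex_stem D phi h.
Hypothesis Hsym : forall z, D z -> psi (Cconj z) = Cconj (psi z).
Hypothesis Hd : forall z, D z -> cdiff psi z.
Hypothesis Hsq : forall z, D z -> (psi z * psi z)%C = phi z.

Let Hc : conj_invariant D := proj1 HD.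

Lemma root_nonneg_real (x : R) :
  circ D (RtoQ x) -> exists r, 0 <= r /\ h (RtoQ x) = RtoQ r.
Proof.
  intros Hx. rewrite <- (in_slice_real I0) in Hx |- *.
  apply circ_in_slice in Hx; auto using imag_unit_I0.
  destruct Hh as (_ & _ & Hind). rewrite Hind by auto using imag_unit_I0.
  rewrite <- Hsq by auto.
  assert (Hs := Hsym _ Hx). rewrite real_conj_fixed in Hs.
  destruct (psi (x, 0)) as [a b]. apply (f_equal snd) in Hs. simpl in Hs.
  assert (b = 0) by lra. subst b.
  exists (a * a). split; [nra|].
  rewrite <- (in_slice_real I0). f_equal.
  unfold Cmult; simpl. f_equal; ring.
Qed.

Hypothesis Hne : exists z, D z /\ psi z <> RtoC 0.

Lemma root_real_zero (x : R) : D (x, 0) ->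
  exists n, real_isolated_multiplicity D h x n /\ Nat.Even n.
Proof.
  intros Hx. assert (HO := circular_domain_open D HD).
  destruct (not_locally_zero D psi HD Hsym Hd Hne _ Hx) as (n & g & Hg & Hgd).
  destruct (divide_out_zero D psi (fun z => z - RtoC x)%C (fun _ => RtoC 1)
              (x, 0) n g) as (gam & Gsym & Gd & G0 & Gfac); auto.
  - intros z. apply cdiff_sub.
  - intros z. apply cdiff_const.
  - intros z. rewrite Cminus_conj. f_equal. unfold Cconj, RtoC. simpl.
    f_equal. ring.
  - intros z Hz. left. apply Ceq_minus. exact Hz.
  - intros z. change (x, 0) with (RtoC x). ring.
  - exact C1_nz.
  - exists (2 * n)%nat. split; [|now exists n]. split.
    + rewrite <- (in_slice_real I0).
      apply circ_in_slice; auto using imag_unit_I0.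
    + assert (Hst := slice_fun_square_stem D gam Gsym Gd).
      exists (slice_fun (fun z => gam z * gam z)%C). split; [|split].
      * apply slice_regular_real_regular.
        now apply complex_stem_regular_real with (1 := Hst).
      * destruct Hst as (_ & _ & Hst). rewrite <- (in_slice_real I0), Hst
          by auto using imag_unit_I0.
        rewrite in_slice_eq_0 by apply imag_unit_I0. now apply Cmult_neq_0.
      * intros q Hq. destruct (circ_cases D q Hq) as (z & J & Hz & HJ & ->).
        destruct Hst as (_ & _ & Hst), Hh as (_ & _ & Hind).
        rewrite in_slice_linear_pow, Hst, Hind, in_slice_mult by auto.
        f_equal. rewrite <- Hsq, Gfac by auto.
        replace (2 * n)%nat with (n + n)%nat by lia. rewrite Cpow_add_r. ring.
Qed.

Lemma root_sphere_multiplicity (x y : R) : D (x, y) -> y <> 0 ->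
  exists mu, spherical_multiplicity D h x y mu /\ Nat.divide 4 mu.
Proof.
  intros Hz0 Hy. assert (HO := circular_domain_open D HD).
  set (z0 := (x, y) : C) in *.
  destruct (not_locally_zero D psi HD Hsym Hd Hne _ Hz0) as (n & g & Hg & Hgd).
  destruct (divide_out_zero D psi (fun z => (z - z0) * (z - Cconj z0))%C
              (fun z => z - Cconj z0)%C z0 n g)
    as (gam & Gsym & Gd & G0 & Gfac);
    auto.
  - intros z. apply cdiff_mult; apply cdiff_sub.
  - intros z. apply cdiff_sub.
  - intros z. rewrite Cmult_conj, !Cminus_conj, Cconj_conj. ring.
  - intros z Hz. destruct (Ceq_dec z z0) as [E|E]; [now left|right].
    apply Ceq_minus. apply NNPP. intros E'.
    apply (Cmult_neq_0 _ _ (Cminus_eq_contra _ _ E) E' Hz).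
  - apply Cminus_eq_contra. intros E. apply (f_equal snd) in E. simpl in E. lra.
  - exists (2 * (2 * n))%nat. split; [|exists n; lia].
    assert (Hst := slice_fun_square_stem D gam Gsym Gd).
    split; [exact Hy|]. split.
    + intros q (J & HJ & ->). now apply (circ_in_slice D J z0).
    + exists (2 * n)%nat, nil, (slice_fun (fun z => gam z * gam z)%C),
        (slice_fun (fun z => gam z * gam z)%C).
      split; [reflexivity|]. split; [intros p []|].
      split; [intros l Hl; simpl in Hl; lia|]. split; [|split; [|split]].
      * apply slice_regular_real_regular.
        now apply complex_stem_regular_real with (1 := Hst).
      * intros q (J & HJ & ->). change (slice_point x y J) with (in_slice J z0).
        destruct Hst as (_ & _ & Hst). rewrite Hst by auto.
        rewrite in_slice_eq_0 by auto. now apply Cmult_neq_0.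
      * intros q Hq. reflexivity.
      * intros q Hq. destruct (circ_cases D q Hq) as (z & J & Hz & HJ & ->).
        destruct Hst as (_ & _ & Hst), Hh as (_ & _ & Hind).
        rewrite in_slice_quadratic_pow, Hst, Hind, in_slice_mult by auto.
        f_equal. rewrite <- Hsq, Gfac by auto. fold z0.
        replace (2 * n)%nat with (n + n)%nat by lia. rewrite Cpow_add_r. ring.
Qed.

Lemma root_sphere_isolated (x y : R) : D (x, y) -> phi (x, y) = RtoC 0 ->
  isolated_zero_sphere (circ D) h x y.
Proof.
  intros Hz0 E0. assert (HO := circular_domain_open D HD).
  set (z0 := (x, y) : C) in *. destruct Hh as (Hpsym & _ & Hind). split.
  - intros q (J & HJ & ->). change (slice_point x y J) with (in_slice J z0).
    split; [now apply circ_in_slice|]. rewrite Hind, E0 by auto.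
    now apply in_slice_eq_0.
  - destruct (not_locally_zero D psi HD Hsym Hd Hne _ Hz0)
      as (n & g & Hg & Hgd).
    assert (Hgc := cdiff_near_continuous g z0 Hgd).
    assert (Hiso := isolated_zero psi z0 n g Hg Hgc).
    set (V := fun w => locally w (fun w => w <> z0 -> psi w <> RtoC 0)).
    assert (HV : open V) by (intros w Hw; apply locally_locally, Hw).
    set (W := fun w => V w \/ V (Cconj w)).
    assert (HWo : open W).
    { apply open_or; [exact HV|]. apply open_comp; [|exact HV].
      intros w _. apply Cconj_continuous. }
    assert (HWc : conj_invariant W).
    { intros w [H|H]; [right|left; exact H]. now rewrite Cconj_conj. }
    exists (circ W). split; [now apply open_circ|]. split.
    + intros q (J & HJ & ->). apply (circ_in_slice W J z0); auto. now left.
    + intros q HqW [Hq Hq0].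
      destruct (circ_cases D q Hq) as (w & J & Hw & HJ & ->).
      apply circ_in_slice in HqW; auto.
      rewrite Hind in Hq0 by auto. apply in_slice_eq_0 in Hq0; auto.
      assert (Hzero : forall w, D w -> V w -> phi w = RtoC 0 -> w = z0).
      { intros v Hv HVv Ev. destruct (Ceq_dec v z0) as [E|E]; [exact E|exfalso].
        rewrite <- Hsq in Ev by auto.
        assert (Hn := locally_singleton v _ HVv E).
        now apply (Cmult_neq_0 _ _ Hn Hn). }
      destruct HqW as [H|H].
      * exists J. split; auto. now rewrite (Hzero w Hw H Hq0).
      * exists (- J)%Q. split; [now apply imag_unit_opp|].
        change (slice_point x y (- J)%Q) with (in_slice (- J)%Q z0).
        rewrite <- (Hzero (Cconj w)); auto.
        -- symmetry. apply in_slice_conj.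
        -- rewrite Hpsym, Hq0 by auto. unfold Cconj, RtoC. simpl. f_equal. ring.
Qed.

End Necessity.

(** A factorization of a slice-preserving function whose cofactor has a stem
    with arbitrary quaternionic values: the cofactor is scalar off the zeros,
    hence, by continuity, also at them. *)
Lemma scalar_cofactor (phi P : C -> C) (p r : C -> Quat) (z : C) :
  continuous phi z -> continuous P z -> qcont p z -> qcont r z ->
  locally z (fun w => w <> z -> P w <> RtoC 0 /\ forall J, imag_unit J ->
    in_slice J (phi w) = (in_slice J (P w) * (p w + J * r w))%Q) ->
  (p z <> RtoQ 0 \/ r z <> RtoQ 0) ->
  exists gam, continuous gam z /\ gam z <> RtoC 0 /\
    locally z (fun w => phi w = (P w * gam w)%C).
Proof.
  intros Hphi HP (P1 & P2 & P3 & P4) (R1 & R2 & R3 & R4) Hloc Hne.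
  assert (Hoff : locally z (fun w => w <> z ->
            p w = RtoQ (fst (phi w / P w)%C) /\
            r w = RtoQ (snd (phi w / P w)%C) /\ P w <> RtoC 0)).
  { revert Hloc. apply filter_imp. intros w Hw Hwz.
    destruct (Hw Hwz) as [HP0 E].
    assert (Hst : p w = RtoQ (fst (phi w / P w)%C)
                  /\ r w = RtoQ (snd (phi w / P w)%C)).
    { apply stem_unique. intros J HJ. rewrite <- in_slice_eq.
      transitivity (in_slice J (/ P w)%C
                    * (in_slice J (P w) * (p w + J * r w)))%Q.
      - rewrite Qmult_assoc, in_slice_mult, Cinv_l by auto.
        unfold RtoC. rewrite in_slice_real. quat_ring.
      - rewrite <- E by auto. rewrite in_slice_mult by auto. f_equal.
        unfold Cdiv. ring. }
    destruct Hst. auto. }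
  set (co := fun (c : Quat -> R) w => (c (p w), c (r w)) : C).
  assert (Hco : forall c, continuous (fun w => c (p w)) z ->
            continuous (fun w => c (r w)) z -> continuous (co c) z)
    by (intros c h1 h2; now apply Ccont_pair).
  assert (Hvan : forall c, continuous (co c) z ->
            (forall a, c (RtoQ a) = 0) -> co c z = RtoC 0).
  { intros c Hcc Hc0. apply (continuous_agree (co c) (fun _ => RtoC 0)); auto.
    - apply continuous_const.
    - revert Hoff. apply filter_imp. intros w Hw Hwz.
      destruct (Hw Hwz) as (E1 & E2 & _). unfold co. rewrite E1, E2, !Hc0.
      reflexivity. }
  assert (Hfac : locally z (fun w => w <> z -> phi w = (P w * co q_re w)%C)).
  { revert Hoff. apply filter_imp. intros w Hw Hwz.
    destruct (Hw Hwz) as (E1 & E2 & HP0). unfold co. rewrite E1, E2.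
    replace (q_re (RtoQ (fst (phi w / P w)%C)),
             q_re (RtoQ (snd (phi w / P w)%C)))
      with (phi w / P w)%C by (now destruct (phi w / P w)%C).
    field. exact HP0. }
  assert (Hre : continuous (co q_re) z) by now apply Hco.
  exists (co q_re). split; [exact Hre|]. split.
  - intros E0.
    assert (Ei := Hvan q_i (Hco _ P2 R2) (fun _ => eq_refl)).
    assert (Ej := Hvan q_j (Hco _ P3 R3) (fun _ => eq_refl)).
    assert (Ek := Hvan q_k (Hco _ P4 R4) (fun _ => eq_refl)).
    unfold co, RtoC in *. injection E0 as ? ?. injection Ei as ? ?.
    injection Ej as ? ?. injection Ek as ? ?.
    destruct Hne as [Hn|Hn]; apply Hn; apply quat_eq; assumption.
  - assert (Ez : phi z = (P z * co q_re z)%C).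
    { apply (continuous_agree phi (fun w => P w * co q_re w)%C); auto.
      now apply Ccont_mult. }
    revert Hfac. apply filter_imp. intros w Hw.
    destruct (Ceq_dec w z) as [->|E]; auto.
Qed.

(** A stem [p + i r] of [k] of which only continuity is recorded: the factors
    of a star product are not assumed to be holomorphic. *)
Definition quat_stem (D : C -> Prop) (p r : C -> Quat) (k : Quat -> Quat) :=
  (forall z, D z -> qcont p z /\ qcont r z) /\
  (forall z J, D z -> imag_unit J -> k (in_slice J z) = (p z + J * r z)%Q).

Lemma stem_value_neq0 (p r J : Quat) :
  (p + J * r)%Q <> RtoQ 0 -> p <> RtoQ 0 \/ r <> RtoQ 0.
Proof.
  intros H. apply NNPP. intros Hn. apply H.
  assert (Ep : p = RtoQ 0) by (apply NNPP; tauto).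
  assert (Er : r = RtoQ 0) by (apply NNPP; tauto).
  rewrite Ep, Er. quat_ring.
Qed.

Lemma slice_regular_stem (D : C -> Prop) (g : Quat -> Quat) :
  slice_regular D g -> exists p r, quat_stem D p r g.
Proof.
  intros (G & _ & Hhol & Hind).
  exists (fun z => fst (G z)), (fun z => snd (G z)). split.
  - intros z Hz.
    assert (H : forall c, In c (q_re :: q_i :: q_j :: q_k :: nil) ->
              continuous (fun w => c (fst (G w))) z /\
              continuous (fun w => c (snd (G w))) z).
    { intros c Hc. destruct (Hhol c Hc z Hz) as [l Hl].
      apply cderiv_is_derive in Hl.
      assert (Hcont := cdiff_continuous _ z (ex_intro _ l Hl)). split.
      - exact (Ccont_fst _ z Hcont).
      - exact (Ccont_snd _ z Hcont). }
    assert (H1 := H q_re ltac:(simpl; auto)).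
    assert (H2 := H q_i ltac:(simpl; auto)).
    assert (H3 := H q_j ltac:(simpl; auto)).
    assert (H4 := H q_k ltac:(simpl; auto)).
    split; (split; [|split; [|split]]); tauto.
  - intros [x y] J Hz HJ. exact (Hind x y J Hz HJ).
Qed.

Lemma Qconj_slice (x y : R) (J : Quat) : imag_unit J ->
  Qconj (slice_point x y J) = slice_point x y (- J)%Q.
Proof.
  intros HJ. apply imag_unit_char in HJ. destruct HJ as [HJ _].
  destruct J as [[[a b] c] d]. unfold q_re in HJ; simpl in HJ. subst a.
  quat_ring.
Qed.

Lemma RtoQ_neq0 (y : R) : y <> 0 -> RtoQ y <> RtoQ 0.
Proof. intros Hy E. apply (f_equal q_re) in E. cbn in E. contradiction. Qed.

(** The stem of [(q - p_1) * ... * (q - p_n) * g] does not vanish at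
    [z0 = x + i y].  With [p_l = x + y J_l], the stem [p + i r] of a partial
    product starting with [q - p_l] satisfies [r = J_l p] at [z0], and one
    more factor multiplies [p] by [- y (J + J_l)], which is nonzero because
    successive points are not conjugate.  The innermost factor gives a nonzero
    [p] because [g] has no zero on the sphere. *)
Lemma star_linear_stem (D : C -> Prop) (x y : R) (g : Quat -> Quat) :
  D (x, y) -> y <> 0 -> slice_regular D g ->
  (forall q, sphere x y q -> g q <> RtoQ 0) ->
  forall (ps : list Quat) (k : Quat -> Quat),
  (forall p, In p ps -> sphere x y p) ->
  (forall l : nat, (S l < length ps)%nat ->
     nth l ps (RtoQ 0) <> Qconj (nth (S l) ps (RtoQ 0))) ->
  is_star_linear D ps g k ->
  exists p r, quat_stem D p r k /\
    match ps with
    | nil => forall J, imag_unit J -> (p (x, y) + J * r (x, y))%Q <> RtoQ 0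
    | p1 :: _ => forall J, imag_unit J -> p1 = slice_point x y J ->
        p (x, y) <> RtoQ 0 /\ r (x, y) = (J * p (x, y))%Q
    end.
Proof.
  intros Hz0 Hy Hg Hg0. induction ps as [|p1 ps IH]; intros k Hps Halt Hk.
  - destruct (slice_regular_stem D g Hg) as (p & r & Hc & Hi).
    assert (Hk' : forall z J, D z -> imag_unit J ->
              k (in_slice J z) = (p z + J * r z)%Q).
    { intros z J Hz HJ. rewrite <- Hi by auto. apply Hk.
      exists (fst z), (snd z), J. destruct z; auto. }
    exists p, r. split; [now split|].
    intros J HJ. rewrite <- (Hi (x, y)) by auto. apply Hg0. now exists J.
  - destruct Hk as (k' & Hk' & F & G & _ & _ & HF & HG & HFG).
    destruct (IH k') as (p' & r' & [Hc' Hi'] & Hlast); auto.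
    { intros p Hp. apply Hps. now right. }
    { intros l Hl. apply (Halt (S l)). simpl. lia. }
    clear IH Hk'.
    set (p := fun z : C =>
      ((RtoQ (fst z) - p1) * p' z - RtoQ (snd z) * r' z)%Q).
    set (r := fun z : C =>
      ((RtoQ (fst z) - p1) * r' z + RtoQ (snd z) * p' z)%Q).
    exists p, r. split; [split|].
    + intros z Hz. destruct (Hc' z Hz) as [Hp' Hr'].
      assert (H1 : qcont (fun z : C => RtoQ (fst z) - p1)%Q z).
      { apply qcont_minus; [|apply qcont_const].
        apply qcont_RtoQ, continuous_fst. }
      assert (H2 : qcont (fun z : C => RtoQ (snd z)) z)
        by (apply qcont_RtoQ, continuous_snd).
      split; [apply qcont_minus | apply qcont_plus]; now apply qcont_mult.
    + intros [a b] J Hz HJ.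
      change (in_slice J (a, b)) with (slice_point a b J).
      rewrite (HFG a b J Hz HJ).
      assert (EF : fst (F (a, b)) = (RtoQ a - p1)%Q
                   /\ snd (F (a, b)) = RtoQ b).
      { apply stem_unique. intros K HK. rewrite <- (HF a b K Hz HK).
        unfold slice_point. quat_ring. }
      assert (EG : fst (G (a, b)) = p' (a, b) /\ snd (G (a, b)) = r' (a, b)).
      { apply stem_unique. intros K HK. rewrite <- (HG a b K Hz HK).
        exact (Hi' (a, b) K Hz HK). }
      unfold QCmult. simpl fst; simpl snd.
      destruct EF as [-> ->], EG as [-> ->]. reflexivity.
    + intros J HJ ->.
      set (P' := p' (x, y)) in *. set (R' := r' (x, y)) in *.
      assert (Ep : p (x, y) = (RtoQ (- y) * (J * P' + R'))%Q).
      { unfold p. simpl fst; simpl snd. fold P' R'. unfold slice_point.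
        quat_ring. }
      assert (Er : r (x, y) = (RtoQ y * (P' - J * R'))%Q).
      { unfold r. simpl fst; simpl snd. fold P' R'. unfold slice_point.
        quat_ring. }
      split.
      * rewrite Ep. intros E. apply Qmult_eq_0 in E.
        destruct E as [E|E]; [revert E; apply RtoQ_neq0; lra|].
        destruct ps as [|p2 ps].
        -- apply (Hlast (- J)%Q (imag_unit_opp J HJ)).
           transitivity (- (J * (J * P' + R')))%Q.
           ++ transitivity (- (J * (J * P')) - J * R')%Q; [|quat_ring].
              rewrite imag_unit_square by auto. quat_ring.
           ++ rewrite E. quat_ring.
        -- destruct (Hps p2 ltac:(simpl; auto)) as (J2 & HJ2 & E2).
           destruct (Hlast J2 HJ2 E2) as [HP' ER'].
           assert (E3 : ((J + J2) * P')%Q = RtoQ 0).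
           { rewrite <- E, ER'. quat_ring. }
           apply Qmult_eq_0 in E3. destruct E3 as [E3|E3]; [|contradiction].
           apply (Halt 0%nat); [simpl; lia|]. simpl nth.
           rewrite E2, Qconj_slice by auto. f_equal.
           replace J with ((J + J2) - J2)%Q by quat_ring. rewrite E3. quat_ring.
      * rewrite Ep, Er.
        transitivity (RtoQ (- y) * (J * (J * P') + J * R'))%Q; [|quat_ring].
        rewrite imag_unit_square by auto. quat_ring.
Qed.

Lemma even_order_conj (D : C -> Prop) (phi : C -> C) (z : C) :
  open D -> D z -> (forall z, D z -> phi (Cconj z) = Cconj (phi z)) ->
  even_order phi z -> even_order phi (Cconj z).
Proof.
  intros HO Hz Hsym (k & g & [Hg Hg0] & Hgc).
  exists k, (fun w => Cconj (g (Cconj w))). split; [split|].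
  - generalize (locally_conj _ _ (filter_and _ _ (HO z Hz) Hg)).
    apply filter_imp. intros w [H1 H2].
    rewrite <- (Cconj_conj w) at 1. rewrite Hsym, H2 by auto.
    rewrite Cmult_conj, Cpow_conj, Cminus_conj, Cconj_conj. reflexivity.
  - rewrite Cconj_conj. intros E. apply Hg0.
    rewrite <- (Cconj_conj (g z)), E. unfold Cconj, RtoC. simpl. f_equal. ring.
  - apply (continuous_comp (fun w => g (Cconj w)) Cconj).
    + apply (continuous_comp Cconj g).
      * apply Cconj_continuous.
      * now rewrite Cconj_conj.
    + apply Cconj_continuous.
Qed.

Lemma real_multiplicity_order (D : C -> Prop) (h : Quat -> Quat) (phi : C -> C)
    (x : R) (n : nat) :
  open D -> conj_invariant D -> complex_stem D phi h ->
  real_isolated_multiplicity D h x n ->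
  exists g, factors_at phi (x, 0) n g /\ continuous g (x, 0).
Proof.
  intros HO Hc (_ & Hd & Hind) (Hx & g & Hg & Hg0 & Hfac).
  rewrite <- (in_slice_real I0) in Hx, Hg0.
  apply circ_in_slice in Hx; auto using imag_unit_I0.
  destruct (slice_regular_stem D g Hg) as (p & r & Hpr & Hi).
  destruct (Hpr _ Hx) as [Hp Hr].
  destruct (scalar_cofactor phi (fun w => (w - (x, 0)) ^ n)%C p r (x, 0))
    as (gam & G1 & G2 & G3); auto.
  - apply cdiff_continuous, Hd, Hx.
  - apply Ccont_pow, Ccont_sub.
  - generalize (HO _ Hx). apply filter_imp. intros w Hw Hwx. split.
    + now apply Cpow_nz, Cminus_eq_contra.
    + intros J HJ. rewrite <- Hind, <- Hi by auto. rewrite Hfac.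
      * now rewrite in_slice_linear_pow.
      * now apply circ_in_slice.
  - rewrite Hi in Hg0 by auto using imag_unit_I0.
    exact (stem_value_neq0 _ _ _ Hg0).
  - exists gam. split; [split|]; auto.
Qed.

(** The isolated factors contribute nothing to the order of [phi] at [z0]: the
    stem of their product with [g] is nonzero there, and it is scalar because
    [phi] is. *)
Lemma spherical_multiplicity_order (D : C -> Prop) (h : Quat -> Quat)
    (phi : C -> C) (x y : R) (mu : nat) :
  open D -> conj_invariant D -> complex_stem D phi h ->
  spherical_multiplicity D h x y mu ->
  D (x, y) /\ exists m g, mu = (2 * m)%nat /\
    factors_at phi (x, y) m g /\ continuous g (x, y).
Proof.
  intros HO Hc (_ & Hd & Hind)
    (Hy & Hsph & m & ps & g & k & Hmu & Hps & Halt & Hg & Hg0 & Hk & Hfac).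
  set (z0 := (x, y) : C).
  assert (Hz0 : D z0).
  { apply (circ_in_slice D I0); auto using imag_unit_I0. apply Hsph.
    exists I0. split; [apply imag_unit_I0 | reflexivity]. }
  split; [exact Hz0|].
  destruct (star_linear_stem D x y g Hz0 Hy Hg Hg0 ps k Hps Halt Hk)
    as (p & r & [Hpr Hi] & Hlast).
  destruct (Hpr _ Hz0) as [Hp Hr].
  set (u := fun w => (w - Cconj z0)%C).
  assert (Hu0 : u z0 <> RtoC 0).
  { apply Cminus_eq_contra. intros E. apply (f_equal snd) in E.
    simpl in E. lra. }
  assert (Huc : continuous u z0)
    by apply Ccont_sub.
  destruct (scalar_cofactor phi (fun w => ((w - z0) * u w) ^ m)%C p r z0)
    as (gam & G1 & G2 & G3); auto.
  - apply cdiff_continuous, Hd, Hz0.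
  - apply Ccont_pow, Ccont_mult; auto. apply Ccont_sub.
  - generalize (filter_and _ _ (HO _ Hz0) (Clocally_neq u z0 _ Huc Hu0)).
    apply filter_imp. intros w [Hw Huw] Hwz. split.
    + apply Cpow_nz, Cmult_neq_0; auto. now apply Cminus_eq_contra.
    + intros J HJ. rewrite <- Hind, <- Hi by auto. rewrite Hfac.
      * now rewrite in_slice_quadratic_pow.
      * now apply circ_in_slice.
  - destruct ps as [|p1 ps].
    + exact (stem_value_neq0 _ _ _ (Hlast _ imag_unit_I0)).
    + left. destruct (Hps p1 ltac:(simpl; auto)) as (J & HJ & E).
      now destruct (Hlast J HJ E).
  - exists m, (fun w => u w ^ m * gam w)%C. split; [exact Hmu|].
    split; [split|].
    + revert G3. apply filter_imp. intros w ->. rewrite Cpow_mult_l. ring.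
    + apply Cmult_neq_0; auto. now apply Cpow_nz.
    + apply Ccont_mult; auto. now apply Ccont_pow.
Qed.

(** * Symmetric square roots *)

(** A square root of a symmetric function agrees with its own reflection up to
    a sign that is constant on [D] in the sense of [circular_split].  A real
    point where [phi] is positive forces the sign [+]; without real points the
    root on the upper half of [D] is reflected to the lower half. *)
Lemma symmetric_sqrt (D : C -> Prop) (phi psi : C -> C) :
  circular_domain D ->
  (forall z, D z -> phi (Cconj z) = Cconj (phi z)) ->
  (forall z, D z -> exists n g, factors_at phi z n g /\ continuous g z) ->
  (forall x, D (x, 0) -> exists r, 0 <= r /\ phi (x, 0) = RtoC r) ->
  (forall z, D z -> cdiff psi z) ->
  (forall z, D z -> (psi z * psi z)%C = phi z) ->
  exists chi,
    (forall z, D z -> chi (Cconj z) = Cconj (chi z)) /\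
    (forall z, D z -> cdiff chi z) /\
    (forall z, D z -> (chi z * chi z)%C = phi z).
Proof.
  intros HD Hpsym Hord Hpos Hd Hsq.
  assert (HO := circular_domain_open D HD). assert (Hc := proj1 HD).
  set (psi' := fun z => Cconj (psi (Cconj z))).
  assert (Hd' : forall z, D z -> cdiff psi' z)
    by (intros z Hz; apply cdiff_conj, Hd, Hc, Hz).
  assert (Hsq' : forall z, D z -> (psi' z * psi' z)%C = phi z).
  { intros z Hz. unfold psi'.
    rewrite <- Cmult_conj, Hsq, Hpsym, Cconj_conj by auto. reflexivity. }
  destruct (classic (exists x, D (x, 0))) as [[x0 Hx0]|Hno].
  -
    (* The signs + and - each hold on an open symmetric set. *)
    set (S := fun b z => D z /\ locally z (fun w => psi w = csign b (psi' w))).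
    assert (HSo : forall b, open (S b)).
    { intros b z [Hz H]. apply filter_and; [now apply HO|].
      now apply locally_locally. }
    assert (HSc : forall b, conj_invariant (S b)).
    { intros b z [Hz H]. split; [now apply Hc|].
      generalize (locally_conj _ _ H). apply filter_imp. intros w E.
      unfold psi' in *. rewrite Cconj_conj in E. rewrite E.
      destruct b; simpl; rewrite ?Copp_conj, !Cconj_conj; [ring|reflexivity]. }
    assert (Hcov : forall z, D z -> S false z \/ S true z).
    { intros z Hz.
      destruct (roots_agree psi psi' z) as [H|H].
      - generalize (HO z Hz). apply filter_imp. auto.
      - generalize (HO z Hz). apply filter_imp. auto.
      - generalize (HO z Hz). apply filter_imp. intros w Hw.
        now rewrite Hsq, Hsq'.
      - left. now split.
      - right. now split. }
    destruct (Hord _ Hx0) as (n & g & Hg & Hgc).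
    destruct (punctured_point (x0, 0) _
                (filter_and _ _ (HO _ Hx0) (isolated_zero phi _ n g Hg Hgc)))
      as ([x y] & Hw & Ey & HDw & Hphi).
    simpl in Ey. subst y. specialize (Hphi Hw).
    assert (HSx : S false (x, 0)).
    { destruct (Hcov _ HDw) as [H|[_ H]]; [exact H|exfalso].
      assert (E := locally_singleton _ _ H). unfold psi' in E.
      rewrite real_conj_fixed in E. simpl in E.
      destruct (Hpos x HDw) as (s & Hs & Es).
      assert (E2 := Hsq _ HDw). rewrite Es in E2.
      apply Hphi. rewrite Es.
      destruct (psi (x, 0)) as [a b]. unfold Cconj, Copp in E. simpl in E.
      injection E as Ea.
      assert (Ea0 : a = 0) by lra. subst a.
      unfold Cmult, RtoC in E2. simpl in E2. injection E2 as E2 _.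
      f_equal. nra. }
    assert (Hplus : forall z, D z -> S false z).
    { intros z1 Hz1. destruct (Hcov z1 Hz1) as [H|H]; [exact H|exfalso].
      destruct (circular_split D (S false) (S true)) as (z & [Hz H1] & [_ H2]);
        auto.
      - intros z [Hz _]; exact Hz.
      - intros z [Hz _]; exact Hz.
      - now exists (x, 0).
      - now exists z1.
      - destruct (Hord z Hz) as (k & g' & Hg' & Hgc').
        apply (factors_not_zero phi z k g' Hg' Hgc').
        generalize (filter_and _ _ (HO z Hz) (filter_and _ _ H1 H2)).
        apply filter_imp. intros w (Hw' & E1 & E2). simpl in E1, E2.
        rewrite <- Hsq by auto.
        replace (psi w * psi w)%C with (psi w * (psi w + psi w) / RtoC 2)%C
          by field.
        rewrite E1 at 2. rewrite E2 at 2. field. }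
    exists psi. split; [|split; assumption].
    intros z Hz. destruct (Hplus _ Hz) as [_ H].
    assert (E := locally_singleton z _ H). simpl in E. unfold psi' in E.
    rewrite E. now rewrite Cconj_conj.
  - assert (Him : forall z, D z -> snd z <> 0).
    { intros [x y] Hz E. simpl in E. subst y. apply Hno. now exists x. }
    exists (fun z => if Rlt_dec 0 (snd z) then psi z else psi' z).
    split; [|split].
    + intros z Hz. assert (Hy := Him z Hz). simpl snd.
      destruct (Rlt_dec 0 (snd z)) as [h|h], (Rlt_dec 0 (- snd z)) as [h'|h'];
        try lra; unfold psi'; rewrite ?Cconj_conj; reflexivity.
    + intros z Hz. assert (Hy := Him z Hz).
      assert (Hside : forall s, s * snd z > 0 ->
                locally z (fun w : C => s * snd w > 0)).
      { intros s Hs.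
        assert (Hcs : continuous (fun w : C => s * snd w) z)
          by (apply Rcont_mult;
              [apply continuous_const | apply continuous_snd]).
        apply (Hcs (fun t => t > 0)).
        exists (mkposreal _ Hs). intros t Ht.
        change (Rabs (t - s * snd z) < s * snd z) in Ht.
        apply Rabs_def2 in Ht. lra. }
      destruct (Rlt_dec 0 (snd z)) as [h|h].
      * apply cdiff_ext_loc with psi; [|now apply Hd].
        generalize (Hside 1 ltac:(lra)). apply filter_imp. intros w Hw.
        destruct Rlt_dec as [_|k]; [reflexivity|elim k; lra].
      * apply cdiff_ext_loc with psi'; [|now apply Hd'].
        generalize (Hside (-1) ltac:(lra)). apply filter_imp. intros w Hw.
        destruct Rlt_dec as [k|_]; [exfalso; lra|reflexivity].
    + intros z Hz. destruct Rlt_dec; auto.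
Qed.

(** * The criterion *)

Theorem proposition1p6 :
  forall D : C -> Prop,
  circular_domain D ->
  (exists q, circ D q) ->
  (exists I : Quat, imag_unit I /\
     forall q, plane_section (circ D) I q ->
       simply_connected (component (plane_section (circ D) I) q)) ->
  forall h : Quat -> Quat,
  slice_regular_real D h ->
  (exists q, circ D q /\ h q <> RtoQ 0) ->
  (exists f : Quat -> Quat,
     slice_regular_real D f /\
     forall q, circ D q -> (f q * f q)%Q = h q)
  <->
  ((forall q, zero_of (circ D) h q ->
      (exists (x : R) (n : nat),
         q = RtoQ x /\ real_isolated_multiplicity D h x n /\ Nat.Even n)
      \/
      (exists (x y : R) (mu : nat),
         y <> 0 /\ sphere x y q /\
         isolated_zero_sphere (circ D) h x y /\
         spherical_multiplicity D h x y mu /\ Nat.divide 4 mu))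
   /\
   ((exists x : R, circ D (RtoQ x)) ->
    forall x : R, circ D (RtoQ x) ->
      exists r : R, 0 <= r /\ h (RtoQ x) = RtoQ r)).
Proof.
  intros D HD _ (I & HI & Hsc) h Hreal (q1 & Hq1 & Hne).
  assert (HO := circular_domain_open D HD). assert (Hc := proj1 HD).
  destruct (slice_regular_real_stem D h Hreal) as [phi Hphi].
  assert (Hphi' := Hphi). destruct Hphi' as (Hsym & Hd & Hind).
  assert (Hphine : exists z, D z /\ phi z <> RtoC 0).
  { destruct (circ_cases D q1 Hq1) as (z & J & Hz & HJ & ->).
    exists z. split; auto. intros E. apply Hne. rewrite Hind, E by auto.
    now apply in_slice_eq_0. }
  split.
  - intros (f & Hf & Hfh).
    destruct (slice_regular_real_stem D f Hf) as [psi Hpsi].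
    assert (Hsq := proj1 (complex_stem_square D phi psi h f Hphi Hpsi) Hfh).
    destruct Hpsi as (Psym & Pd & _).
    assert (Hpsine : exists z, D z /\ psi z <> RtoC 0).
    { destruct Hphine as (z & Hz & Hz0). exists z. split; auto.
      intros E. apply Hz0. rewrite <- Hsq, E by auto. ring. }
    split.
    + intros q [Hq Hq0].
      destruct (circ_cases D q Hq) as ([x y] & J & Hz & HJ & ->).
      rewrite Hind in Hq0 by auto. apply in_slice_eq_0 in Hq0; auto.
      destruct (Req_dec y 0) as [->|Hy].
      * left.
        destruct (root_real_zero D h phi psi HD Hphi Psym Pd Hsq Hpsine x Hz)
          as (n & Hn & Hev).
        exists x, n. split; [apply in_slice_real|]. auto.
      * right.
        destruct (root_sphere_multiplicity D h phi psi HD Hphi Psym Pd Hsq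
                    Hpsine x y Hz Hy) as (mu & Hmu & H4).
        exists x, y, mu. split; [exact Hy|]. split; [now exists J|].
        split; [|auto].
        now apply (root_sphere_isolated D h phi psi).
    + intros _ x Hx. now apply (root_nonneg_real D h phi psi).
  - intros [Hzeros Hnn].
    assert (Heven : forall z, D z -> even_order phi z).
    { intros z Hz. destruct (Ceq_dec (phi z) (RtoC 0)) as [E|E].
      2:{ exists 0%nat, phi. split; [split|]; auto.
          - apply filter_forall. intros w. simpl. ring.
          - now apply cdiff_continuous, Hd. }
      destruct (Hzeros (in_slice I0 z)) as [(x & n & Eq & Hn & k & ->)|Hsp].
      - split; [apply circ_in_slice; auto using imag_unit_I0|].
        rewrite Hind, E by auto using imag_unit_I0.
        now apply in_slice_eq_0; auto using imag_unit_I0.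
      - rewrite <- (in_slice_real I0) in Eq.
        apply in_slice_inj in Eq; [|apply imag_unit_I0]. subst z.
        destruct (real_multiplicity_order D h phi x _ HO Hc Hphi Hn)
          as (g & Hg & Hgc).
        now exists k, g.
      - destruct Hsp as (x & y & mu & Hy & (J & HJ & Eq) & _ & Hmu & H4).
        destruct (spherical_multiplicity_order D h phi x y mu HO Hc Hphi Hmu)
          as (Hxy & m & g & Em & Hg & Hgc).
        assert (Hxye : even_order phi (x, y)).
        { destruct H4 as [k Hk]. assert (m = (2 * k)%nat) by lia. subst m.
          now exists k, g. }
        change (slice_point x y J) with (in_slice J (x, y)) in Eq.
        assert (Ez : z = (x, y) \/ z = Cconj (x, y)).
        { destruct (to_C_in_slice I0 z imag_unit_I0) as [E1|E1];
            destruct (to_C_in_slice J (x, y) HJ) as [E2|E2];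
            rewrite Eq, E2 in E1.
          - now left.
          - now right.
          - right. now rewrite E1, Cconj_conj.
          - left. rewrite <- (Cconj_conj z), <- E1. apply Cconj_conj. }
        destruct Ez as [-> | ->]; [exact Hxye|].
        now apply (even_order_conj D). }
    destruct (global_sqrt D phi HO Hd Heven (loops_contract D I Hc HI Hsc))
      as [psi Hpsi].
    destruct (symmetric_sqrt D phi psi HD Hsym) as (chi & Csym & Cd & Csq).
    + intros z Hz. destruct (Heven z Hz) as (k & g & Hg & Hgc).
      now exists (2 * k)%nat, g.
    + intros x Hx.
      assert (Hxq : circ D (RtoQ x)).
      { rewrite <- (in_slice_real I0).
        apply circ_in_slice; auto using imag_unit_I0. }
      destruct (Hnn (ex_intro _ x Hxq) x Hxq) as (r & Hr & E).
      exists r. split; auto. apply (in_slice_inj I0); [apply imag_unit_I0|].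
      rewrite <- Hind, in_slice_real, E by auto using imag_unit_I0.
      symmetry. apply in_slice_real.
    + intros z Hz. apply (Hpsi z Hz).
    + intros z Hz. apply (Hpsi z Hz).
    + exists (slice_fun chi).
      assert (Hst := slice_fun_stem D chi Csym Cd).
      split; [now apply complex_stem_regular_real with chi|].
      now apply (complex_stem_square D phi chi).
Qed.
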